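(* Let $N\in\mathbb N$ and $F_n,F\in\mathcal F^N$, $n=1,2,\dots$, with $F_n\to F$ pointwise. Then the following are equivalent: (1) For any $N$ sequences $\{X^i_n\}_{n\in\mathbb N}$, $i=1,\dots,N$, of mm-spaces concentrating to mm-spaces $X^i$ respectively, the sequence $\big(\prod_{i=1}^N X^i_n, d_{F_n}, \bigotimes_{i=1}^N m_{X^i_n}\big)$ concentrates to $\big(\prod_{i=1}^N X^i, d_F, \bigotimes_{i=1}^N m_{X^i}\big)$. (2) For every $(s_1,\dots,s_N)\in[0,+\infty)^N$, $\lim_{n\to\infty}\big(F_n(s_1,\dots,s_N)-\inf\{F_n(s'_1,\dots,s'_N): s_i\le s'_i \ \forall i\}\big)=0$. (3) For every $D>0$, $\lim_{n\to\infty}\sup_{0\le s_i\le D}\big(F_n(s_1,\dots,s_N)-\inf\{F_n(s'_1,\dots,s'_N): s_i\le s'_i\ \forall i\}\big)=0$.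
   Context: An mm-space is a triple $(X,d_X,m_X)$ with $(X,d_X)$ complete separable metric space and $m_X$ a Borel probability measure, considered up to mm-isomorphism. A function $F\colon[0,+\infty)^N\to[0,+\infty)$ is metric preserving if for any metric spaces $(X_1,d_1),\dots,(X_N,d_N)$, $d_F((x_i),(x'_i)):=F(d_1(x_1,x'_1),\dots,d_N(x_N,x'_N))$ is a metric on $\prod X_i$; $\mathcal F^N$ is the set of continuous metric preserving functions on $[0,+\infty)^N$. Concentration: Let $I=[0,1)$ with Lebesgue measure $\mathcal L^1$. A parameter of $X$ is a Borel map $\varphi\colon I\to X$ with $\varphi_*\mathcal L^1=m_X$. Ky Fan metric: $\mathrm{me}(f,g)=\inf\{\varepsilon\ge0:\mathcal L^1(|f-g|>\varepsilon)\le\varepsilon\}$. Observable distance: $d_{\mathrm{conc}}(X,Y)=\inf_{\varphi,\psi}d_H(\{f\circ\varphi: f\in\mathrm{Lip}_1(X)\},\{g\circ\psi: g\in\mathrm{Lip}_1(Y)\})$ over parameters, with $d_H$ the Hausdorff distance w.r.t. the Ky Fan metric. $\{X_n\}$ concentrates to $X$ if $d_{\mathrm{conc}}(X_n,X)\to0$. *)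

(* Defs.v *)
From HB Require Import structures.
From mathcomp Require Import all_boot all_order all_algebra.
From mathcomp Require Import all_classical all_reals all_analysis.
Unset Printing Implicit Defensive.
Import Order.TTheory GRing.Theory Num.Theory.
Import numFieldNormedType.Exports.
Local Open Scope classical_set_scope.
Local Open Scope ring_scope.

Definition is_metric {R : realType} {T : Type} (d : T -> T -> R) : Prop :=
  [/\ (forall x y, 0 <= d x y),
      (forall x y, d x y = 0 <-> x = y),
      (forall x y, d x y = d y x) &
      (forall x y z, d x z <= d x y + d y z)].

Definition dcomplete {R : realType} {T : Type} (d : T -> T -> R) : Prop :=
  forall u : nat -> T,
    (forall e : R, 0 < e -> exists M, forall m n, (M <= m)%N -> (M <= n)%N ->
        d (u m) (u n) < e) ->
    exists x, forall e : R, 0 < e -> exists M, forall n, (M <= n)%N -> d (u n) x < e.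

Definition dseparable {R : realType} {T : Type} (d : T -> T -> R) : Prop :=
  exists u : nat -> T, forall x (e : R), 0 < e -> exists n, d x (u n) < e.

Definition dopen {R : realType} {T : Type} (d : T -> T -> R) : set (set T) :=
  [set U | forall x, U x -> exists2 e : R, 0 < e & [set y | d x y < e] `<=` U].

Definition Borel {R : realType} {T : pointedType} (d : T -> T -> R) :=
  g_sigma_algebraType (dopen d).

Record mmspace (R : realType) := MMSpace {
  mm_T : pointedType ;
  mm_d : mm_T -> mm_T -> R ;
  mm_P : probability (Borel mm_d) R }.
Arguments MMSpace {R mm_T}.
Arguments mm_T {R} m.
Arguments mm_d {R} m _ _.
Arguments mm_P {R} m.

Definition is_mm {R : realType} (X : mmspace R) : Prop :=
  [/\ is_metric (mm_d X), dcomplete (mm_d X) & dseparable (mm_d X)].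

Definition I01 {R : realType} : set R := `[0%R, 1%R[%classic.

Definition parameter {R : realType} (X : mmspace R) (phi : R -> Borel (mm_d X)) : Prop :=
  measurable_fun (I01 : set (measurableTypeR R)) phi /\
  forall A : set (Borel (mm_d X)), measurable A ->
    lebesgue_measure (I01 `&` phi @^-1` A) = mm_P X A.

Definition kyfan {R : realType} (f g : R -> R) : R :=
  inf [set e : R | 0 <= e /\
        (lebesgue_measure (I01 `&` [set t | (e < `|f t - g t|)%R]) <= e%:E)%E].

Definition Lip1 {R : realType} (X : mmspace R) : set (mm_T X -> R) :=
  [set f | forall x y, `|f x - f y| <= mm_d X x y].

Definition hausdorff_kf {R : realType} (A B : set (R -> R)) : \bar R :=
  maxe (ereal_sup [set ereal_inf [set (kyfan a b)%:E | b in B] | a in A])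
       (ereal_sup [set ereal_inf [set (kyfan a b)%:E | a in A] | b in B]).

Definition dconc {R : realType} (X Y : mmspace R) : \bar R :=
  ereal_inf [set r | exists phi psi, parameter X phi /\ parameter Y psi /\
     r = hausdorff_kf [set f \o phi | f in Lip1 X] [set g \o psi | g in Lip1 Y]].

Definition concentrates {R : realType} (Xn : nat -> mmspace R) (X : mmspace R) : Prop :=
  dconc (Xn n) X @[n --> \oo] --> 0%E.

Definition nonneg_vec {R : realType} {N : nat} (s : 'I_N -> R) : Prop :=
  forall i, 0 <= s i.

Definition metric_preserving {R : realType} {N : nat} (F : ('I_N -> R) -> R) : Prop :=
  forall (T : 'I_N -> Type) (d : forall i, T i -> T i -> R),
    (forall i, is_metric (d i)) ->
    is_metric (fun x y : (forall i, T i) => F (fun i => d i (x i) (y i))).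

Definition continuous_on_orthant {R : realType} {N : nat} (F : ('I_N -> R) -> R) : Prop :=
  forall s, nonneg_vec s -> forall e : R, 0 < e -> exists2 delta : R, 0 < delta &
    forall s', nonneg_vec s' -> (forall i, `|s' i - s i| < delta) -> `|F s' - F s| < e.

Definition FN {R : realType} {N : nat} (F : ('I_N -> R) -> R) : Prop :=
  metric_preserving F /\ continuous_on_orthant F.

Definition prodT {N : nat} (T : 'I_N -> pointedType) := {dffun forall i, T i}.
HB.instance Definition _ (N : nat) (T : 'I_N -> pointedType) :=
  Choice.on (prodT T).
HB.instance Definition _ (N : nat) (T : 'I_N -> pointedType) :=
  isPointed.Build (prodT T) [ffun i => point].

Definition dF {R : realType} {N : nat} (F : ('I_N -> R) -> R) (X : 'I_N -> mmspace R) :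
  prodT (fun i => mm_T (X i)) -> prodT (fun i => mm_T (X i)) -> R :=
  fun x y => F (fun i => mm_d (X i) (x i) (y i)).

Definition is_product_measure {R : realType} {N : nat} (F : ('I_N -> R) -> R)
    (X : 'I_N -> mmspace R) (mu : probability (Borel (dF F X)) R) : Prop :=
  forall A : forall i, set (Borel (mm_d (X i))),
    (forall i, measurable (A i)) ->
    mu [set x | forall i, A i (x i)] = (\prod_(i < N) fine (mm_P (X i) (A i)))%:E.

Definition product_mm {R : realType} {N : nat} (F : ('I_N -> R) -> R)
    (X : 'I_N -> mmspace R) (mu : probability (Borel (dF F X)) R) : mmspace R :=
  MMSpace (dF F X) mu.

Definition Finf {R : realType} {N : nat} (F : ('I_N -> R) -> R) (s : 'I_N -> R) : R :=
  inf [set F s' | s' in [set s' | forall i, s i <= s' i]].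

(* Main.v *)
(**
  Couple the factors by parameters [phi_i], [psi_i] and the products by
  composing them with independent uniform variables [theta_i] built from the
  binary digits of [t].  Each factor is cut into small cells.  A set of cells
  lying over one small piece of the limit and having non-negligible mass is, up to a
  small error, as close to almost every point as the piece itself; this
  expansion property passes to finite products by Fubini.  Hence every
  1-Lipschitz function on the product is nearly a 1-Lipschitz function of the
  limit, for any [F_n -> F].  Conversely, functions of the limit lift by McShane
  extension as soon as [F a <= F_n b + e] whenever [a <= b], up to small errors,
  which is condition (3).  Conditions (2) and (3) agree because metric
  preserving functions converging pointwise are equicontinuous.

  If (2) fails at [s], let the limits be two-point spaces of diameter [s_i]
  and let the approximating spaces be two clusters, at distance [s_i], of
  truncated high-dimensional cubes in which most distances equal [tau_i].  By
  the first half a 1-Lipschitz function on the product is nearly constant on the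
  clusters, and the two extreme clusters are typically at distance
  [F_n (s + tau)], less than [F s] by a definite amount.  The weights of the
  clusters are chosen with distinct subset sums, so the law of a function
  identifies its values on each cluster, and no function can imitate the distance
  to a vertex of the limit.
*)
Require Import Defs.
From HB Require Import structures.
From mathcomp Require Import all_boot all_order all_algebra.
From mathcomp Require Import all_classical all_reals all_analysis.
From mathcomp Require Import measurable_realfun ring lra.
Import Order.TTheory GRing.Theory Num.Theory.
Import numFieldNormedType.Exports.
Local Open Scope classical_set_scope.
Local Open Scope ring_scope.
Set Implicit Arguments.
Unset Strict Implicit.

(** The obstacle is that members of [FN] need not be monotone. To bound [Fn n b] by [F a], the two
    vectors must be close in every coordinate, whereas a coupling of close spaces controls one side
    only: distances in the limit are at most those in [X i] up to an error, but in a cube two points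
    over the same limit point are usually far apart. Expansion circumvents this: given [t], [t'] and
    a 1-Lipschitz [f], it provides a point [u] over the same piece of the limit as [t], where [f] is
    not much larger than at [t], and whose distance to [t'] is right in all coordinates at once.

    The order of choices matters: the pieces of the limit are fixed by the limit and by [e], then
    the expansion constants, and only then the closeness [eta] of the factors. The number of cells
    of [X i], possibly unbounded along the sequence, enters no constant.

    In the converse, [dconc] may be realised by parameters that ignore the clusters, so functions
    can be compared only through their laws. *)

(** * Metric preserving functions *)

Section PlaneMetric.
Context {R : realType}.

Definition plane_dist (x y : R * R) : R :=
  Num.max `|x.1 - y.1| `|x.2 - y.2|.

Lemma plane_dist_metric : is_metric plane_dist.
Proof.
split=> [x y|x y|x y|x y z]; rewrite /plane_dist.
- by rewrite le_max normr_ge0.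
- split=> [h|->]; last by rewrite !subrr normr0 maxxx.
  have h1 : `|x.1 - y.1| <= 0 by rewrite -h le_max lexx.
  have h2 : `|x.2 - y.2| <= 0 by rewrite -h le_max lexx orbT.
  move: h1 h2; rewrite !normr_le0 !subr_eq0 => /eqP h1 /eqP h2.
  by rewrite (surjective_pairing x) (surjective_pairing y) h1 h2.
- by rewrite distrC (distrC x.2).
- rewrite ge_max; apply/andP; split.
  + by apply: (le_trans (ler_distD y.1 _ _)); apply: lerD; rewrite le_max lexx.
  + by apply: (le_trans (ler_distD y.2 _ _)); apply: lerD; rewrite le_max lexx orbT.
Qed.

End PlaneMetric.

Section MetricPreserving.
Context {R : realType} {N : nat}.
Implicit Types (F : ('I_N -> R) -> R) (a b c : 'I_N -> R).

(* Three points at distances a, b, c embed into the plane with the sup metric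
   as (0, a), (a, 0), (b, c), also when some of the distances vanish. *)
Lemma metric_preserving_triplet F a b c : metric_preserving F ->
  nonneg_vec a -> nonneg_vec b -> nonneg_vec c ->
  (forall i, a i <= b i + c i) -> (forall i, b i <= a i + c i) ->
  (forall i, c i <= a i + b i) ->
  F a <= F b + F c.
Proof.
move=> Fmp a0 b0 c0 abc bac cab.
have [_ _ _ tri] := Fmp (fun=> (R * R)%type) (fun=> plane_dist)
  (fun=> plane_dist_metric).
have := tri (fun i => (0, a i)) (fun i => (b i, c i)) (fun i => (a i, 0)).
rewrite /plane_dist /=.
have -> : (fun i => Num.max `|0 - a i| `|a i - 0|) = a.
  by apply/funext => i; rewrite sub0r subr0 normrN maxxx ger0_norm.
have -> : (fun i => Num.max `|0 - b i| `|a i - c i|) = b.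
  apply/funext => i; rewrite sub0r normrN ger0_norm //; apply/max_idPl.
  by rewrite ler_norml; apply/andP; split; have := abc i; have := bac i; have := cab i; lra.
suff -> : (fun i => Num.max `|b i - a i| `|c i - 0|) = c by [].
apply/funext => i; rewrite subr0 (ger0_norm (c0 i)); apply/max_idPr.
by rewrite ler_norml; apply/andP; split; have := abc i; have := bac i; have := cab i; lra.
Qed.

Lemma metric_preserving_ge0 F a : metric_preserving F -> nonneg_vec a -> 0 <= F a.
Proof.
move=> Fmp a0; have := @metric_preserving_triplet F a a a Fmp a0 a0 a0.
have h i : a i <= a i + a i by have := a0 i; lra.
by move=> /(_ h h h); lra.
Qed.

Lemma metric_preserving0 F : metric_preserving F -> F (fun=> 0) = 0.
Proof.
move=> Fmp; have [_ d0 _ _] := Fmp (fun=> (R * R)%type) (fun=> plane_dist)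
  (fun=> plane_dist_metric).
have := (d0 (fun=> (0, 0)) (fun=> (0, 0))).2 erefl.
by rewrite /plane_dist /= subrr normr0 maxxx.
Qed.

Lemma metric_preserving_eq0 F a : metric_preserving F -> nonneg_vec a ->
  F a = 0 -> a = fun=> 0.
Proof.
move=> Fmp a0 Fa0; have [_ d0 _ _] := Fmp (fun=> (R * R)%type) (fun=> plane_dist)
  (fun=> plane_dist_metric).
have := (d0 (fun i => (a i, 0)) (fun=> (0, 0))).1.
rewrite /plane_dist /= subrr normr0.
have -> : (fun i => Num.max `|a i - 0| 0) = a.
  by apply/funext => i; rewrite subr0 ger0_norm //; apply/max_idPl.
by move=> /(_ Fa0) h; apply/funext => i; have := congr1 (fun g => (g i).1) h.
Qed.

(** The triple [a], [b], [b] satisfies the triangle inequalities. This is the available substitute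
    for monotonicity. *)
Lemma metric_preserving_double F a b : metric_preserving F ->
  nonneg_vec a -> nonneg_vec b -> (forall i, a i <= 2 * b i) -> F a <= 2 * F b.
Proof.
move=> Fmp a0 b0 ab; suff : F a <= F b + F b by lra.
by apply: metric_preserving_triplet => // i; have := ab i; have := a0 i; have := b0 i; lra.
Qed.

(** The triple [a], [b], [|a - b|] is a triangle in every coordinate, so smallness of [F] near the
    origin gives a modulus of continuity everywhere. *)
Lemma metric_preserving_dist F a b : metric_preserving F ->
  nonneg_vec a -> nonneg_vec b -> F a <= F b + F (fun i => `|a i - b i|).
Proof.
move=> Fmp a0 b0; apply: metric_preserving_triplet => // i; have := a0 i; have := b0 i;
  case: (ger0P (a i - b i)); lra.
Qed.

Lemma Finf_le F a b : metric_preserving F -> nonneg_vec a -> (forall i, a i <= b i) ->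
  Finf F a <= F b.
Proof.
move=> Fmp a0 ab; apply: ge_inf; last by exists b.
exists 0 => _ [c ac <-]; apply: metric_preserving_ge0 => // i.
exact: le_trans (a0 i) (ac i).
Qed.

Lemma le_Finf F a (x : R) : (forall b, (forall i, a i <= b i) -> x <= F b) -> x <= Finf F a.
Proof.
move=> h; apply: lb_le_inf; first by exists (F a), a.
by move=> _ [b ab <-]; exact: h.
Qed.

(** Translation by [a - b] sends each vector above [b] to one above [a] and moves it by exactly
    [|a - b|] in each coordinate. *)
Lemma Finf_dist F a b : metric_preserving F -> nonneg_vec a -> nonneg_vec b ->
  Finf F a <= Finf F b + F (fun i => `|a i - b i|).
Proof.
move=> Fmp a0 b0; rewrite -lerBlDr; apply: le_Finf => c bc; rewrite lerBlDr.
have c0 i : 0 <= c i by exact: le_trans (b0 i) (bc i).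
pose c' i := c i + (a i - b i).
have ac' i : a i <= c' i by rewrite /c'; have := bc i; lra.
apply: (le_trans (@Finf_le F a c' Fmp a0 ac')).
have := @metric_preserving_dist F c' c Fmp (fun i => le_trans (a0 i) (ac' i)) c0.
suff -> : (fun i => `|c' i - c i|) = (fun i => `|a i - b i|) by [].
by apply/funext => i; rewrite /c'; congr (`| _ |); lra.
Qed.

End MetricPreserving.

(** * From pointwise to uniform convergence *)

Section Uniform.
Context {R : realType} {N : nat}.

(** With [metric_preserving_dist] this is uniform equicontinuity of the tail of the sequence on the
    whole orthant. *)
Definition evt_small_near0 (Fn : nat -> ('I_N -> R) -> R) := forall e : R, 0 < e ->
  exists2 del : R, 0 < del & exists n0, forall n, (n0 <= n)%N -> forall v, nonneg_vec v ->
    (forall i, v i <= del) -> Fn n v <= e.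

Lemma FN_small_near0 (F : ('I_N -> R) -> R) : FN F -> forall e : R, 0 < e ->
  exists2 del : R, 0 < del & forall v, nonneg_vec v -> (forall i, v i <= del) -> F v <= e.
Proof.
move=> [Fmp Fc] e e0.
have [del del0 h] := Fc (fun=> 0) (fun=> lexx 0) e e0.
exists (del / 2); first by lra.
move=> v v0 vd; have := h v v0.
have hv i : `|v i - 0| < del by rewrite subr0 ger0_norm //; have := vd i; lra.
move=> /(_ hv); rewrite metric_preserving0 // subr0 ger0_norm ?metric_preserving_ge0 //.
exact: ltW.
Qed.

(** Convergence at the single constant vector [del] suffices: by [metric_preserving_double] the
    value there controls [Fn n] on the whole box below it. *)
Lemma FN_evt_small_near0 (Fn : nat -> ('I_N -> R) -> R) (F : ('I_N -> R) -> R) :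
  (forall n, FN (Fn n)) -> FN F ->
  (forall s, nonneg_vec s -> Fn n s @[n --> \oo] --> F s) ->
  evt_small_near0 Fn.
Proof.
move=> FnN FNF FnF e e0.
have [del del0 hdel] := FN_small_near0 FNF (e := e / 4) ltac:(lra).
exists del => //.
have dnn : nonneg_vec ((fun=> del) : 'I_N -> R) by move=> i; exact: ltW.
have /cvgrPdist_le /(_ (e / 4) ltac:(lra)) [n0 _ hn0] := FnF (fun=> del) dnn.
exists n0 => n n0n v v0 vd.
have := @metric_preserving_double _ _ (Fn n) v (fun=> del) (FnN n).1 v0 dnn.
have hv i : v i <= 2 * del by have := vd i; lra.
move=> /(_ hv); have := hn0 n n0n; have := hdel (fun=> del) dnn (fun=> lexx _).
by rewrite /= ler_norml => h /andP[h1 h2]; lra.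
Qed.

Definition box (D : R) : set ('I_N -> R) := [set s | forall i, 0 <= s i <= D].

(** Convergence on a finite grid of mesh [del] is uniform, and equicontinuity carries it to the box.
    The lemma serves both [|Fn n - F|] and the gap of condition (2). *)
Lemma box_uniform (H : nat -> ('I_N -> R) -> R) (D : R) : 0 < D ->
  (forall s, nonneg_vec s -> H n s @[n --> \oo] --> 0) ->
  (forall e : R, 0 < e -> exists2 del : R, 0 < del & exists n0, forall n, (n0 <= n)%N ->
     forall a b, nonneg_vec a -> nonneg_vec b -> (forall i, `|a i - b i| <= del) ->
       H n a <= H n b + e) ->
  forall e : R, 0 < e -> exists n0, forall n, (n0 <= n)%N -> forall s, box D s -> H n s <= e.
Proof.
move=> D0 Hc Heq e e0.
have [del del0 [n1 h1]] := Heq (e / 2) ltac:(lra).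
pose M := (Num.truncn (D / del)).+1.
pose grid (f : {ffun 'I_N -> 'I_M}) : 'I_N -> R := fun i => (f i)%:R * del.
have grid0 f : nonneg_vec (grid f) by move=> i; rewrite mulr_ge0 // ltW.
have hgrid : \forall n \near \oo, forall f, H n (grid f) <= e / 2.
  have := @filter_forall _ {ffun 'I_N -> 'I_M} (fun f n => H n (grid f) <= e / 2) \oo _.
  apply => f.
  have /cvgrPdist_le /(_ (e / 2) ltac:(lra)) := Hc (grid f) (grid0 f).
  by apply: filterS => n; rewrite sub0r normrN ler_norml => /andP[].
have [n2 _ h2] := hgrid.
exists (maxn n1 n2) => n; rewrite geq_max => /andP[n1n n2n] s sD.
have s0 : nonneg_vec s by move=> i; have /andP[] := sD i.
have hM i : (Num.truncn (s i / del) < M)%N.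
  rewrite ltnS; apply: le_truncn; have /andP[_ h] := sD i.
  by rewrite ler_pM2r // invr_gt0.
pose f : {ffun 'I_N -> 'I_M} := [ffun i => Ordinal (hM i)].
apply: (@le_trans _ _ (H n (grid f) + e / 2)); last first.
  by have := h2 n n2n f; rewrite /=; lra.
apply: h1 => // i; rewrite /grid ffunE /=.
have sdel0 : 0 <= s i / del by rewrite divr_ge0 // ltW.
have /andP[] := truncn_itv sdel0.
rewrite ler_pdivlMr // ltr_pdivrMr // -natr1 mulrDl mul1r => ? ?.
by rewrite ger0_norm; lra.
Qed.

Context (Fn : nat -> ('I_N -> R) -> R) (F : ('I_N -> R) -> R).
Hypotheses (FnN : forall n, FN (Fn n)) (FNF : FN F)
  (FnF : forall s, nonneg_vec s -> Fn n s @[n --> \oo] --> F s).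

Lemma absvec0 (a b : 'I_N -> R) : nonneg_vec (fun i => `|a i - b i|).
Proof. by move=> i. Qed.

Lemma FN_box_uniform (D e : R) : 0 < D -> 0 < e -> exists n0, forall n, (n0 <= n)%N ->
  forall s, box D s -> `|Fn n s - F s| <= e.
Proof.
move=> D0 e0.
pose H n s := `|Fn n s - F s|.
have := @box_uniform H D D0 _ _ e e0; apply.
  move=> s s0; rewrite /H -(normr0 R) -(subrr (F s)).
  by apply: cvg_norm; apply: cvgB; [exact: FnF|exact: cvg_cst].
move=> e' e'0.
have [d1 d10 [n1 h1]] := FN_evt_small_near0 FnN FNF FnF (e := e' / 2) ltac:(lra).
have [d2 d20 h2] := FN_small_near0 FNF (e := e' / 2) ltac:(lra).
exists (Num.min d1 d2); first by rewrite lt_min d10.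
exists n1 => n n1n a b a0 b0 ab.
have hFn u v : nonneg_vec u -> nonneg_vec v -> (forall i, `|u i - v i| <= d1) ->
    Fn n u <= Fn n v + e' / 2.
  move=> u0 v0 uv; apply: (le_trans (metric_preserving_dist (FnN n).1 u0 v0)).
  by rewrite lerD2l; apply: h1.
have hF u v : nonneg_vec u -> nonneg_vec v -> (forall i, `|u i - v i| <= d2) ->
    F u <= F v + e' / 2.
  move=> u0 v0 uv; apply: (le_trans (metric_preserving_dist FNF.1 u0 v0)).
  by rewrite lerD2l; apply: h2.
have ab1 i : `|a i - b i| <= d1 by have := ab i; rewrite le_min => /andP[].
have ab2 i : `|a i - b i| <= d2 by have := ab i; rewrite le_min => /andP[].
have ba1 i : `|b i - a i| <= d1 by rewrite distrC.
have ba2 i : `|b i - a i| <= d2 by rewrite distrC.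
have := hFn a b a0 b0 ab1; have := hFn b a b0 a0 ba1.
have := hF a b a0 b0 ab2; have := hF b a b0 a0 ba2.
rewrite /H; case: (ger0P (Fn n a - F a)); case: (ger0P (Fn n b - F b)); lra.
Qed.

Lemma Finf_gap_ge0 n s : nonneg_vec s -> 0 <= Fn n s - Finf (Fn n) s.
Proof. by move=> s0; rewrite subr_ge0; apply: Finf_le => //; exact: (FnN n).1. Qed.

Lemma Finf_box_uniform (D e : R) :
  (forall s, nonneg_vec s -> Fn n s - Finf (Fn n) s @[n --> \oo] --> 0) ->
  0 < D -> 0 < e -> exists n0, forall n, (n0 <= n)%N ->
  forall s, box D s -> Fn n s - Finf (Fn n) s <= e.
Proof.
move=> c2 D0 e0.
apply: (@box_uniform (fun n s => Fn n s - Finf (Fn n) s) D D0 c2 _ e e0).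
move=> e' e'0.
have [d1 d10 [n1 h1]] := FN_evt_small_near0 FnN FNF FnF (e := e' / 2) ltac:(lra).
exists d1 => //; exists n1 => n n1n a b a0 b0 ab.
have := metric_preserving_dist (FnN n).1 a0 b0.
have := Finf_dist (FnN n).1 b0 a0.
have ba i : `|b i - a i| <= d1 by rewrite distrC.
have := h1 n n1n _ (absvec0 a b) ab; have := h1 n n1n _ (absvec0 b a) ba; lra.
Qed.

(** [sup] takes a default value on unbounded sets; boundedness makes the supremum of condition (3) a
    genuine one. *)
Lemma gap_box_bounded n (D : R) : 0 < D ->
  has_ubound [set Fn n s - Finf (Fn n) s | s in box D].
Proof.
move=> D0; exists (2 * Fn n (fun=> D)) => _ [s sD <-].
have s0 : nonneg_vec s by move=> i; have /andP[] := sD i.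
have Dnn : nonneg_vec ((fun=> D) : 'I_N -> R) by move=> i; exact: ltW.
have h0 : 0 <= Finf (Fn n) s.
  apply: le_Finf => b sb; apply: metric_preserving_ge0; first exact: (FnN n).1.
  by move=> i; exact: le_trans (s0 i) (sb i).
have sD2 i : s i <= 2 * D by have /andP[_ ] := sD i; lra.
have := metric_preserving_double (FnN n).1 s0 Dnn sD2; lra.
Qed.

Lemma gap_pointwise_sup :
  (forall s, nonneg_vec s -> Fn n s - Finf (Fn n) s @[n --> \oo] --> 0) ->
  forall D : R, 0 < D ->
    sup [set Fn n s - Finf (Fn n) s | s in box D] @[n --> \oo] --> 0.
Proof.
move=> c2 D D0; apply/cvgrPdist_le => e e0.
have [n0 h0] := Finf_box_uniform c2 D0 e0.
exists n0 => // n /h0 hn.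
have z0 : box D (fun=> 0) by move=> i; rewrite lexx ltW.
have hne : [set Fn n s - Finf (Fn n) s | s in box D] !=set0.
  by exists (Fn n (fun=> 0) - Finf (Fn n) (fun=> 0)), (fun=> 0).
rewrite sub0r normrN ger0_norm.
  by apply: ge_sup => // _ [s sD <-]; exact: hn.
apply: (le_trans (Finf_gap_ge0 n (fun=> lexx 0))).
by apply: ub_le_sup; [exact: gap_box_bounded|exists (fun=> 0)].
Qed.

Lemma sup_gap_le (D e : R) :
  sup [set Fn n s - Finf (Fn n) s | s in box D] @[n --> \oo] --> 0 ->
  0 < D -> 0 < e -> exists n0, forall n, (n0 <= n)%N ->
    forall s, box D s -> Fn n s - Finf (Fn n) s <= e.
Proof.
move=> c3 D0 e0; have /cvgrPdist_le /(_ e e0) [n0 _ h0] := c3.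
exists n0 => n /h0; rewrite /= sub0r normrN => hn s sD.
apply: le_trans (le_trans (ler_norm _) hn).
by apply: ub_le_sup; [exact: gap_box_bounded|exists s].
Qed.

(* Only here does condition (3) enter: it replaces monotonicity of [F]. *)
Lemma FN_lower_perturb (D e : R) :
  (forall D : R, 0 < D ->
    sup [set Fn n s - Finf (Fn n) s | s in box D] @[n --> \oo] --> 0) ->
  0 < D -> 0 < e -> exists2 del : R, 0 < del & exists n0, forall n, (n0 <= n)%N ->
    forall a b, box D a -> nonneg_vec b -> (forall i, a i <= b i + del) ->
      F a <= Fn n b + e.
Proof.
move=> c3 D0 e0.
have [d1 d10 [n1 h1]] := FN_evt_small_near0 FnN FNF FnF (e := e / 3) ltac:(lra).
have [n2 h2] := sup_gap_le (e := e / 3) (c3 D D0) D0 ltac:(lra).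
have [n3 h3] := FN_box_uniform (e := e / 3) D0 ltac:(lra).
exists d1 => //; exists (maxn n1 (maxn n2 n3)) => n.
rewrite !geq_max => /and3P[n1n n2n n3n] a b aD b0 ab.
have a0 : nonneg_vec a by move=> i; have /andP[] := aD i.
pose a' i := Num.max (a i - d1) 0.
have a'0 : nonneg_vec a' by move=> i; rewrite /a' le_max lexx orbT.
have a'D : box D a'.
  by move=> i; rewrite a'0 /= /a' ge_max; have /andP[? ?] := aD i; apply/andP; split; lra.
have a'b i : a' i <= b i by rewrite /a' ge_max b0 andbT; have := ab i; lra.
have haa' i : `|a i - a' i| <= d1.
  rewrite /a' ler_norml; have := a0 i.
  by case: (lerP (a i - d1) 0) => ? ?; apply/andP; split; lra.
have := h3 n n3n a aD; rewrite ler_norml => /andP[? ?].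
have := metric_preserving_dist (FnN n).1 a0 a'0.
have := h1 n n1n _ (absvec0 a a') haa'.
have := h2 n n2n a' a'D; have := Finf_le (FnN n).1 a'0 a'b; lra.
Qed.

Lemma FN_perturb (D e : R) : 0 < D -> 0 < e ->
  exists2 del : R, 0 < del & exists n0, forall n, (n0 <= n)%N ->
    forall a b, box D a -> nonneg_vec b -> (forall i, `|a i - b i| <= del) ->
      Fn n b <= F a + e.
Proof.
move=> D0 e0.
have [d1 d10 [n1 h1]] := FN_evt_small_near0 FnN FNF FnF (e := e / 2) ltac:(lra).
have [n3 h3] := FN_box_uniform (e := e / 2) D0 ltac:(lra).
exists d1 => //; exists (maxn n1 n3) => n.
rewrite !geq_max => /andP[n1n n3n] a b aD b0 ab.
have a0 : nonneg_vec a by move=> i; have /andP[] := aD i.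
have := h3 n n3n a aD; rewrite ler_norml => /andP[? ?].
have ba i : `|b i - a i| <= d1 by rewrite distrC.
have := metric_preserving_dist (FnN n).1 b0 a0.
have := h1 n n1n _ (absvec0 b a) ba; lra.
Qed.

End Uniform.

(** * The unit interval as a probability space *)

Section UnitInterval.
Context {R : realType}.

Lemma measurable_I01 : measurable (I01 : set (measurableTypeR R)).
Proof. exact: measurable_itv. Qed.

(** A probability on the whole line for which the complement of [I01] is null, so that maps defined
    on all of [R] can be used throughout. *)
Definition lebI : set (measurableTypeR R) -> \bar R :=
  mrestr (@lebesgue_measure R) measurable_I01.

HB.instance Definition _ := Measure.on lebI.

Lemma lebI_setT : lebI setT = 1%E.
Proof.
rewrite /lebI /mrestr setTI /I01 lebesgue_measure_itv /= lte_fin ltr01.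
by rewrite sube0.
Qed.

HB.instance Definition _ := Measure_isProbability.Build _ _ _ lebI lebI_setT.

Lemma lebIE (A : set R) : lebesgue_measure (I01 `&` A) = lebI A.
Proof. by rewrite /lebI /mrestr setIC. Qed.

Definition prI (A : set R) : R := fine (lebI A).

Lemma prIE (A : set R) : measurable (A : set (measurableTypeR R)) ->
  lebI A = (prI A)%:E.
Proof. by move=> mA; rewrite /prI fineK //; apply: fin_num_measure. Qed.

Lemma prI_ge0 (A : set R) : 0 <= prI A.
Proof. exact: fine_ge0. Qed.

Lemma prI_setT : prI setT = 1.
Proof. by rewrite /prI lebI_setT. Qed.

Lemma le_prI (A B : set R) : measurable (A : set (measurableTypeR R)) ->
  measurable (B : set (measurableTypeR R)) -> I01 `&` A `<=` B -> prI A <= prI B.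
Proof.
move=> mA mB AB; rewrite -lee_fin -!prIE //= -!lebIE.
apply: le_measure; rewrite ?inE; [exact: measurableI measurable_I01 _| |].
  exact: measurableI measurable_I01 _.
by move=> t [It At]; split=> //; apply: AB.
Qed.

Lemma prIU_le (A B : set R) : measurable (A : set (measurableTypeR R)) ->
  measurable (B : set (measurableTypeR R)) -> prI (A `|` B) <= prI A + prI B.
Proof.
move=> mA mB; rewrite -lee_fin EFinD -!prIE //; last exact: measurableU.
exact: measureU2.
Qed.

Lemma prIC (A : set R) : measurable (A : set (measurableTypeR R)) -> prI (~` A) = 1 - prI A.
Proof.
move=> mA; apply: EFin_inj; rewrite -prIE; last exact: measurableC.
by rewrite (probability_setC lebI mA) /= (prIE mA).
Qed.

Lemma prI_ex (A : set R) : measurable (A : set (measurableTypeR R)) -> 0 < prI A ->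
  exists2 t, I01 t & A t.
Proof.
move=> mA; apply: contraPP => h; apply/negP; rewrite -leNgt.
apply: (le_trans (@le_prI A set0 mA measurable0 _)).
  by move=> t [It At]; apply: h; exists t.
by rewrite /prI measure0.
Qed.

Lemma measurable_fin_preimage (J : finType) (h : R -> J) (Q : J -> Prop) :
  (forall j, measurable ([set t | h t = j] : set (measurableTypeR R))) ->
  measurable ([set t | Q (h t)] : set (measurableTypeR R)).
Proof.
move=> mh; rewrite (_ : [set t | _] = \big[setU/set0]_(j | `[< Q j >]) [set t | h t = j]).
  exact: bigsetU_measurable.
rewrite -bigcup_seq_cond; apply/seteqP; split => t /=.
  by move=> Qt; exists (h t) => //=; rewrite mem_index_enum asboolE.
by move=> [j /= /andP[_ /asboolP Qj] ->].
Qed.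

Lemma prI_fin (J : finType) (h : R -> J) (Q : pred J) :
  (forall j, measurable ([set t | h t = j] : set (measurableTypeR R))) ->
  prI [set t | Q (h t)] = \sum_(j | Q j) prI [set t | h t = j].
Proof.
move=> mh; apply: EFin_inj; rewrite -prIE; last exact: (measurable_fin_preimage Q mh).
rewrite -sumEFin.
have -> : [set t | Q (h t)] = \bigcup_(j in [set j | Q j]) [set t | h t = j].
  by apply/seteqP; split => t /= => [Qt|[j Qj ->//]]; exists (h t).
rewrite measure_fin_bigcup //=.
- rewrite -(@bigfs _ _ _ _ (index_enum J) Q) ?index_enum_uniq //=; last first.
    by move=> j _; rewrite mem_index_enum.
  by apply: eq_bigr => j _; rewrite -prIE.
- by move=> i j _ _ [t [/= -> ->]].
Qed.

End UnitInterval.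

(** * Binary digits *)

Section BinaryDigits.
Context {R : realType}.
Implicit Types (t x : R).

(** Digits are read off the orbit of the doubling map: each application drops the leading digit,
    which suits induction on the number of digits. *)
Definition doubling t : R := if t < 2^-1 then 2 * t else 2 * t - 1.
Definition bit (k : nat) t : bool := 2^-1 <= iter k doubling t.

Lemma bitS k t : bit k.+1 t = bit k (doubling t).
Proof. by rewrite /bit iterSr. Qed.

Definition dyad (c : nat -> bool) (m : nat) : R := \sum_(k < m) (c k)%:R * 2^-1 ^+ k.+1.

Lemma dyadS (c : nat -> bool) m : dyad c m.+1 = ((c 0%N)%:R + dyad (fun k => c k.+1) m) / 2.
Proof.
rewrite /dyad big_ord_recl /= expr1 mulrDl; congr (_ + _).
rewrite mulr_suml; apply: eq_bigr => k _.
by rewrite /bump /= add1n (exprS _ k.+1); ring.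
Qed.

Lemma dyad_bound (c : nat -> bool) m : 0 <= dyad c m /\ dyad c m + 2^-1 ^+ m <= 1.
Proof.
elim: m c => [|m IH] c; first by rewrite /dyad big_ord0 expr0 add0r.
have [h1 h2] := IH (fun k => c k.+1).
rewrite dyadS exprS; move: (2^-1 ^+ m) h2 => y h2.
by case: (c 0%N) => /=; split; lra.
Qed.

(** Induction through [doubling], which maps each half of [I01] affinely onto [I01] and shifts the
    digits. *)
Lemma bits_dyad m (c : nat -> bool) t :
  (I01 t /\ forall k, (k < m)%N -> bit k t = c k) <-> dyad c m <= t < dyad c m + 2^-1 ^+ m.
Proof.
elim: m c t => [|m IH] c t.
  rewrite /dyad big_ord0 expr0 add0r /I01 /= in_itv /=; split=> [[]//|tI]; split=> //.
have [b1 b2] := dyad_bound (fun k => c k.+1) m.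
have IH' := IH (fun k => c k.+1) (doubling t).
rewrite dyadS exprS; move: (dyad _ m) b1 b2 IH' => z b1 b2 IH'.
have y0 : 0 < 2^-1 ^+ m :> R by rewrite exprn_gt0 // invr_gt0.
move: (2^-1 ^+ m) y0 b2 IH' => y y0 b2 IH'.
have dI : I01 t -> I01 (doubling t).
  rewrite /I01 /doubling /= !in_itv /= => /andP[? ?].
  by case: ltP => ?; apply/andP; split; lra.
split=> [[It bt]|].
  have /IH' : I01 (doubling t) /\ forall k, (k < m)%N -> bit k (doubling t) = c k.+1.
    by split=> [|k km]; [exact: dI|rewrite -bitS; exact: bt].
  rewrite /doubling -(bt 0%N) // /bit /=.
  by case: ltP => ? /andP[? ?] /=; apply/andP; split; lra.
move=> zt.
have c0 : c 0%N = (2^-1 <= t).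
  move: zt; case: (c 0%N) => /= /andP[? ?]; apply/esym; first by lra.
  by apply/negbTE; rewrite -ltNge; lra.
have It : I01 t.
  move: zt; rewrite /I01 /= in_itv /=.
  by case: (c 0%N) => /= /andP[? ?]; apply/andP; split; lra.
have /IH'[_ h] : z <= doubling t < z + y.
  by move: zt; rewrite c0 /doubling; case: (ltP t 2^-1) => /= ? /andP[? ?]; apply/andP; split; lra.
split=> // -[_|k km]; first by rewrite c0.
by rewrite bitS; exact: h.
Qed.

Lemma measurable_doubling : measurable_fun setT (doubling : measurableTypeR R -> measurableTypeR R).
Proof.
apply: measurable_fun_ifT.
- by apply: measurable_fun_ltr => //; exact: measurable_id.
- by apply: measurable_funM => //; exact: measurable_id.
- apply: measurable_funB => //; apply: measurable_funM => //; exact: measurable_id.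
Qed.

Lemma measurable_bit k b : measurable ([set t | bit k t = b] : set (measurableTypeR R)).
Proof.
have mit : measurable_fun setT (iter k doubling : measurableTypeR R -> measurableTypeR R).
  elim: k => [|k IH]; first exact: measurable_id.
  exact: (measurableT_comp measurable_doubling IH).
have : measurable_fun setT (bit k : measurableTypeR R -> bool).
  by apply: measurable_fun_ler => //; exact: measurable_cst.
by move=> /(_ measurableT [set b] Logic.I); rewrite setTI.
Qed.

Definition pattern m t : {ffun 'I_m -> bool} := [ffun k : 'I_m => bit k t].

Lemma measurable_pattern m (c : {ffun 'I_m -> bool}) :
  measurable ([set t | pattern m t = c] : set (measurableTypeR R)).
Proof.
have -> : [set t | pattern m t = c] = \bigcap_(k : 'I_m) [set t | bit k t = c k].
  apply/seteqP; split => t /= => [<- k _ /=|h]; first by rewrite ffunE.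
  by apply/ffunP => k; rewrite ffunE; exact: h.
by apply: fin_bigcap_measurable => // k _; exact: measurable_bit.
Qed.

Lemma prI_pattern m (c : {ffun 'I_m -> bool}) : prI [set t : R | pattern m t = c] = 2^-1 ^+ m.
Proof.
(* [dyad] expects digits indexed by all naturals; the value past [m] is arbitrary. *)
pose c' k := if insub k is Some i then c i else false.
have [b1 b2] := dyad_bound c' m.
rewrite /prI -lebIE.
have -> : I01 `&` [set t | pattern m t = c] = `[dyad c' m, dyad c' m + 2^-1 ^+ m[%classic.
  apply/seteqP; split => t; rewrite /= ?in_itv /=.
    move=> [It /ffunP ct]; apply/bits_dyad; split=> // k km.
    by have := ct (Ordinal km); rewrite ffunE /= => ->; rewrite /c' insubT.
  move=> /bits_dyad[It ct]; split=> //; apply/ffunP => k; rewrite ffunE ct //.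
  by rewrite /c' valK.
rewrite lebesgue_measure_itv /= lte_fin ltrDl exprn_gt0 ?invr_gt0 //.
by rewrite -EFinB /= addrC addKr.
Qed.

Definition digits_val m (c : {ffun 'I_m -> bool}) : R := \sum_(k < m) (c k)%:R * 2^-1 ^+ k.+1.

Lemma prI_digits m (A : set R) :
  prI [set t | A (digits_val (pattern m t))] =
  \sum_(c : {ffun 'I_m -> bool} | `[< A (digits_val c) >]) 2^-1 ^+ m.
Proof.
have := @prI_fin R _ (pattern m) (fun c => `[< A (digits_val c) >]) (measurable_pattern (m := m)).
under eq_bigr => c _ do rewrite prI_pattern.
by move=> <-; congr prI; apply/seteqP; split => t /= /asboolP.
Qed.

Lemma digits_val_le m (t : R) : I01 t ->
  digits_val (pattern m t) <= t < digits_val (pattern m t) + 2^-1 ^+ m.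
Proof.
move=> It; have := (bits_dyad m (bit^~ t) t).1 (conj It (fun _ _ => erefl)).
suff -> : dyad (bit^~ t) m = digits_val (pattern m t) by [].
by apply: eq_bigr => k _; rewrite ffunE.
Qed.

End BinaryDigits.

(** * Independent uniform variables from one *)

Section IndependentUniforms.
Context {R : realType} {N : nat}.
Implicit Types (t x : R).

(** The digits of [t] are dealt out by residue class modulo [N]; disjoint sets of digits give
    independent variables. *)
Definition thetan (i : 'I_N) (m : nat) t : R :=
  \sum_(k < m) (bit (k * N + i) t)%:R * 2^-1 ^+ k.+1.

(** The partial sums are nondecreasing, so their limit is a supremum, and exceeding [x] becomes an
    increasing union of events on finitely many digits. *)
Definition theta (i : 'I_N) t : R := sup (range (thetan i ^~ t)).

Lemma deal_subproof m (k : 'I_m) (i : 'I_N) : (k * N + i < m * N)%N.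
Proof. by rewrite (@leq_trans (k.+1 * N)) ?leq_mul2r ?ltn_ord ?orbT // mulSn addnC ltn_add2r. Qed.

Definition deal_index m (k : 'I_m) (i : 'I_N) : 'I_(m * N) := Ordinal (deal_subproof k i).

Definition deal m (c : {ffun 'I_(m * N) -> bool}) : {ffun 'I_N -> {ffun 'I_m -> bool}} :=
  [ffun i => [ffun k => c (deal_index k i)]].

Lemma deal_bij m : bijective (@deal m).
Proof.
apply: inj_card_bij; last by rewrite !card_ffun !card_ord card_bool expnM.
move=> c c' cc'; apply/ffunP => q.
have N0 : (0 < N)%N by case: N q {c c' cc'} => // -[q]; rewrite muln0.
have qm : (q %/ N < m)%N by rewrite ltn_divLR.
have qN : (q %% N < N)%N by rewrite ltn_mod.
have -> : q = deal_index (Ordinal qm) (Ordinal qN) by apply: val_inj; rewrite /= -divn_eq.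
by have /ffunP/(_ (Ordinal qN))/ffunP/(_ (Ordinal qm)) := cc'; rewrite !ffunE.
Qed.

Lemma thetan_deal i m t : thetan i m t = digits_val (deal (pattern (m * N) t) i).
Proof. by apply: eq_bigr => k _; rewrite !ffunE. Qed.

(** All [m * N] digit patterns are equally likely and [deal] is a bijection, so independence reduces
    to counting in a product of finite sets. *)
Lemma prI_thetan m (A : 'I_N -> set R) :
  prI [set t | forall i, A i (thetan i m t)] =
  \prod_i prI [set t | A i (digits_val (pattern m t))].
Proof.
pose Q (d : {ffun 'I_N -> {ffun 'I_m -> bool}}) := [forall i, `[< A i (digits_val (d i)) >]].
have -> : [set t | forall i, A i (thetan i m t)] = [set t | Q (deal (pattern (m * N) t))].
  apply/seteqP; split => t /=.
    by move=> h; apply/forallP => i; apply/asboolP; rewrite -thetan_deal.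
  by move=> /forallP h i; have /asboolP := h i; rewrite -thetan_deal.
rewrite (@prI_fin R _ (pattern (m * N)) (fun c => Q (deal c))); last exact: measurable_pattern.
rewrite (eq_bigr (fun=> 2^-1 ^+ (m * N))); last by move=> c _; exact: prI_pattern.
transitivity (\sum_(d | Q d) (2^-1 : R) ^+ (m * N)).
  by rewrite [RHS](reindex (@deal m)) //=; exact: onW_bij (deal_bij m).
under [RHS]eq_bigr => i _ do rewrite prI_digits big_mkcond.
rewrite bigA_distr_bigA /= big_mkcond /=; apply: eq_bigr => d _.
rewrite /Q; case: (boolP [forall i, _]) => [/forallP h|/forallPn[i hi]].
  under eq_bigr => i _ do rewrite h.
  by rewrite prodr_const card_ord -exprM.
by rewrite (bigD1 i) //= (negbTE hi) mul0r.
Qed.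

Lemma thetan_nd i t : {homo thetan i ^~ t : m n / (m <= n)%N >-> m <= n}.
Proof.
move=> m n mn; rewrite /thetan.
rewrite -(big_mkord xpredT (fun k => (bit (k * N + i) t)%:R * 2^-1 ^+ k.+1)).
rewrite -(big_mkord xpredT (fun k => (bit (k * N + i) t)%:R * 2^-1 ^+ k.+1)).
rewrite [leRHS](big_cat_nat (n := m)) //= lerDl; apply: sumr_ge0 => k _.
by rewrite mulr_ge0 // exprn_ge0 // invr_ge0.
Qed.

Lemma thetan_le1 i m t : thetan i m t <= 1.
Proof.
have := (dyad_bound (R := R) (fun k => bit (k * N + i) t) m).2.
have y0 : 0 < 2^-1 ^+ m :> R by rewrite exprn_gt0 // invr_gt0.
by rewrite -[dyad _ _]/(thetan i m t); lra.
Qed.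

Lemma theta_gt i t x : x < theta i t <-> exists m, x < thetan i m t.
Proof.
have hs : has_sup (range (thetan i ^~ t)).
  by split; [exists (thetan i 0 t), 0%N|exists 1 => _ [m _ <-]; exact: thetan_le1].
split=> [/(sup_gt hs.1)[_ [m _ <-]]|[m xm]]; first by exists m.
by apply: (lt_le_trans xm); apply: ub_le_sup; [exact: hs.2|exists m].
Qed.

Lemma measurable_thetan_gt m (x : 'I_N -> R) :
  measurable ([set t | forall i, x i < thetan i m t] : set (measurableTypeR R)).
Proof.
have := @measurable_fin_preimage R _ (pattern (m * N))
  (fun c => forall i, x i < digits_val (deal c i)) (measurable_pattern (m := m * N)).
congr measurable; apply/seteqP.
by split => t /= h i; have := h i; rewrite thetan_deal.
Qed.

Lemma measurable_theta i :
  measurable_fun setT (theta i : measurableTypeR R -> measurableTypeR R).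
Proof.
apply: (measurability _ (RGenOInfty.measurableE R)) => _ [_ [x ->] <-]; rewrite setTI.
have -> : theta i @^-1` `]x, +oo[ = \bigcup_m [set t | x < thetan i m t].
  apply/seteqP; split => t /=; rewrite in_itv /= andbT.
    by move=> /theta_gt[m]; exists m.
  by move=> [m _ xm]; apply/theta_gt; exists m.
apply: bigcupT_measurable => m.
have := @measurable_fin_preimage R _ (pattern (m * N))
  (fun c => x < digits_val (deal c i)) (measurable_pattern (m := m * N)).
by congr measurable; apply/seteqP; split => t /=; rewrite thetan_deal.
Qed.

(** Truncation to [m] digits moves a point down by less than [2^-m], so the two events differ inside
    an interval of that length. *)
Lemma prI_digits_gt_cvg x :
  prI [set t : R | x < digits_val (pattern m t)] @[m --> \oo] --> prI [set t : R | x < t].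
Proof.
have mD m : measurable ([set t | x < digits_val (pattern m t)] : set (measurableTypeR R)).
  exact: (measurable_fin_preimage (fun c => x < digits_val c) (measurable_pattern (m := m))).
have mG : measurable ([set t | x < t] : set (measurableTypeR R)).
  have -> : [set t | x < t] = `]x, +oo[%classic.
    by apply/seteqP; split => t /=; rewrite in_itv /= andbT.
  exact: measurable_itv.
apply/cvgrPdist_le => e e0.
have [m0 hm0] : exists m0, 2^-1 ^+ m0 <= e :> R.
  have /cvgrPdist_le/(_ e e0)[m0 _ h] := @cvg_expr R (2^-1) ltac:(rewrite ger0_norm ?invr_ge0; lra).
  have y0 : 0 <= 2^-1 ^+ m0 :> R by rewrite exprn_ge0 // invr_ge0.
  by exists m0; have := h m0 (leqnn _); rewrite /= sub0r normrN (ger0_norm y0).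
exists m0 => // m m0m.
have ym : 2^-1 ^+ m <= e :> R.
  by apply: le_trans hm0; rewrite ler_wiXn2l ?invr_ge0 //; lra.
have h1 : prI [set t : R | x < digits_val (pattern m t)] <= prI [set t : R | x < t].
  apply: le_prI => // t [It /= xt]; have /andP[h _] := digits_val_le m It.
  exact: lt_le_trans h.
have mI : measurable (`]x, x + 2^-1 ^+ m]%classic : set (measurableTypeR R)).
  exact: measurable_itv.
have h2 : prI [set t : R | x < t] <=
    prI [set t : R | x < digits_val (pattern m t)] + prI `]x, x + 2^-1 ^+ m]%classic.
  apply: le_trans (prIU_le (mD m) mI); apply: le_prI => //; first exact: measurableU.
  move=> t [It /= xt]; have /andP[_ h] := digits_val_le m It.
  case: (ltP x (digits_val (pattern m t))) => hx; [by left|right].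
  by rewrite /= in_itv /= xt /=; lra.
have h3 : prI `]x, x + 2^-1 ^+ m]%classic <= 2^-1 ^+ m.
  rewrite -lee_fin -prIE // -lebIE.
  apply: (@le_trans _ _ (lebesgue_measure (`]x, x + 2^-1 ^+ m]%classic : set R))).
    by apply: le_measure; rewrite ?inE //; exact: measurableI measurable_I01 _.
  rewrite lebesgue_measure_itv /= lte_fin ltrDl exprn_gt0 ?invr_gt0 //.
  by rewrite -EFinB /= addrC addKr.
by rewrite ler_norml; apply/andP; split; lra.
Qed.

Lemma cvg_prodr (I : finType) (u : I -> nat -> R) (l : I -> R) :
  (forall i, u i m @[m --> \oo] --> l i) -> \prod_i u i m @[m --> \oo] --> \prod_i l i.
Proof.
move=> h; rewrite unlock /reducebig /=; elim: index_enum => [|i s IH] /=; first exact: cvg_cst.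
exact: cvgM.
Qed.

(** Both sides are limits of the identity [prI_thetan]. Open upper rays are used because [thetan]
    increases to [theta], so these events increase with [m]. *)
Lemma prI_theta_gt (x : 'I_N -> R) :
  prI [set t | forall i, x i < theta i t] = \prod_i prI [set t | x i < t].
Proof.
have h1 : prI [set t | forall i, x i < thetan i m t] @[m --> \oo] -->
    prI [set t | forall i, x i < theta i t].
  have E : [set t | forall i, x i < theta i t] = \bigcup_m [set t | forall i, x i < thetan i m t].
    apply/seteqP; split => t /=.
      move=> h; have /choice[m hm] : forall i, exists m, x i < thetan i m t.
        by move=> i; exact/theta_gt.
      exists (\max_i m i)%N => // i; apply: (lt_le_trans (hm i)); apply: thetan_nd.
      exact: leq_bigmax.
    by move=> [m _ h] i; apply/theta_gt; exists m.
  have mU : measurable ([set t | forall i, x i < theta i t] : set (measurableTypeR R)).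
    by rewrite E; apply: bigcupT_measurable => m; exact: measurable_thetan_gt.
  apply: fine_cvg; rewrite -prIE // E; apply: nondecreasing_cvg_mu.
  - by move=> m; exact: measurable_thetan_gt.
  - by rewrite -E.
  - move=> m n mn; apply/subsetPset => t /= h i; apply: (lt_le_trans (h i)).
    exact: thetan_nd.
have h2 : prI [set t | forall i, x i < thetan i m t] @[m --> \oo] -->
    \prod_i prI [set t | x i < t].
  under eq_cvg => m do rewrite (prI_thetan m (fun i => [set y | x i < y])).
  by apply: cvg_prodr => i; exact: prI_digits_gt_cvg.
exact: (cvg_unique _ h1 h2).
Qed.

Lemma measurable_theta_preimage (A : 'I_N -> set R) :
  (forall i, measurable (A i : set (measurableTypeR R))) ->
  measurable ([set t | forall i, A i (theta i t)] : set (measurableTypeR R)).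
Proof.
move=> mA; have -> : [set t | forall i, A i (theta i t)] = \bigcap_i (theta i @^-1` A i).
  by apply/seteqP; split => t /= h i; [move=> _|]; exact: h.
apply: fin_bigcap_measurable => // i _.
by have := measurable_theta i measurableT (mA i); rewrite setTI.
Qed.

Lemma measure_rays_unique (m1 m2 : {measure set (measurableTypeR R) -> \bar R}) :
  (forall x, m1 `]x, +oo[%classic = m2 `]x, +oo[%classic) ->
  (forall x, (m1 `]x, +oo[%classic < +oo)%E) ->
  forall A, measurable A -> m1 A = m2 A.
Proof.
move=> m12 moo A mA.
apply: (@measure_unique _ R (measurableTypeR R) (@RGenOInfty.G R)
  (fun n => `]- n%:R, +oo[%classic) _ _ _ _ m1 m2 _ _ A mA).
- exact: RGenOInfty.measurableE.
- move=> _ _ [x ->] [y ->]; exists (Num.max x y); apply/seteqP; split => t /=.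
    by rewrite !in_itv /= !andbT gt_max => -[-> ->].
  by rewrite !in_itv /= !andbT gt_max => /andP[-> ->].
- by move=> n; exists (- n%:R).
- apply/seteqP; split => // t _.
  have [n hn] : exists n : nat, - t < n%:R.
    by exists (Num.truncn `|t|).+1; apply: le_lt_trans (truncnS_gt _); rewrite -normrN ler_norm.
  by exists n => //=; rewrite in_itv /= andbT ltrNl.
- by move=> _ [x ->].
- by move=> n; exact: moo.
Qed.

(* Passing from rays to arbitrary sets one coordinate at a time; the first [k]
   coordinates are the ones already treated. *)
Lemma prI_theta_aux (k : nat) (A : 'I_N -> set R) :
  (forall i, measurable (A i : set (measurableTypeR R))) ->
  (forall i : 'I_N, (k <= i)%N -> exists x, A i = `]x, +oo[%classic) ->
  prI [set t | forall i, A i (theta i t)] = \prod_i prI (A i).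
Proof.
elim: k A => [|k IH] A mA rA.
  have /choice[x hx] : forall i, exists x, A i = `]x, +oo[%classic by move=> i; exact: rA.
  have -> : [set t | forall i, A i (theta i t)] = [set t | forall i, x i < theta i t].
    by apply/seteqP; split => t /= h i; have := h i; rewrite hx /= in_itv /= andbT.
  rewrite prI_theta_gt; apply: eq_bigr => i _; congr prI.
  by rewrite hx; apply/seteqP; split => t /=; rewrite in_itv /= andbT.
have [kN|Nk] := ltnP k N; last first.
  by apply: IH => // i ki; have := ltn_ord i; rewrite ltnNge (leq_trans Nk ki).
pose i0 := Ordinal kN.
pose rest := [set t | forall i, i != i0 -> A i (theta i t)].
pose A' (B : set R) := fun i => if i == i0 then B else A i.
have mA' B : measurable (B : set (measurableTypeR R)) ->
    forall i, measurable (A' B i : set (measurableTypeR R)).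
  by move=> mB i; rewrite /A'; case: ifP.
have restE B : [set t | forall i, A' B i (theta i t)] = theta i0 @^-1` B `&` rest.
  apply/seteqP; split => t /=.
    move=> h; split; first by have := h i0; rewrite /A' eqxx.
    by move=> i ii0; have := h i; rewrite /A' (negbTE ii0).
  by move=> [Bt ht] i; rewrite /A'; case: eqVneq => [->//|]; exact: ht.
have mrest : measurable (rest : set (measurableTypeR R)).
  have := measurable_theta_preimage (mA' setT measurableT).
  by rewrite restE preimage_setT setTI.
pose q := \prod_(i | i != i0) prI (A i).
have q0 : 0 <= q by apply: prodr_ge0 => i _; exact: prI_ge0.
have prodE B : \prod_i prI (A' B i) = prI B * q.
  rewrite (bigD1 i0) //= /A' eqxx; congr (_ * _).
  by apply: eq_bigr => i /negbTE ->.
(* The law of [theta i0] on the event [rest], against the uniform law times the probability [q]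
   expected for [rest]. They agree on rays by induction, hence on all Borel sets. *)
pose m1 := pushforward (mrestr lebI mrest) (theta i0).
pose m2 := mscale (NngNum q0) lebI.
have m1E B : m1 B = lebI [set t | forall i, A' B i (theta i t)] by rewrite restE.
have m2E B : measurable (B : set (measurableTypeR R)) -> m2 B = (q * prI B)%:E.
  by move=> mB; rewrite EFinM -prIE.
have AE : A = A' (A i0).
  by apply/funext => i; rewrite /A'; case: eqVneq => [->|].
rewrite AE prodE mulrC; apply: EFin_inj.
rewrite -m2E // -prIE; last exact: measurable_theta_preimage (mA' _ (mA i0)).
rewrite -m1E.
have mth := measurable_theta i0.
have mA'x x : measurable ([set t | forall i, A' `]x, +oo[%classic i (theta i t)] :
    set (measurableTypeR R)).
  by apply: measurable_theta_preimage; apply: mA'; exact: measurable_itv.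
apply: (measure_rays_unique
  (m1 := @measure_function_pushforward__canonical__measure_function_Measure _ _ _ _ _
    (mrestr lebI mrest) _ mth)
  (m2 := mscale (NngNum q0) lebI)) => // x /=.
- rewrite -[LHS]/(m1 _) -[RHS]/(m2 _) m1E m2E; last exact: measurable_itv.
  rewrite (prIE (mA'x x)).
  congr EFin; rewrite mulrC -prodE; apply: IH; first by apply: mA'; exact: measurable_itv.
  move=> i ki; rewrite /A'; case: eqVneq => [_|ii0]; first by exists x.
  by apply: rA; rewrite ltn_neqAle ki andbT; apply: contra ii0 => /eqP kk; apply/eqP/val_inj.
- by rewrite -[X in (X < _)%E]/(m1 _) m1E (prIE (mA'x x)) ltry.
Qed.

Lemma prI_theta (A : 'I_N -> set R) :
  (forall i, measurable (A i : set (measurableTypeR R))) ->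
  prI [set t | forall i, A i (theta i t)] = \prod_i prI (A i).
Proof. by move=> mA; apply: (@prI_theta_aux N) => // i; rewrite leqNgt ltn_ord. Qed.

End IndependentUniforms.

(** * Expansion in finite weighted models *)

Section Expansion.
Local Open Scope set_scope.
Local Open Scope ring_scope.
Context {R : realType}.

Definition weight (J : finType) (w : J -> R) (A : {set J}) : R := \sum_(j in A) w j.

(* Every [A] inside one block of the partition [pi] whose weight is at least
   [kappa] is [r]-reached from all points outside a set of weight [eta]. *)
Definition expands (J K : finType) (w : J -> R) (pi : J -> K) (ok : pred J)
    (r : rel J) (kappa eta : R) : Prop :=
  forall A : {set J}, {in A, forall a, ok a} -> {in A &, forall a b, pi a = pi b} ->
    kappa <= weight w A -> \sum_(j | [forall a in A, ~~ r j a]) w j <= eta.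

Lemma expandsW (J K : finType) (w : J -> R) (pi : J -> K) ok r (k k' e e' : R) :
  k <= k' -> e <= e' -> expands w pi ok r k e -> expands w pi ok r k' e'.
Proof. by move=> kk ee h A Aok Api kA; apply: le_trans (h A Aok Api (le_trans kk kA)) ee. Qed.

Lemma ler_sum_pred (J : finType) (w : J -> R) (P Q : pred J) :
  (forall j, 0 <= w j) -> (forall j, P j -> Q j) -> \sum_(j | P j) w j <= \sum_(j | Q j) w j.
Proof.
move=> w0 PQ; rewrite big_mkcond [leRHS]big_mkcond /=; apply: ler_sum => j _.
by case: ifP => [/PQ ->//|_]; case: ifP.
Qed.

Lemma expands_bij (J J' K K' : finType) (h : J -> J') (w : J -> R) (w' : J' -> R)
    (pi : J -> K) (pi' : J' -> K') (ok : pred J) (ok' : pred J') (r : rel J) (r' : rel J') (k e : R) :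
  (forall j, 0 <= w j) ->
  bijective h -> (forall j, w j = w' (h j)) -> (forall j, ok j -> ok' (h j)) ->
  (forall a b, pi a = pi b -> pi' (h a) = pi' (h b)) ->
  (forall a b, r' (h a) (h b) -> r a b) ->
  expands w' pi' ok' r' k e -> expands w pi ok r k e.
Proof.
move=> w0 hb ww oko pip rr h' A Aok Api kA.
have hi : injective h := bij_inj hb.
have H1 : {in h @: A, forall a, ok' a} by move=> _ /imsetP[a aA ->]; exact/oko/Aok.
have H2 : {in h @: A &, forall a b, pi' a = pi' b}.
  by move=> _ _ /imsetP[a aA ->] /imsetP[b bA ->]; exact/pip/Api.
have H3 : k <= weight w' (h @: A).
  rewrite /weight big_imset /=; last by move=> ? ? _ _; exact: hi.
  by under eq_bigr => j _ do rewrite -ww.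
apply: le_trans (h' _ H1 H2 H3).
rewrite (reindex h) /=; last exact: onW_bij.
under [leRHS]eq_bigr => j _ do rewrite -ww.
apply: ler_sum_pred => // j /forall_inP jA; apply/forall_inP => _ /imsetP[a aA ->].
by apply: contra (jA _ aA); exact: rr.
Qed.

(** Of the mass [3 * k], one [k] pays for the light sections of [A], one for the sections that a
    given first coordinate fails to reach, and the last feeds the expansion of the second factor.
    The term [e1 / k] is Markov's inequality for the failures in the first factor. *)
Lemma expands_prod (J1 J2 K1 K2 : finType) (w1 : J1 -> R) (w2 : J2 -> R)
    (pi1 : J1 -> K1) (pi2 : J2 -> K2) (ok1 : pred J1) (ok2 : pred J2)
    (r1 : rel J1) (r2 : rel J2) (k e1 e2 : R) :
  (forall j, 0 <= w1 j) -> (forall j, 0 <= w2 j) ->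
  \sum_j w1 j = 1 -> \sum_j w2 j = 1 -> 0 < k -> 0 <= e1 -> 0 <= e2 ->
  expands w1 pi1 ok1 r1 k e1 -> expands w2 pi2 ok2 r2 k e2 ->
  expands (fun p : J1 * J2 => w1 p.1 * w2 p.2) (fun p => (pi1 p.1, pi2 p.2))
    (fun p => ok1 p.1 && ok2 p.2) (fun p q => r1 p.1 q.1 && r2 p.2 q.2)
    (3 * k) (e1 / k + e2).
Proof.
move=> w10 w20 w11 w21 k0 e10 e20 E1 E2 A Aok Api kA.
have w1le (P : pred J1) : \sum_(j | P j) w1 j <= 1.
  by rewrite -w11; apply: ler_sum_pred.
have w2le (P : pred J2) : \sum_(j | P j) w2 j <= 1.
  by rewrite -w21; apply: ler_sum_pred.
pose sec t2 : {set J1} := [set t1 | (t1, t2) \in A].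
pose S := [set t2 | k <= weight w1 (sec t2)].
pose bad1 t2 t1 := [forall a in sec t2, ~~ r1 t1 a].
(* Sections lighter than [k] contribute at most [k] to the mass of [A], and the others at most their
   base weight. *)
have S2k : 2 * k <= weight w2 S.
  have : weight (fun p : J1 * J2 => w1 p.1 * w2 p.2) A = \sum_t2 w2 t2 * weight w1 (sec t2).
    rewrite /weight big_mkcond /=.
    transitivity (\sum_t1 \sum_t2 if (t1, t2) \in A then w1 t1 * w2 t2 else 0).
      by rewrite pair_bigA /=; apply: eq_bigr => -[].
    rewrite exchange_big /=.
    apply: eq_bigr => t2 _; rewrite [in RHS]big_mkcond mulr_sumr; apply: eq_bigr => t1 _.
    by rewrite inE; case: ifP; rewrite ?mulr0 // mulrC.
  move=> wA; rewrite wA in kA.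
  suff : \sum_t2 w2 t2 * weight w1 (sec t2) <= weight w2 S + k by lra.
  rewrite {2}/weight [in leRHS]big_mkcond /=.
  rewrite -[X in _ + X]mul1r -w21 mulr_suml -big_split /=.
  apply: ler_sum => t2 _; rewrite inE.
  have W0 : 0 <= weight w1 (sec t2) by apply: sumr_ge0.
  have W1 : weight w1 (sec t2) <= 1 by apply: w1le.
  have := w20 t2; move: (w2 t2) => x x0.
  by move: W0 W1; case: (leP k (weight w1 (sec t2))); move: (weight w1 (sec t2)) => y; nra.
have B1 : \sum_(t2 in S) w2 t2 * \sum_(t1 | bad1 t2 t1) w1 t1 <= e1.
  apply: (@le_trans _ _ (\sum_(t2 in S) w2 t2 * e1)).
    apply: ler_sum => t2; rewrite inE => kt2; apply: ler_wpM2l => //.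
    apply: E1 => // [a|a b]; rewrite !inE => aA; first by have /andP[] := Aok _ aA.
    by move=> bA; have [] := Api _ _ aA bA.
  rewrite -mulr_suml; have : \sum_(t2 in S) w2 t2 <= 1 by apply: w2le.
  by move: (\sum_(t2 in S) w2 t2) => x; nra.
pose C t1 := [set t2 in S | ~~ bad1 t2 t1].
pose B p := [forall a in A, ~~ (r1 p.1 a.1 && r2 p.2 a.2)].
(* Either [C t1] weighs at least [k], and the second factor expands from it; or [t1] is bad for a
   part of [S] of weight at least [k], and the first summand is already at least 1. *)
have inner t1 : \sum_(t2 | B (t1, t2)) w2 t2 <=
    (\sum_(t2 in S | bad1 t2 t1) w2 t2) / k + e2.
  have X0 : 0 <= \sum_(t2 in S | bad1 t2 t1) w2 t2 by apply: sumr_ge0.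
  have [kC|Ck] := leP k (weight w2 (C t1)).
    have : \sum_(t2 | [forall a in C t1, ~~ r2 t2 a]) w2 t2 <= e2.
      apply: E2 => // [b|b b']; rewrite !inE => /andP[_ /forall_inPn[a]].
        by rewrite inE => abA _; have /andP[] := Aok _ abA.
      rewrite inE => abA _ /andP[_ /forall_inPn[a']]; rewrite inE => abA' _.
      by have [] := Api _ _ abA abA'.
    move=> h; apply: (@le_trans _ _ e2); last by rewrite lerDr divr_ge0 // ltW.
    apply: le_trans h; apply: ler_sum_pred => // t2 /forall_inP Bt.
    apply/forall_inP => b; rewrite !inE => /andP[_ /forall_inPn[a]].
    by rewrite inE => abA /negPn ra; have := Bt _ abA; rewrite /= ra.
  have : weight w2 S = \sum_(t2 in S | bad1 t2 t1) w2 t2 + weight w2 (C t1).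
    rewrite /weight (bigID (fun t2 => bad1 t2 t1)) /=; congr (_ + _).
    by apply: eq_bigl => t2; rewrite !inE.
  move=> wS; have kX : k <= \sum_(t2 in S | bad1 t2 t1) w2 t2 by lra.
  apply: (le_trans (w2le _)); apply: (@le_trans _ _ (1 + 0)); first by rewrite addr0.
  by apply: lerD => //; rewrite ler_pdivlMr // mul1r.
rewrite (eq_bigl B) // big_mkcond.
have -> : \sum_p (if B p then w1 p.1 * w2 p.2 else 0) =
    \sum_t1 \sum_t2 (if B (t1, t2) then w1 t1 * w2 t2 else 0).
  by rewrite pair_bigA /=; apply: eq_bigr => -[].
apply: (@le_trans _ _ (\sum_t1 w1 t1 * ((\sum_(t2 in S | bad1 t2 t1) w2 t2) / k + e2))).
  apply: ler_sum => t1 _; rewrite -big_mkcond /= -mulr_sumr.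
  exact: ler_wpM2l.
under eq_bigr => t1 _ do rewrite mulrDr mulrA.
rewrite big_split /= -!mulr_suml w11 mul1r lerD2r ler_pM2r ?invr_gt0 //.
apply: le_trans B1; rewrite le_eqVlt; apply/orP; left; apply/eqP.
under eq_bigr => t1 _ do rewrite mulr_sumr big_mkcondr /=.
rewrite exchange_big /=; apply: eq_bigr => t2 _.
rewrite mulr_sumr [RHS]big_mkcond /=; apply: eq_bigr => t1 _.
by case: ifP => // _; rewrite mulrC.
Qed.

Definition ffun_split (N : nat) (J : finType) (j : {ffun 'I_N.+1 -> J}) :
    J * {ffun 'I_N -> J} := (j ord0, [ffun i => j (lift ord0 i)]).

Definition ffun_cons (N : nat) (J : finType) (p : J * {ffun 'I_N -> J}) :
    {ffun 'I_N.+1 -> J} := [ffun i => if unlift ord0 i is Some i' then p.2 i' else p.1].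

Lemma ffun_splitK N (J : finType) : cancel (@ffun_split N J) (@ffun_cons N J).
Proof.
by move=> j; apply/ffunP => i; rewrite ffunE; case: unliftP => [i' ->|->] //=; rewrite ffunE.
Qed.

Lemma ffun_consK N (J : finType) : cancel (@ffun_cons N J) (@ffun_split N J).
Proof.
move=> [a b]; rewrite /ffun_split; congr pair.
  by rewrite ffunE unlift_none.
by apply/ffunP => i; rewrite !ffunE liftK.
Qed.

(* The constants depend on N only, not on the size of the finite models. *)
Lemma expands_ffun N (kappa eta : R) : 0 < kappa -> 0 < eta ->
  exists2 k : R, 0 < k & exists2 e : R, 0 < e &
  forall (J K : finType) (w : 'I_N -> J -> R) (pi : 'I_N -> J -> K)
    (ok : 'I_N -> pred J) (r : 'I_N -> rel J),
    (forall i j, 0 <= w i j) -> (forall i, \sum_j w i j = 1) ->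
    (forall i, expands (w i) (pi i) (ok i) (r i) k e) ->
    expands (fun j : {ffun 'I_N -> J} => \prod_i w i (j i))
      (fun j => [ffun i => pi i (j i)]) (fun j => [forall i, ok i (j i)])
      (fun j j' => [forall i, r i (j i) (j' i)]) kappa eta.
Proof.
elim: N kappa eta => [|N IH] kappa eta kappa0 eta0.
  exists 1 => //; exists 1 => // J K w pi ok r _ _ _ A _ _ kA.
  rewrite big_pred0; first exact: ltW.
  move=> j; apply/negbTE/forall_inPn.
  have [A0|[a aA]] := set_0Vmem A.
    by move: kA; rewrite A0 /weight big_set0 leNgt kappa0.
  by exists a => //; apply/negPn/forallP => -[].
have [k1 k10 [e1 e10 H]] := IH (kappa / 3) (eta / 2) ltac:(lra) ltac:(lra).
(* [expands_prod] is applied with threshold [kappa / 3]; dividing the head error by it leaves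
   [eta / 2]. *)
pose k := Num.min k1 (kappa / 3); pose e := Num.min e1 (kappa / 3 * (eta / 2)).
have ke0 : 0 < kappa / 3 * (eta / 2) by apply: mulr_gt0; lra.
exists k; first by rewrite lt_min k10 /=; lra.
exists e; first by rewrite lt_min e10.
move=> J K w pi ok r w0 w1 E.
have Ekap : kappa = 3 * (kappa / 3) by lra.
have Eeta : eta = (kappa / 3 * (eta / 2)) / (kappa / 3) + eta / 2 by field; rewrite gt_eqF.
have Etail := H J K (fun i => w (lift ord0 i)) (fun i => pi (lift ord0 i))
  (fun i => ok (lift ord0 i)) (fun i => r (lift ord0 i)) (fun i => w0 _) (fun i => w1 _)
  (fun i => @expandsW J K _ _ _ _ k k1 e e1 ltac:(by rewrite ge_min lexx)
     ltac:(by rewrite ge_min lexx) (E (lift ord0 i))).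
have Ehead : expands (w ord0) (pi ord0) (ok ord0) (r ord0) (kappa / 3) (kappa / 3 * (eta / 2)).
  by apply: expandsW (E ord0); rewrite ge_min lexx orbT.
rewrite Ekap Eeta.
apply: (@expands_bij _ _ _ _ (@ffun_split N J) _ _ _ _ _ _ _ _ _ _ _ _ _ _ _ _
  (expands_prod _ _ _ _ _ _ _ Ehead Etail)).
- by move=> j; apply: prodr_ge0.
- exact: Bijective (@ffun_splitK N J) (@ffun_consK N J).
- move=> j /=; rewrite big_ord_recl; congr (_ * _).
  by apply: eq_bigr => i _; rewrite ffunE.
- move=> j /= /forallP jok; rewrite jok /=; apply/forallP => i; rewrite ffunE.
  exact: jok.
- move=> a b /ffunP ab /=; congr pair.
    by have := ab ord0; rewrite !ffunE.
  by apply/ffunP => i; rewrite !ffunE; have := ab (lift ord0 i); rewrite !ffunE.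
- move=> a b /= /andP[ab0 /forallP ab]; apply/forallP => i.
  by case: (unliftP ord0 i) => [i' ->|-> //]; have := ab i'; rewrite !ffunE.
- exact: w0.
- by move=> j; apply: prodr_ge0.
- exact: w1.
- by rewrite -(bigA_distr_bigA (fun i => w (lift ord0 i))) big1.
- by lra.
- exact: ltW.
- by lra.
Qed.

(** Among the points summed over, take one with [f] maximal: all the others of nonzero weight lie in
    its sublevel set, which weighs less than [kappa]. *)
Lemma low_weight_le (J : finType) (w f : J -> R) (P : pred J) (kappa : R) :
  (forall j, 0 <= w j) -> 0 <= kappa ->
  \sum_(j | P j && (weight w [set a | P a & (w a != 0) && (f a <= f j)] < kappa)) w j <= kappa.
Proof.
move=> w0 k0.
pose Q j := P j && (weight w [set a | P a & (w a != 0) && (f a <= f j)] < kappa).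
rewrite -[leLHS]/(\sum_(j | Q j) w j).
case: (pickP Q) => [j0 Qj0|Q0]; last by rewrite big_pred0.
have [jm Qjm jmax] := arg_maxP f Qj0.
have /andP[_ /ltW] := Qjm; apply: le_trans.
rewrite (bigID (fun j => w j == 0)) /= big1 ?add0r; last by move=> j /andP[_ /eqP].
rewrite /weight; apply: ler_sum_pred => // j /andP[Qj wj].
by rewrite !inE wj /=; have /andP[-> _] := Qj; apply: jmax.
Qed.

Lemma sum_sum_card (J K : finType) (w : J -> R) (A : K -> pred J) :
  \sum_p \sum_(j | A p j) w j = \sum_j w j *+ #|[pred p | A p j]|.
Proof.
rewrite (exchange_big_dep xpredT) //=; apply: eq_bigr => j _.
by rewrite sumr_const; congr (_ *+ _); apply: eq_card => p; rewrite !inE.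
Qed.

(** Expansion is applied to sublevel sets of [f] inside one block: after discarding little mass,
    every good point [j'] is related to a point in the block of [j] where [f] is no larger than at
    [j]. Asking for nonzero weight ensures later that the cell found is inhabited. *)
Lemma expands_good_set (J K : finType) (w : J -> R) (pi : J -> K) (ok : pred J) (r : rel J)
    (kappa eta : R) (f : J -> R) :
  (forall j, 0 <= w j) -> 0 <= kappa -> 0 <= eta -> expands w pi ok r kappa eta ->
  exists G : {set J}, [/\ {in G, forall j, ok j},
    \sum_(j | j \notin G) w j <= \sum_(j | ~~ ok j) w j + #|K|%:R * kappa + #|K|%:R * eta &
    {in G &, forall j' j, exists k, [/\ ok k, pi k = pi j, w k != 0, f k <= f j & r j' k]}].
Proof.
move=> w0 k0 e0 E.
pose P p := [pred j | ok j & pi j == p].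
pose low p j := [set a | P p a & (w a != 0) && (f a <= f j)].
have /fin_all_exists[B hB] : forall p : K, exists B : {set J}, weight w B <= eta /\
    forall j, P p j -> kappa <= weight w (low p j) -> forall j', j' \notin B ->
      exists k, [/\ ok k, pi k = pi j, w k != 0, f k <= f j & r j' k].
  move=> p; pose Q j := P p j && (kappa <= weight w (low p j)).
  case: (pickP Q) => [j0 Qj0|Q0]; last first.
    exists finset.set0; split; first by rewrite /weight big_set0.
    by move=> j Pj kj; have := Q0 j; rewrite /Q Pj kj.
  (* Sublevel sets are nested, so reaching the smallest heavy one reaches them all and a single
     exceptional set per block is enough. *)
  have [jm Qjm jmin] := arg_minP f Qj0.
  exists [set j | [forall a in low p jm, ~~ r j a]]; split.
    rewrite /weight (eq_bigl (fun j => [forall a in low p jm, ~~ r j a])); last first.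
      by move=> j; rewrite inE.
    apply: E => [a|a b|]; rewrite ?inE.
    - by case/andP => /andP[].
    - by case/andP => /andP[_ /eqP ->] _ /andP[/andP[_ /eqP ->]].
    - by have /andP[] := Qjm.
  move=> j Pj kj j'; rewrite inE => /forall_inPn[k].
  rewrite inE => /andP[/andP[okk /eqP pik] /andP[wk fk]] /negPn rk.
  exists k; split=> //; first by have /andP[_ /eqP ->] := Pj.
  by apply: (le_trans fk); apply: jmin; rewrite /Q Pj kj.
pose G := [set j | [&& ok j, kappa <= weight w (low (pi j) j) & [forall p, j \notin B p]]].
exists G; split.
- by move=> j; rewrite inE => /andP[].
(* Union bound over the blocks: a point outside [G] is not [ok], or has a light sublevel set in its
   block, or is exceptional for some block. *)
- apply: (@le_trans _ _ (\sum_(j | ~~ ok j) w j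
    + \sum_(p : K) \sum_(j | P p j && (weight w (low p j) < kappa)) w j
    + \sum_(p : K) weight w (B p))); last first.
    rewrite lerD //; last first.
      rewrite mulr_natl -sumr_const; apply: ler_sum => p _; exact: (hB p).1.
    rewrite lerD2l mulr_natl -sumr_const; apply: ler_sum => p _.
    exact: low_weight_le.
  rewrite [X in _ + X + _](sum_sum_card w (fun p j => P p j && (weight w (low p j) < kappa))).
  rewrite [X in _ + X](sum_sum_card w (fun p j => j \in B p)).
  rewrite big_mkcond [X in X + _ + _]big_mkcond -!big_split /=.
  apply: ler_sum => j _.
  have [->|wj] := eqVneq (w j) 0; first by rewrite !mul0rn; do 2 case: ifP; rewrite ?addr0.
  have wj0 : 0 < w j by rewrite lt_neqAle eq_sym wj w0.
  have n0 m : 0 <= w j *+ m by rewrite mulrn_wge0.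
  case: ifP => [|_]; last by rewrite !addr_ge0 //; case: ifP.
  rewrite inE !negb_and; case: (boolP (ok j)) => okj /=; last first.
    by move=> _; rewrite -addrA lerDl addr_ge0.
  case/orP => [lowj|/forallPn[p /negPn jB]].
    rewrite add0r (@le_trans _ _ (w j *+ 1)) //; rewrite -mulrnDr.
    rewrite -ltNge in lowj; apply: ler_wpMn2l => //.
    have : (0 < #|[pred p | (pi j == p) && (weight w (low p j) < kappa)%R]|)%N.
      by apply/card_gt0P; exists (pi j); rewrite !inE eqxx /=.
    by move=> h; apply: (leq_trans h); exact: leq_addr.
  rewrite add0r (@le_trans _ _ (w j *+ 1)) //; rewrite -mulrnDr.
  apply: ler_wpMn2l => //.
  have h : (0 < #|[pred p | j \in B p]|)%N by apply/card_gt0P; exists p.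
  by apply: (leq_trans h); exact: leq_addl.
- move=> j' j; rewrite !inE => /and3P[_ _ /forallP j'B] /and3P[okj kj _].
  by apply: ((hB (pi j)).2 j) => //; rewrite /P /= okj eqxx.
Qed.

End Expansion.

(** * McShane extension *)

Section McShane.
Context {R : realType}.

(** The extension is the infimum of [u s + d (p s) x]. Data are indexed through [p], since a
    parameter is not injective, and may violate the Lipschitz bound by [e]. The last clause is used
    with [u = 0], when the extension is the distance to a set. *)
Lemma mcshane (T S : Type) (d : T -> T -> R) (G : set S) (u : S -> R) (p : S -> T) (e : R) :
  is_metric d -> G !=set0 ->
  (forall s s', G s -> G s' -> u s' - u s <= d (p s) (p s') + e) ->
  exists g : T -> R, [/\ forall x y, `|g x - g y| <= d x y,
    forall s, G s -> u s - e <= g (p s) <= u s &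
    forall x r, g x < r -> exists2 s, G s & u s + d (p s) x < r].
Proof.
move=> [d0 dE dC dT] [s0 Gs0] hu.
pose E x := [set u s + d (p s) x | s in G].
have Elb x : has_lbound (E x).
  exists (u s0 - e - d (p s0) x) => _ [s Gs <-].
  by have := hu s s0 Gs Gs0; have := dT (p s) x (p s0); rewrite (dC x); lra.
have E0 x : E x !=set0 by exists (u s0 + d (p s0) x), s0.
exists (fun x => inf (E x)); split; last first.
- by move=> x r /(inf_lt (E0 x))[_ [s Gs <-]] sr; exists s.
- move=> s Gs; apply/andP; split.
    apply: lb_le_inf => // _ [s' Gs' <-].
    by have := hu s' s Gs' Gs; lra.
  apply: ge_inf => //; exists s => //.
  by rewrite (dE _ _).2 // addr0.
- have h x y : inf (E x) - inf (E y) <= d x y.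
    rewrite lerBlDr addrC -lerBlDr; apply: lb_le_inf => // _ [s Gs <-].
    rewrite lerBlDr; apply: (@le_trans _ _ (u s + d (p s) x)).
      by apply: ge_inf => //; exists s.
    by have := dT (p s) y x; rewrite (dC y); lra.
  move=> x y; rewrite ler_norml; have := h x y; have := h y x; rewrite (dC y).
  by move=> ? ?; apply/andP; split; lra.
Qed.

End McShane.

(** * Parameters and the observable distance *)

Section ObservableDistance.
Context {R : realType}.
Implicit Types (X Y : mmspace R).

(* Unlike [parameter], [gparam] asks for measurability on the whole line: the
   variables [theta i] may take the value 1, which is not in [I01]. *)
Definition gparam X (phi : R -> Borel (mm_d X)) : Prop :=
  measurable_fun setT (phi : measurableTypeR R -> Borel (mm_d X)) /\
  forall A : set (Borel (mm_d X)), measurable A -> lebI (phi @^-1` A) = mm_P X A.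

(** One half of the Hausdorff distance, with the Ky Fan bound written as a probability. *)
Definition approx X Y (phi : R -> Borel (mm_d X)) (psi : R -> Borel (mm_d Y)) (e : R) : Prop :=
  forall f, Lip1 X f -> exists2 g, Lip1 Y g &
    prI [set t | e < `|f (phi t) - g (psi t)|] <= e.

Arguments gparam X phi : clear implicits.
Arguments approx X Y phi psi e : clear implicits.

Lemma gparam_parameter X phi : gparam X phi -> parameter X phi.
Proof.
move=> [mphi hphi]; split; first exact: measurable_funTS.
by move=> A mA; rewrite lebIE hphi.
Qed.

(** Off [I01] the map is reset to the constant [point], so that a preimage contains all of the
    complement or none of it. *)
Lemma parameter_gparam X (phi : R -> Borel (mm_d X)) : parameter X phi ->
  exists2 phi' : R -> Borel (mm_d X), gparam X phi' & {in I01, phi =1 phi'}.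
Proof.
move=> [mphi hphi]; exists (fun t => if t \in I01 then phi t else point); last first.
  by move=> t ->.
have E A : I01 `&` (fun t => if t \in I01 then phi t else point) @^-1` A = I01 `&` phi @^-1` A.
  by apply/seteqP; split => t /= [It]; rewrite mem_set.
split=> [_ A mA|A mA]; last by rewrite -lebIE E hphi.
rewrite setTI.
set B := _ @^-1` A.
have -> : B = (I01 `&` B) `|` (~` I01 `&` B).
  by rewrite -setIUl setUv setTI.
rewrite E; apply: measurableU; first exact: mphi measurable_I01 _ mA.
have [Ap|Ap] := pselect (A point).
  have -> : ~` I01 `&` B = ~` I01.
    by apply/seteqP; split => t /= => [[]//|It]; split=> //; rewrite /B /= memNset.
  exact: measurableC measurable_I01.
have -> : ~` I01 `&` B = set0; last exact: measurable0.
by apply/seteqP; split => t //= [It]; rewrite /B /= memNset.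
Qed.

Lemma measurable_dopen X (U : set (mm_T X)) : dopen (mm_d X) U ->
  measurable (U : set (Borel (mm_d X))).
Proof. exact: sub_sigma_algebra. Qed.

Lemma measurable_Lip1 X phi f : gparam X phi -> Lip1 X f ->
  measurable_fun setT (f \o phi : measurableTypeR R -> measurableTypeR R).
Proof.
move=> [mphi _] fL; apply: (measurability _ (RGenOInfty.measurableE R)) => _ [_ [x ->] <-].
rewrite comp_preimage; apply: mphi => //; apply: measurable_dopen => y /=.
rewrite in_itv /= andbT => xy; exists (f y - x); first by rewrite subr_gt0.
move=> z /= yz; rewrite in_itv /= andbT.
by have := fL y z; rewrite ler_norml => /andP[_ ?]; lra.
Qed.

Lemma measurable_lt_set (u v : R -> R) :
  measurable_fun setT (u : measurableTypeR R -> measurableTypeR R) ->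
  measurable_fun setT (v : measurableTypeR R -> measurableTypeR R) ->
  measurable ([set t | u t < v t] : set (measurableTypeR R)).
Proof.
move=> mu mv; have := measurable_fun_ltr mu mv.
by move=> /(_ measurableT [set true] Logic.I); rewrite setTI.
Qed.

Lemma measurable_far_set (u v : R -> R) (e : R) :
  measurable_fun setT (u : measurableTypeR R -> measurableTypeR R) ->
  measurable_fun setT (v : measurableTypeR R -> measurableTypeR R) ->
  measurable ([set t | e < `|u t - v t|] : set (measurableTypeR R)).
Proof.
move=> mu mv; apply: measurable_lt_set; first exact: measurable_cst.
apply: (@measurableT_comp _ _ _ _ _ _ (@Num.norm R R)); first exact: normr_measurable.
exact: measurable_funB.
Qed.

Lemma measurable_far X Y phi psi f g e : gparam X phi -> gparam Y psi -> Lip1 X f -> Lip1 Y g ->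
  measurable ([set t | e < `|f (phi t) - g (psi t)|] : set (measurableTypeR R)).
Proof.
by move=> pX pY fL gL; apply: measurable_far_set; exact: measurable_Lip1.
Qed.

Lemma kyfan_ge0 (f g : R -> R) : 0 <= kyfan f g.
Proof.
have [E0|E0] := pselect ([set e : R | 0 <= e /\
  (lebesgue_measure (I01 `&` [set t | (e < `|f t - g t|)%R]) <= e%:E)%E] !=set0).
  by apply: lb_le_inf => // e [].
by rewrite /kyfan (_ : [set e | _] = set0) ?inf0 //; apply/eqP/negPn/negP => /set0P.
Qed.

Lemma kyfan_le (f g : R -> R) (e : R) : 0 <= e ->
  (lebI [set t | (e < `|f t - g t|)%R] <= e%:E)%E -> kyfan f g <= e.
Proof.
move=> e0 h; apply: ge_inf; last by split=> //; rewrite lebIE.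
by exists 0 => r [].
Qed.

Lemma kyfan_lt (f g : R -> R) (e : R) :
  (forall e : R, measurable ([set t | e < `|f t - g t|] : set (measurableTypeR R))) ->
  kyfan f g < e -> prI [set t | e < `|f t - g t|] <= e.
Proof.
move=> mfg /inf_lt [].
  exists 1; split=> //; rewrite lebIE.
  exact: probability_le1.
move=> r [r0]; rewrite lebIE prIE // lee_fin => hr re.
apply: (le_trans _ (le_trans hr (ltW re))); apply: le_prI => // t [_] /=.
exact: lt_trans.
Qed.

Lemma kyfan_eqI (f g f' g' : R -> R) : {in I01, f =1 f'} -> {in I01, g =1 g'} ->
  kyfan f g = kyfan f' g'.
Proof.
move=> ff gg; rewrite /kyfan; congr inf; apply/seteqP.
have E e : I01 `&` [set t | e < `|f t - g t|] = I01 `&` [set t | e < `|f' t - g' t|].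
  by apply/seteqP; split => t /= [It]; rewrite ff ?gg ?inE.
by split => e /=; rewrite E.
Qed.

Lemma ereal_sup_inf_lt (A B : set (R -> R)) (k : (R -> R) -> (R -> R) -> R) (e : R) :
  (ereal_sup [set ereal_inf [set (k a b)%:E | b in B] | a in A] < e%:E)%E ->
  forall a, A a -> exists2 b, B b & k a b < e.
Proof.
move=> h a Aa.
have : (ereal_inf [set (k a b)%:E | b in B] < e%:E)%E.
  by apply: le_lt_trans h; apply: ereal_sup_ubound; exists a.
by move=> /ereal_inf_lt[_ [b Bb <-]]; rewrite lte_fin; exists b.
Qed.

Lemma dconc_lt X Y (e : R) : (dconc X Y < e%:E)%E ->
  exists phi psi, [/\ gparam X phi, gparam Y psi,
    approx X Y phi psi e & approx Y X psi phi e].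
Proof.
move=> /ereal_inf_lt[_ [phi [psi [pX [pY ->]]]]].
rewrite /hausdorff_kf gt_max => /andP[h1 h2].
have [phi' gX phiE] := parameter_gparam pX.
have [psi' gY psiE] := parameter_gparam pY.
have kE f g : kyfan (f \o phi) (g \o psi) = kyfan (f \o phi') (g \o psi').
  by apply: kyfan_eqI => t It /=; rewrite ?phiE ?psiE.
exists phi', psi'; split=> //.
- move=> f fL; have fA : [set f \o phi | f in Lip1 X] (f \o phi) by exists f.
  have [_ [g gL <-]] := ereal_sup_inf_lt h1 fA.
  rewrite kE => /kyfan_lt h; exists g => //; apply: h => r.
  exact: measurable_far.
- move=> g gL.
  have h2' : (ereal_sup [set ereal_inf [set (kyfan a b)%:E | a in [set f \o phi | f in Lip1 X]]
    | b in [set g \o psi | g in Lip1 Y]] < e%:E)%E by [].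
  have gB : [set g \o psi | g in Lip1 Y] (g \o psi) by exists g.
  have [_ [f fL <-]] := ereal_sup_inf_lt (k := fun b a => kyfan a b) h2' gB.
  rewrite kE => /kyfan_lt h; exists f => //.
  have -> : [set t | e < `|g (psi' t) - f (phi' t)|] = [set t | e < `|f (phi' t) - g (psi' t)|].
    by apply/seteqP; split => t /=; rewrite distrC.
  by apply: h => r; exact: measurable_far.
Qed.

Lemma dconc_le X Y (e : R) phi psi : 0 <= e -> gparam X phi -> gparam Y psi ->
  approx X Y phi psi e -> approx Y X psi phi e -> (dconc X Y <= e%:E)%E.
Proof.
move=> e0 gX gY h1 h2.
apply: (@le_trans _ _ (hausdorff_kf [set f \o phi | f in Lip1 X] [set g \o psi | g in Lip1 Y])).
  apply: ereal_inf_lbound; exists phi, psi; split; first exact: gparam_parameter.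
  by split=> //; exact: gparam_parameter.
rewrite /hausdorff_kf ge_max; apply/andP; split; apply: ge_ereal_sup => _ [_ [f fL <-] <-].
- have [g gL hg] := h1 f fL.
  apply: (@le_trans _ _ (kyfan (f \o phi) (g \o psi))%:E).
    by apply: ereal_inf_lbound; exists (g \o psi) => //; exists g.
  rewrite lee_fin; apply: kyfan_le => //; rewrite prIE ?lee_fin //.
  exact: measurable_far.
- have [g gL hg] := h2 f fL.
  apply: (@le_trans _ _ (kyfan (g \o phi) (f \o psi))%:E).
    by apply: ereal_inf_lbound; exists (g \o phi) => //; exists g.
  rewrite lee_fin; apply: kyfan_le => //.
  have E : [set t | e < `|f (psi t) - g (phi t)|] = [set t | e < `|g (phi t) - f (psi t)|].
    by apply/seteqP; split => t /=; rewrite distrC.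
  rewrite E in hg; rewrite prIE ?lee_fin //.
  exact: measurable_far.
Qed.

(** A supremum over an empty set would be minus infinity; the zero function is 1-Lipschitz because
    distances are nonnegative. *)
Lemma dconc_ge0 X Y : is_metric (mm_d X) -> (0 <= dconc X Y)%E.
Proof.
move=> [d0 _ _ _]; apply: le_ereal_inf_tmp => _ [phi [psi [_ [_ ->]]]].
rewrite /hausdorff_kf le_max; apply/orP; left.
apply: (@le_trans _ _ (ereal_inf [set (kyfan (cst 0 \o phi) b)%:E | b in [set g \o psi | g in Lip1 Y]])).
  by apply: le_ereal_inf_tmp => _ [b _ <-]; rewrite lee_fin kyfan_ge0.
apply: ereal_sup_ubound; exists (cst 0 \o phi) => //; exists (cst 0) => //.
by move=> x y; rewrite subrr normr0.
Qed.

Lemma concentratesP (Xn : nat -> mmspace R) Y : (forall n, is_metric (mm_d (Xn n))) ->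
  concentrates Xn Y <->
  (forall e : R, 0 < e -> exists n0, forall n, (n0 <= n)%N -> (dconc (Xn n) Y < e%:E)%E).
Proof.
move=> mX; split.
  move=> /fine_cvgP[[n1 _ h1] /cvgrPdist_lt h2] e e0; have [n2 _ hn2] := h2 e e0.
  exists (maxn n1 n2) => n; rewrite geq_max => /andP[/h1 fn /hn2] /=.
  by rewrite sub0r normrN -[dconc _ _]fineK // lte_fin => /(le_lt_trans (ler_norm _)).
move=> h; apply/fine_cvgP.
have hfin e n : (dconc (Xn n) Y < e%:E)%E -> dconc (Xn n) Y \is a fin_num.
  by move=> hn; rewrite ge0_fin_numE ?dconc_ge0 // (lt_trans hn) ?ltry.
split.
  by have [n0 hn0] := h 1 ltr01; exists n0 => // n /= /hn0; exact: hfin.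
apply/cvgrPdist_lt => e /h[n0 hn0]; exists n0 => // n /= /hn0 hn.
rewrite sub0r normrN ger0_norm; last by rewrite fine_ge0 // dconc_ge0.
by rewrite -lte_fin fineK // (hfin _ _ hn).
Qed.

End ObservableDistance.

Arguments gparam {R} X phi.
Arguments approx {R} X Y phi psi e.

(** * Parameters of product spaces *)

Section ProductParameter.
Context {R : realType} {N : nat}.
Variables (F : ('I_N -> R) -> R) (X : 'I_N -> mmspace R).
Hypotheses (FNF : FN F) (mX : forall i, is_mm (X i)).

Let dmet i : is_metric (mm_d (X i)). Proof. by have [] := mX i. Qed.

Lemma mm_d_nonneg (x y : prodT (fun i => mm_T (X i))) :
  nonneg_vec (fun i => mm_d (X i) (x i) (y i)).
Proof. by move=> i; have [h _ _ _] := dmet i; exact: h. Qed.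

Lemma dF_metric : is_metric (dF F X).
Proof.
have [d0 dE dC dT] := FNF.1 (fun i => mm_T (X i)) (fun i => mm_d (X i)) dmet.
split.
- by move=> x y; exact: d0 (fun i => x i) (fun i => y i).
- move=> x y; split=> [/(dE (fun i => x i) (fun i => y i)) h|->].
    by apply/ffunP => i; have := congr1 (fun g => g i) h.
  by apply/(dE (fun i => y i) (fun i => y i)).
- by move=> x y; exact: dC (fun i => x i) (fun i => y i).
- by move=> x y z; exact: dT (fun i => x i) (fun i => y i) (fun i => z i).
Qed.

Definition rects : set (set (Borel (dF F X))) :=
  [set B | exists2 A : forall i, set (Borel (mm_d (X i))),
     forall i, measurable (A i) & B = [set x : prodT (fun i => mm_T (X i)) | forall i, A i (x i)]].

Lemma dF_small (e : R) : 0 < e -> exists2 del : R, 0 < del &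
  forall x y : prodT (fun i => mm_T (X i)),
    (forall i, mm_d (X i) (x i) (y i) <= del) -> dF F X x y < e.
Proof.
move=> e0; have [del del0 h] := FN_small_near0 FNF (e := e / 2) ltac:(lra).
exists del => // x y xy; rewrite (@le_lt_trans _ _ (e / 2)) //; last by lra.
by apply: h => //; exact: mm_d_nonneg.
Qed.

(** If coordinate [i] has distance at least [e], the vector supported at [i] with value [e] is below
    the distance vector, so [metric_preserving_double] bounds [dF] from below by half its positive
    value. *)
Lemma dF_coord (i : 'I_N) (e : R) : 0 < e -> exists2 del : R, 0 < del &
  forall x y : prodT (fun i => mm_T (X i)), dF F X x y < del -> mm_d (X i) (x i) (y i) < e.
Proof.
move=> e0; pose a j : R := if j == i then e else 0.
have a0 : nonneg_vec a by move=> j; rewrite /a; case: ifP => // _; exact: ltW.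
have Fa0 : 0 < F a.
  have Fa := metric_preserving_ge0 FNF.1 a0.
  rewrite lt_neqAle Fa andbT eq_sym.
  apply/negP => /eqP /(metric_preserving_eq0 FNF.1 a0) /(congr1 (fun g => g i)).
  by rewrite /a eqxx => h; rewrite h ltxx in e0.
exists (F a / 2); first by lra.
move=> x y xy; rewrite ltNge; apply/negP => exy.
have := @metric_preserving_double _ _ F a _ FNF.1 a0 (mm_d_nonneg x y).
have h j : a j <= 2 * mm_d (X j) (x j) (y j).
  have := mm_d_nonneg x y j; rewrite /a; case: eqP => [->|_]; lra.
by move=> /(_ h); rewrite -/(dF F X x y); lra.
Qed.

Lemma measurable_coord (i : 'I_N) (A : set (Borel (mm_d (X i)))) : measurable A ->
  measurable ([set x : prodT (fun i => mm_T (X i)) | A (x i)] : set (Borel (dF F X))).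
Proof.
move=> mA.
have : measurable_fun setT
    ((fun x : prodT (fun i => mm_T (X i)) => x i) : Borel (dF F X) -> Borel (mm_d (X i))).
  apply: (@measurability _ _ (Borel (dF F X)) (Borel (mm_d (X i))) _ _ (dopen (mm_d (X i)))) => //.
  move=> _ [U oU <-]; rewrite setTI; apply: sub_sigma_algebra => x /= /oU[e e0 eU].
  have [del del0 h] := dF_coord i e0.
  by exists del => // y /= xy; apply: eU => /=; exact: h.
by move=> /(_ measurableT A mA); rewrite setTI.
Qed.

Lemma measurable_rects : rects `<=` (measurable : set (set (Borel (dF F X)))).
Proof.
move=> _ [A mA ->].
have -> : [set x : prodT (fun i => mm_T (X i)) | forall i, A i (x i)] =
    \bigcap_i [set x : prodT (fun i => mm_T (X i)) | A i (x i)].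
  by apply/seteqP; split => x /= h i; [move=> _|]; exact: h.
by apply: fin_bigcap_measurable => // i _; exact: measurable_coord.
Qed.

(** By separability an open set is a countable union of products of balls with centres in dense
    sequences and radii [1 / (m + 1)]. *)
Lemma dopen_rects (U : set (prodT (fun i => mm_T (X i)))) :
  dopen (dF F X) U -> (<<s rects >> : set (set (Borel (dF F X)))) U.
Proof.
move=> oU.
have sepX i : dseparable (mm_d (X i)) by have [] := mX i.
pose u i := sval (cid (sepX i)).
have hu i : forall x (e : R), 0 < e -> exists n, mm_d (X i) x (u i n) < e := svalP (cid (sepX i)).
pose rect (p : {ffun 'I_N -> nat} * nat) : set (Borel (dF F X)) :=
  [set z : prodT (fun i => mm_T (X i)) | forall i, mm_d (X i) (u i (p.1 i)) (z i) < p.2.+1%:R^-1].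
have rectG p : (<<s rects >> : set (set (Borel (dF F X)))) (rect p).
  apply: sub_sigma_algebra.
  exists (fun i => [set z | mm_d (X i) (u i (p.1 i)) z < p.2.+1%:R^-1]) => // i.
  apply: measurable_dopen => z /= hz.
  exists (p.2.+1%:R^-1 - mm_d (X i) (u i (p.1 i)) z); first by rewrite subr_gt0.
  move=> y /= zy; have [_ _ _ dT] := dmet i.
  by apply: (le_lt_trans (dT (u i (p.1 i)) z y)); rewrite -ltrBrDl.
(* The countable family of rectangles is enumerated by [nat]; codes of no rectangle, or of one not
   inside [U], contribute the empty set. *)
have -> : U = \bigcup_n (if unpickle n is Some p then
    (if `[< rect p `<=` U >] then rect p else set0) else set0).
  apply/seteqP; split => x.
    move=> Ux; have [e e0 eU] := oU x Ux.
    have [del del0 hdel] := dF_small e0.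
    pose m := Num.truncn (2 / del).
    have m0 : 0 < m.+1%:R^-1 :> R by rewrite invr_gt0.
    have hm : m.+1%:R^-1 < del / 2.
      rewrite invf_plt ?posrE //; last by lra.
      by rewrite invf_div; exact: truncnS_gt.
    have /choice[k hk] : forall i, exists n, mm_d (X i) (x i) (u i n) < m.+1%:R^-1.
      by move=> i; exact: hu.
    pose p : {ffun 'I_N -> nat} * nat := ([ffun i => k i], m).
    exists (pickle p) => //; rewrite pickleK.
    have xp : rect p x.
      by move=> i; rewrite ffunE; have [_ _ dC _] := dmet i; rewrite dC; exact: hk.
    have -> // : `[< rect p `<=` U >] = true.
    apply/asboolP => z pz; apply: eU => /=; apply: hdel => i.
    have [_ _ dC dT] := dmet i.
    have := pz i; rewrite /= ffunE => h1; have := dT (x i) (u i (k i)) (z i).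
    by have := hk i; move: h1 hm; move: (m.+1%:R^-1) => r; lra.
  by move=> [n _]; case: unpickle => // p; case: asboolP => // pU; exact: pU.
apply: (@bigcupT_measurable _ (g_sigma_algebraType rects)) => n.
case: unpickle => [p|]; last exact: measurable0.
by case: ifP => _; [exact: rectG|exact: measurable0].
Qed.

(** The Borel sets of [dF] are the product sigma-algebra, so the values on rectangles in
    [is_product_measure] determine the measure. *)
Lemma measurable_dFE : (measurable : set (set (Borel (dF F X)))) = <<s rects >>.
Proof.
apply/seteqP; split.
  by apply: smallest_sub; [exact: smallest_sigma_algebra|exact: dopen_rects].
apply: smallest_sub; last exact: measurable_rects.
exact: sigma_algebra_measurable.
Qed.

Definition prodmap (phi : forall i, R -> Borel (mm_d (X i))) : R -> Borel (dF F X) :=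
  fun t => [ffun i => phi i (theta i t)].

Variable phi : forall i, R -> Borel (mm_d (X i)).
Hypothesis gphi : forall i, gparam (X i) (phi i).

Lemma prodmap_rect (A : forall i, set (Borel (mm_d (X i)))) :
  prodmap phi @^-1` [set x : prodT (fun i => mm_T (X i)) | forall i, A i (x i)] =
  [set t | forall i, (phi i @^-1` A i) (theta i t)].
Proof.
by apply/seteqP; split => t /= h i; have := h i; rewrite ffunE.
Qed.

Lemma measurable_phi i (A : set (Borel (mm_d (X i)))) : measurable A ->
  measurable (phi i @^-1` A : set (measurableTypeR R)).
Proof. by move=> mA; have := (gphi i).1 measurableT A mA; rewrite setTI. Qed.

Lemma measurable_prodmap :
  measurable_fun setT (prodmap phi : measurableTypeR R -> Borel (dF F X)).
Proof.
apply: (measurability _ measurable_dFE) => _ [_ [A mA ->] <-].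
rewrite setTI prodmap_rect.
apply: (measurable_theta_preimage (A := fun i => phi i @^-1` A i)) => i.
exact: measurable_phi.
Qed.

Lemma lebI_prodmap_rect (A : forall i, set (Borel (mm_d (X i)))) :
  (forall i, measurable (A i)) ->
  lebI (prodmap phi @^-1` [set x : prodT (fun i => mm_T (X i)) | forall i, A i (x i)]) =
  (\prod_(i < N) fine (mm_P (X i) (A i)))%:E.
Proof.
move=> mA; rewrite prodmap_rect.
have mphiA i := measurable_phi (mA i).
rewrite (prIE (measurable_theta_preimage mphiA)) (prI_theta mphiA); congr EFin; apply: eq_bigr => i _.
by rewrite /prI (gphi i).2.
Qed.

Lemma prodmap_gparam (mu : probability (Borel (dF F X)) R) :
  is_product_measure F X mu -> gparam (product_mm F X mu) (prodmap phi).
Proof.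
move=> pmu; have mP := measurable_prodmap; split=> // A mA.
apply: (@measure_unique _ R (Borel (dF F X)) rects (fun=> setT) _ _ _ _
  (@measure_function_pushforward__canonical__measure_function_Measure _ _ _ _ _ lebI _ mP)
  mu _ _ A mA).
- exact: measurable_dFE.
- move=> _ _ [A1 mA1 ->] [A2 mA2 ->]; exists (fun i => A1 i `&` A2 i).
    by move=> i; exact: measurableI.
  by apply/seteqP; split => x /= => [[h1 h2] i|h]; [split|split=> i; have [] := h i].
- move=> _; exists (fun=> setT) => //; apply/seteqP; split => x //= _ i.
- by rewrite bigcup_const //; exists 0%N.
- move=> _ [B mB ->]; exact: etrans (lebI_prodmap_rect mB) (esym (pmu B mB)).
- by move=> _ /=; rewrite /pushforward preimage_setT lebI_setT ltry.
Qed.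

End ProductParameter.

(** * Finite nets and large balls *)

Section Nets.
Context {R : realType}.
Variable X : mmspace R.
Hypothesis mX : is_mm X.

(** The probability depends on the law alone, so [n0] can be fixed before the parameter is known. *)
Lemma exhaust_open (U : nat -> set (mm_T X)) (e : R) :
  (forall n, dopen (mm_d X) (U n)) -> (forall n m, (n <= m)%N -> U n `<=` U m) ->
  \bigcup_n U n = setT -> 0 < e ->
  exists n0, forall n phi, (n0 <= n)%N -> gparam X phi -> 1 - e <= prI (phi @^-1` U n).
Proof.
move=> oU ndU UT e0.
have mU n : measurable (U n : set (Borel (mm_d X))) by exact: measurable_dopen.
have : mm_P X \o U @ \oo --> mm_P X (\bigcup_n U n).
  apply: nondecreasing_cvg_mu => //; first by rewrite UT; exact: measurableT.
  by move=> n m nm; apply/subsetPset; exact: ndU.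
rewrite UT probability_setT => /fine_cvg/cvgrPdist_le/(_ e e0)[n0 _ h].
exists n0 => n phi /h /=; rewrite ler_norml => /andP[_ hn] [_ gphi].
by rewrite /prI gphi //; lra.
Qed.

Lemma dopen_ball (y : mm_T X) (r : R) : dopen (mm_d X) [set x | mm_d X x y < r].
Proof.
have [[_ _ dC dT] _ _] := mX.
move=> x /= xy; exists (r - mm_d X x y); first by rewrite subr_gt0.
by move=> z /= xz; have := dT z x y; rewrite (dC z x); lra.
Qed.

Lemma net_exhaust (u : nat -> mm_T X) (r e : R) :
  (forall x (e : R), 0 < e -> exists n, mm_d X x (u n) < e) -> 0 < r -> 0 < e ->
  exists K0, forall K phi, (K0 <= K)%N -> gparam X phi ->
    1 - e <= prI [set t | exists2 j, (j < K)%N & mm_d X (phi t) (u j) < r].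
Proof.
move=> hu r0 e0; apply: (exhaust_open (U := fun K => [set x | exists2 j, (j < K)%N & mm_d X x (u j) < r])) => //.
- move=> K x [j jK xj]; have [e' e'0 h] := dopen_ball xj.
  by exists e' => // z /h /= ?; exists j.
- by move=> n m nm x [j jn xj]; exists j => //; exact: leq_trans nm.
- by apply/seteqP; split => // x _; have [n hn] := hu x r r0; exists n.+1 => //; exists n.
Qed.

Lemma ball_exhaust (y : mm_T X) (e : R) : 0 < e ->
  exists D0 : nat, forall D phi, (D0 <= D)%N -> gparam X phi ->
    1 - e <= prI [set t | mm_d X (phi t) y < D%:R].
Proof.
move=> e0; apply: (exhaust_open (U := fun D => [set x | mm_d X x y < D%:R])) => //.
- by move=> n; exact: dopen_ball.
- by move=> n m nm x /= h; apply: (lt_le_trans h); rewrite ler_nat.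
- apply/seteqP; split => // x _; exists (Num.truncn (mm_d X x y)).+1 => //=.
  exact: truncnS_gt.
Qed.

End Nets.

Section FiniteValued.
Context {R : realType}.

Lemma measurable_ffun_fiber (m : nat) (p : 'I_m -> R -> bool) (b : {ffun 'I_m -> bool}) :
  (forall k, measurable ([set t | p k t] : set (measurableTypeR R))) ->
  measurable ([set t | [ffun k => p k t] = b] : set (measurableTypeR R)).
Proof.
move=> mp.
have -> : [set t | [ffun k => p k t] = b] = \bigcap_(k : 'I_m) [set t | p k t = b k].
  apply/seteqP; split => t /= => [<- k _ /=|h]; first by rewrite ffunE.
  by apply/ffunP => k; rewrite ffunE; exact: h.
apply: fin_bigcap_measurable => // k _; case: (b k); first exact: mp.
have -> : [set t | p k t = false] = ~` [set t | p k t].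
  by apply/seteqP; split => t /=; case: (p k t) => //= /(_ isT).
exact: measurableC.
Qed.

Lemma measurable_pair_fiber (J1 J2 : finType) (h1 : R -> J1) (h2 : R -> J2) (j : J1 * J2) :
  (forall j, measurable ([set t | h1 t = j] : set (measurableTypeR R))) ->
  (forall j, measurable ([set t | h2 t = j] : set (measurableTypeR R))) ->
  measurable ([set t | (h1 t, h2 t) = j] : set (measurableTypeR R)).
Proof.
move=> m1 m2.
have -> : [set t | (h1 t, h2 t) = j] = [set t | h1 t = j.1] `&` [set t | h2 t = j.2].
  by case: j => j1 j2; apply/seteqP; split => t /= => [[]//|[-> ->]].
exact: measurableI.
Qed.

Lemma prI_ex_le (I : finType) (A : I -> set R) :
  (forall i, measurable (A i : set (measurableTypeR R))) ->
  measurable ([set t | exists i, A i t] : set (measurableTypeR R)) /\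
  prI [set t | exists i, A i t] <= \sum_i prI (A i).
Proof.
move=> mA.
have -> : [set t | exists i, A i t] = \big[setU/set0]_(i : I) A i.
  rewrite -bigcup_seq; apply/seteqP; split => t /=.
    by move=> [i At]; exists i => //=; rewrite mem_index_enum.
  by move=> [i _ At]; exists i.
apply: (big_rec2 (fun (B : set R) (y : R) =>
  measurable (B : set (measurableTypeR R)) /\ prI B <= y)).
  by split; [exact: measurable0|rewrite /prI measure0].
move=> i y B _ [mB hB]; split; first exact: measurableU.
by apply: (le_trans (prIU_le (mA i) mB)); rewrite lerD2l.
Qed.

End FiniteValued.

(** * Cutting a coupled pair of spaces into cells *)

Section Cells.
Context {R : realType}.
Variables (X Y : mmspace R) (phi : R -> Borel (mm_d X)) (psi : R -> Borel (mm_d Y)).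
Variables (M K : nat) (xs : nat -> mm_T X) (ys : nat -> mm_T Y) (y0 : mm_T Y).
Variables (del eta eps D : R).
Hypotheses (metX : is_metric (mm_d X)) (metY : is_metric (mm_d Y)).
Hypotheses (gX : gparam X phi) (gY : gparam Y psi).
Hypotheses (aXY : approx X Y phi psi eta) (aYX : approx Y X psi phi eta).
Hypotheses (del0 : 0 < del) (eta0 : 0 < eta).
Hypothesis netX : 1 - eps <= prI [set t | exists2 m, (m < M)%N & mm_d X (phi t) (xs m) < del].
Hypothesis netY : 1 - eps <= prI [set t | exists2 j, (j < K)%N & mm_d Y (psi t) (ys j) < del].
Hypothesis ballY : 1 - eps <= prI [set t | mm_d Y (psi t) y0 < D].

(* The cell [None] collects the discarded points.  It is declared close to every
   cell, so that its mass does not enter the expansion constants, on which the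
   number of cells, hence this mass, depends in turn. *)
Definition cell_close (c : R -> option ('I_M * 'I_K)) (j' j : option ('I_M * 'I_K)) : bool :=
  ~~ isSome j' || `[< forall t' t, c t' = j' -> c t = j ->
     mm_d X (phi t') (phi t) <= mm_d Y (psi t') (psi t) + (9 * del + 2 * eta) >].

Lemma dist_Lip1 (Z : mmspace R) z : is_metric (mm_d Z) -> Lip1 Z (fun x => mm_d Z x z).
Proof.
move=> [d0 dE dC dT] x y; rewrite ler_norml.
by have := dT x y z; have := dT y x z; rewrite (dC y x) => ? ?; apply/andP; split; lra.
Qed.

Lemma measurable_dist_lt (Z : mmspace R) chi z (r : R) : is_metric (mm_d Z) -> gparam Z chi ->
  measurable ([set t | mm_d Z (chi t) z < r] : set (measurableTypeR R)).
Proof.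
move=> mZ gZ; apply: measurable_lt_set; last exact: measurable_cst.
exact: (measurable_Lip1 gZ (dist_Lip1 z mZ)).
Qed.

(** A cell records a nearby net point in each space. Distances to the net points of [Y] have
    approximants on [X], which yields the fourth clause; the distance to a set in [X] has an
    approximant on [Y], which yields the expansion. *)
Lemma cells : exists c : R -> option ('I_M * 'I_K),
  [/\ forall j, measurable ([set t | c t = j] : set (measurableTypeR R)),
      prI [set t | c t = None] <= 3 * eps + K%:R * eta,
      forall t p, c t = Some p -> [/\ mm_d X (phi t) (xs p.1) < del,
        mm_d Y (psi t) (ys p.2) < del & mm_d Y (psi t) y0 < D],
      forall t t', c t -> c t' ->
        mm_d Y (psi t) (psi t') <= mm_d X (phi t) (phi t') + (2 * del + 2 * eta) &
      forall kap, eta < kap -> expands (fun j => prI [set t | c t = j]) (omap snd) isSome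
        (cell_close c) kap eta].
Proof.
have [dX0 dXE dXC dXT] := metX; have [dY0 dYE dYC dYT] := metY.
have del_gt0 := del0; have eta_gt0 := eta0.
have /choice[f hf] : forall j : 'I_K, exists f, Lip1 X f /\
    prI [set t | eta < `|mm_d Y (psi t) (ys j) - f (phi t)|] <= eta.
  by move=> j; have [f fL h] := aYX (dist_Lip1 (ys j) metY); exists f.
pose bad (j : 'I_K) t := eta < `|mm_d Y (psi t) (ys j) - f j (phi t)|.
pose bX t : {ffun 'I_M -> bool} := [ffun m : 'I_M => mm_d X (phi t) (xs m) < del].
pose bY t : {ffun 'I_K -> bool} := [ffun j : 'I_K => mm_d Y (psi t) (ys j) < del].
pose bD t := mm_d Y (psi t) y0 < D.
pose bB t : {ffun 'I_K -> bool} := [ffun j => bad j t].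
(* The cell is computed from finitely many measurable booleans, which makes its fibres measurable.
   Points outside a net or the ball, or where some approximant errs, go to [None]. *)
pose cv (v : {ffun 'I_M -> bool} * {ffun 'I_K -> bool} * ({ffun 'I_K -> bool} * bool)) :
    option ('I_M * 'I_K) :=
  if v.2.2 && [forall j, ~~ v.2.1 j] then
    if [pick m | v.1.1 m] is Some m then
      if [pick j | v.1.2 j] is Some j then Some (m, j) else None else None else None.
pose v t := ((bX t, bY t), (bB t, bD t)).
pose c t := cv (v t).
have mbad j : measurable ([set t | bad j t] : set (measurableTypeR R)).
  exact: (measurable_far eta gY gX (dist_Lip1 (ys j) metY) (hf j).1).
have mbD : measurable ([set t | bD t] : set (measurableTypeR R)).
  exact: measurable_dist_lt.
have mbX m : measurable ([set t | mm_d X (phi t) (xs m) < del] : set (measurableTypeR R)).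
  exact: measurable_dist_lt.
have mbY j : measurable ([set t | mm_d Y (psi t) (ys j) < del] : set (measurableTypeR R)).
  exact: measurable_dist_lt.
have mv w : measurable ([set t | v t = w] : set (measurableTypeR R)).
  apply: measurable_pair_fiber => j; apply: measurable_pair_fiber => j'.
  - exact: measurable_ffun_fiber.
  - exact: measurable_ffun_fiber.
  - exact: measurable_ffun_fiber.
  - case: j'; first exact: mbD.
    have -> : [set t | bD t = false] = ~` [set t | bD t].
      by apply/seteqP; split => t /=; case: (bD t) => //= /(_ isT).
    exact: measurableC.
have mc j : measurable ([set t | c t = j] : set (measurableTypeR R)).
  exact: (measurable_fin_preimage (fun w => cv w = j) mv).
have cS t p : c t = Some p -> [/\ mm_d X (phi t) (xs p.1) < del,
    mm_d Y (psi t) (ys p.2) < del, mm_d Y (psi t) y0 < D & forall j, ~~ bad j t].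
  rewrite /c /cv /=; case: ifP => // /andP[hD /forallP hB].
  case: pickP => // m; rewrite ffunE => hm; case: pickP => // j; rewrite ffunE => hj [<-].
  by split=> // j'; have := hB j'; rewrite ffunE.
exists c; split.
- exact: mc.
- pose NX := [set t | exists2 m, (m < M)%N & mm_d X (phi t) (xs m) < del].
  pose NY := [set t | exists2 j, (j < K)%N & mm_d Y (psi t) (ys j) < del].
  have NXE : NX = [set t | exists m : 'I_M, mm_d X (phi t) (xs m) < del].
    apply/seteqP; split => t /= [m]; first by move=> mM h; exists (Ordinal mM).
    by move=> h; exists m.
  have NYE : NY = [set t | exists j : 'I_K, mm_d Y (psi t) (ys j) < del].
    apply/seteqP; split => t /= [m]; first by move=> mM h; exists (Ordinal mM).
    by move=> h; exists m.
  have mNX : measurable (NX : set (measurableTypeR R)).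
    by rewrite NXE; exact: (prI_ex_le (fun m : 'I_M => mbX m)).1.
  have mNY : measurable (NY : set (measurableTypeR R)).
    by rewrite NYE; exact: (prI_ex_le (fun m : 'I_K => mbY m)).1.
  have [mB hB] := prI_ex_le mbad.
  have hBK : prI [set t | exists j, bad j t] <= K%:R * eta.
    apply: (le_trans hB); rewrite -[K in K%:R]card_ord mulr_natl -sumr_const.
    by apply: ler_sum => j _; exact: (hf j).2.
  have mU1 : measurable (~` NX `|` ~` NY : set (measurableTypeR R)).
    by apply: measurableU; exact: measurableC.
  have mU2 : measurable (~` NX `|` ~` NY `|` ~` [set t | bD t] : set (measurableTypeR R)).
    by apply: measurableU => //; exact: measurableC.
  apply: (@le_trans _ _ (prI ((~` NX `|` ~` NY `|` ~` [set t | bD t]) `|`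
      [set t | exists j, bad j t]))).
    apply: le_prI => //; first exact: measurableU.
    move=> t [_ /=]; rewrite /c /cv /=.
    case: (boolP (bD t)) => hD /=; last by left; right; apply/negP.
    case: (boolP [forall j, ~~ bB t j]) => [hBt|/forallPn[j]] /=; last first.
      by rewrite ffunE negbK => hj; right; exists j.
    case: pickP => [m _|nX]; last first.
      by left; left; left; rewrite NXE => -[m hm]; have := nX m; rewrite ffunE hm.
    case: pickP => [j _//|nY].
    by left; left; right; rewrite NYE => -[j hj]; have := nY j; rewrite ffunE hj.
  apply: (le_trans (prIU_le mU2 mB)).
  apply: (@le_trans _ _ (3 * eps + prI [set t | exists j, bad j t])).
    rewrite lerD2r; apply: (le_trans (prIU_le mU1 (measurableC mbD))).
    apply: (@le_trans _ _ (prI (~` NX) + prI (~` NY) + prI (~` [set t | bD t]))).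
      by rewrite lerD2r; apply: prIU_le; exact: measurableC.
    by rewrite !prIC //; move: netX netY ballY; rewrite -/NX -/NY -/bD; lra.
  by rewrite lerD2l.
- by move=> t p /cS[].
- move=> t t'; case Ec : (c t) => [[m j]|] //; case Ec' : (c t') => [[m' j']|] // _ _.
  have [_ /= h1 _ b1] := cS _ _ Ec; have [_ /= _ _ b2] := cS _ _ Ec'.
  have := b1 j; have := b2 j; rewrite /bad -!leNgt !ler_norml => /andP[? ?] /andP[? ?].
  have := (hf j).1 (phi t) (phi t'); rewrite ler_norml => /andP[? ?].
  by have := dYT (psi t) (ys j) (psi t'); rewrite (dYC (ys j)); lra.
- move=> kap etakap A Aok Api kA.
  pose S := [set t | c t \in A].
  have mS : measurable (S : set (measurableTypeR R)).
    exact: (measurable_fin_preimage (fun j => j \in A) mc).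
  have prS : prI S = weight (fun j => prI [set t | c t = j]) A.
    exact: (prI_fin (fun j => j \in A) mc).
  have S0 : S !=set0.
    have [|t _ St] := prI_ex mS; last by exists t.
    by rewrite prS; apply: lt_le_trans kA; exact: lt_trans etakap.
  (* Here [h] is the distance in [X] to the image of [S]. *)
  have [|h [hL hS hinf]] := mcshane (u := fun=> 0 : R) (p := phi) (e := 0) metX S0.
    by move=> s s' _ _; rewrite subrr addr0; exact: dX0.
  have [g gL hg] := aXY hL.
  pose far := [set t | eta < `|h (phi t) - g (psi t)|].
  have mfar : measurable (far : set (measurableTypeR R)) by exact: measurable_far.
  (* [S] has mass at least [kap], more than the mass [eta] allowed for [far]. At [t0] the
     approximant [g] is at most [eta], and being 1-Lipschitz it bounds [h] at every [t'] outside
     [far]. *)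
  have [t0 St0 nfar] : exists2 t0, S t0 & ~ far t0.
    apply: contrapT => /forall2NP hall.
    have : prI S <= prI far.
      by apply: le_prI => // t [_ St]; have [//|/contrapT] := hall t.
    by rewrite prS leNgt (le_lt_trans hg (lt_le_trans etakap kA)).
  have gt0 : g (psi t0) <= eta.
    move: nfar; rewrite /far /= => /negP; rewrite -leNgt ler_norml => /andP[? ?].
    by have /andP[? ?] := hS t0 St0; lra.
  apply: le_trans hg.
  rewrite -(prI_fin (fun j => [forall a in A, ~~ cell_close c j a]) mc).
  apply: le_prI => //.
    exact: (measurable_fin_preimage (fun j => [forall a in A, ~~ cell_close c j a]) mc).
  move=> t' [_ /= /forall_inP bt']; rewrite ltNge; apply/negP.
  rewrite ler_norml => /andP[_ ht'].
  have /hinf[t St] : h (phi t') < mm_d Y (psi t') (psi t0) + 2 * eta + del.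
    by have := gL (psi t') (psi t0); rewrite ler_norml => /andP[_ ?]; lra.
  rewrite add0r => tt'; have := bt' (c t) St.
  rewrite /cell_close negb_or negbK => /andP[ct' /asboolP]; apply => s' s cs' cs.
  case Ect' : (c t') ct' cs' => [p'|//] _ cs'.
  have cA : isSome (c t) by exact: (Aok _ St).
  case Ect : (c t) cA cs => [p|//] _ cs.
  have cA0 : isSome (c t0) by exact: (Aok _ St0).
  (* As [A] lies in one block, [t] and [t0] share their net point in [Y], so [psi t0] is within
     [2 * del] of [psi s]. The 9 counts two changes of point within a ball in [X] and two in [Y],
     each worth [2 * del], and one [del] from the infimum. *)
  have p0E := Api _ _ St St0.
  case Ect0 : (c t0) cA0 p0E => [p0|//] _; rewrite Ect /= => -[p0E].
  have [/= x1 y1 _ _] := cS _ _ Ect'; have [/= x2 y2 _ _] := cS _ _ cs'.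
  have [/= x3 y3 _ _] := cS _ _ Ect; have [/= x4 y4 _ _] := cS _ _ cs.
  have [/= _ y5 _ _] := cS _ _ Ect0; rewrite -p0E in y5.
  have := dXT (phi s') (phi t') (phi s); have := dXT (phi t') (phi t) (phi s).
  have := dXT (phi s') (xs p'.1) (phi t'); have := dXT (phi t) (xs p.1) (phi s).
  have := dYT (psi t') (psi s') (psi t0); have := dYT (psi s') (psi s) (psi t0).
  have := dYT (psi t') (ys p'.2) (psi s'); have := dYT (psi s) (ys p.2) (psi t0).
  rewrite (dXC (xs p'.1)) (dXC (xs p.1)) (dYC (ys p'.2)) (dYC (ys p.2)) (dXC (phi t') (phi t)).
  by lra.
Qed.

End Cells.

(** * Coupling products *)

Section ProductCoupling.
Context {R : realType} {N : nat}.

(** On [G] the function [f] is nearly 1-Lipschitz for the distance seen through [psi]; its McShane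
    extension to [Y] is the approximant. *)
Lemma approx_of_good (X Y : mmspace R) phi psi f (G : set R) (e : R) :
  is_metric (mm_d Y) -> gparam X phi -> gparam Y psi -> Lip1 X f ->
  measurable (G : set (measurableTypeR R)) -> prI (~` G) <= e ->
  (forall t t', G t -> G t' -> f (phi t') - f (phi t) <= mm_d Y (psi t) (psi t') + e) ->
  exists2 g, Lip1 Y g & prI [set t | e < `|f (phi t) - g (psi t)|] <= e.
Proof.
move=> mY gX gY fL mG Ge hG.
have [G0|G0] := pselect (G !=set0); last first.
  have L0 : Lip1 Y (fun=> 0) by move=> x y; rewrite subrr normr0; have [] := mY.
  exists (fun=> 0) => //; apply: le_trans Ge; apply: le_prI.
  - exact: (measurable_far e gX gY fL L0).
  - exact: measurableC.
  - by move=> t _ Gt; apply: G0; exists t.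
have [g [gL gG _]] := mcshane (u := fun t => f (phi t)) (p := psi) mY G0 hG.
exists g => //; apply: le_trans Ge; apply: le_prI.
- exact: (measurable_far e gX gY fL gL).
- exact: measurableC.
- move=> t [_ /= h] Gt; move: h; rewrite ltNge; apply/negP/negPn.
  by have /andP[? ?] := gG t Gt; rewrite ger0_norm; lra.
Qed.

Lemma measurable_theta1 (i : 'I_N) (A : set R) : measurable (A : set (measurableTypeR R)) ->
  measurable ([set t | A (theta i t)] : set (measurableTypeR R)).
Proof. by move=> mA; have := measurable_theta i measurableT mA; rewrite setTI. Qed.

Lemma prI_theta1 (i : 'I_N) (A : set R) : measurable (A : set (measurableTypeR R)) ->
  prI [set t | A (theta i t)] = prI A.
Proof.
move=> mA; pose B j := if j == i then A else setT.
have mB j : measurable (B j : set (measurableTypeR R)) by rewrite /B; case: ifP.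
have := prI_theta mB; rewrite (bigD1 i) //= big1 ?mulr1; last first.
  by move=> j /negbTE ji; rewrite /B ji prI_setT.
rewrite {2}/B eqxx => <-; congr prI; apply/seteqP; split => t /=.
  by move=> At j; rewrite /B; case: eqP => [->|].
by move=> /(_ i); rewrite /B eqxx.
Qed.

Context (Fn : nat -> ('I_N -> R) -> R) (F : ('I_N -> R) -> R).
Hypotheses (FnN : forall n, FN (Fn n)) (FNF : FN F)
  (FnF : forall s, nonneg_vec s -> Fn n s @[n --> \oo] --> F s).

Definition gap_vanishes : Prop := forall D : R, 0 < D ->
  sup [set Fn n s - Finf (Fn n) s | s in box D] @[n --> \oo] --> 0.

Variable Y : 'I_N -> mmspace R.
Hypothesis mY : forall i, is_mm (Y i).

(** The threshold [eta] is chosen before the spaces [X] and their parameters. Condition (3) guards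
    the second half only, because the first half is also applied in the counterexample. *)
Lemma product_coupling (e : R) : 0 < e ->
  exists2 eta : R, 0 < eta & exists n0, forall n, (n0 <= n)%N ->
  forall (X : 'I_N -> mmspace R) (phi : forall i, R -> Borel (mm_d (X i)))
    (psi : forall i, R -> Borel (mm_d (Y i))),
    (forall i, is_mm (X i)) ->
    (forall i, gparam (X i) (phi i)) -> (forall i, gparam (Y i) (psi i)) ->
    (forall i, approx (X i) (Y i) (phi i) (psi i) eta) ->
    (forall i, approx (Y i) (X i) (psi i) (phi i) eta) ->
  forall (mu : probability (Borel (dF (Fn n) X)) R) (nu : probability (Borel (dF F Y)) R),
    is_product_measure (Fn n) X mu -> is_product_measure F Y nu ->
    approx (product_mm (Fn n) X mu) (product_mm F Y nu)
      (@prodmap R N (Fn n) X phi) (@prodmap R N F Y psi) e /\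
    (gap_vanishes -> approx (product_mm F Y nu) (product_mm (Fn n) X mu)
      (@prodmap R N F Y psi) (@prodmap R N (Fn n) X phi) e).
Proof.
move=> e0.
have metY i : is_metric (mm_d (Y i)) by have [] := mY i.
have sepY i : dseparable (mm_d (Y i)) by have [] := mY i.
pose ys i := sval (cid (sepY i)).
have hys i : forall x (r : R), 0 < r -> exists n, mm_d (Y i) x (ys i n) < r :=
  svalP (cid (sepY i)).
(* Each factor discards at most [3 * eps + K * eta], hence [4 * eps], so the [N] factors together
   discard at most [e / 4]. *)
pose eps : R := e / (16 * N.+1%:R).
have N0 : 0 < N.+1%:R :> R by rewrite ltr0n.
have eps0 : 0 < eps by rewrite divr_gt0 // mulr_gt0.
have Neps : N%:R * (4 * eps) <= e / 4.
  have -> : e / 4 = N.+1%:R * (4 * eps) by rewrite /eps; field; rewrite gt_eqF.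
  by rewrite ler_wpM2r ?ler_nat //; lra.
have /choice[D0 hD0] : forall i, exists D0 : nat, forall D psi, (D0 <= D)%N ->
    gparam (Y i) psi -> 1 - eps <= prI [set t | mm_d (Y i) (psi t) point < D%:R].
  by move=> i; exact: ball_exhaust.
(* Two points in a ball of radius [Dn] are less than [D] apart. The successor keeps [D] positive
   even when the maximum is 0. *)
pose Dn := (\max_i D0 i).+1; pose D : R := 2 * Dn%:R.
have D_gt0 : 0 < D by rewrite mulr_gt0 // ltr0n.
have e4 : 0 < e / 4 by lra.
have [del1 del10 [n1 h1]] := FN_perturb FnN FNF FnF D_gt0 e4.
have [del2 del20 [n2 h2]] := FN_evt_small_near0 FnN FNF FnF e4.
(* [del3] must be fixed before [gap_vanishes] is assumed; if that condition fails, 1 is taken as a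
   default. *)
have [del3 del30 [n3 h3]] : exists2 del : R, 0 < del & exists n0, gap_vanishes ->
    forall n, (n0 <= n)%N -> forall a b, box D a -> nonneg_vec b ->
      (forall i, a i <= b i + del) -> F a <= Fn n b + e / 4.
  have [gv|ngv] := pselect gap_vanishes; last by exists 1 => //; exists 0%N.
  have [del del0 [n0 h]] := FN_lower_perturb FnN FNF FnF gv D_gt0 e4.
  by exists del => //; exists n0.
(* The largest error met below is [11 * del + 2 * eta], at most [13 * del]. *)
pose del : R := Num.min del1 (Num.min del2 del3) / 20.
have del0 : 0 < del by rewrite divr_gt0 // !lt_min del10 del20.
have dd1 : 20 * del <= del1 by rewrite /del mulrC divfK // ge_min lexx.
have dd2 : 20 * del <= del2 by rewrite /del mulrC divfK // !ge_min lexx orbT.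
have dd3 : 20 * del <= del3 by rewrite /del mulrC divfK // !ge_min lexx !orbT.
have /choice[K0 hK0] : forall i, exists K0, forall K psi, (K0 <= K)%N -> gparam (Y i) psi ->
    1 - eps <= prI [set t | exists2 j, (j < K)%N & mm_d (Y i) (psi t) (ys i j) < del].
  by move=> i; exact: (net_exhaust (mY i) (hys i) del0 eps0).
pose K := (\max_i K0 i)%N.
(* Blocks are indexed by net points of the limits alone. [expands_good_set] loses [P * kap] twice,
   and [kap] makes each loss at most [e / 8]. *)
pose P : R := #|{ffun 'I_N -> option 'I_K}|%:R.
have P0 : 0 <= P by rewrite /P ler0n.
pose kap := e / (8 * (P + 1)).
have kap0 : 0 < kap by rewrite divr_gt0 // mulr_gt0 //; lra.
have Pkap : P * kap <= e / 8.
  have -> : e / 8 = (P + 1) * kap by rewrite /kap; field; lra.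
  by rewrite ler_wpM2r //; [exact: ltW|lra].
have [k k0 [e' e'0 HE]] := expands_ffun N kap0 kap0.
have K1 : 0 < K.+1%:R :> R by rewrite ltr0n.
(* The bound [k / 2] provides the strict inequality [eta < k] that [cells] demands for expansion at
   threshold [k]. *)
pose eta := Num.min (Num.min del (eps / K.+1%:R)) (Num.min (k / 2) e').
have eta0 : 0 < eta.
  by rewrite !lt_min del0 e'0 divr_gt0 //= andbT; lra.
have eta_del : eta <= del by rewrite !ge_min lexx.
have eta_k : eta < k.
  by apply: (@le_lt_trans _ _ (k / 2)); [rewrite !ge_min lexx !orbT|lra].
have eta_e' : eta <= e' by rewrite !ge_min lexx !orbT.
have Keta : K%:R * eta <= eps.
  apply: (@le_trans _ _ (K.+1%:R * (eps / K.+1%:R))); last first.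
    by rewrite mulrC divfK // gt_eqF.
  apply: ler_pM => //; [exact: ltW|by rewrite ler_nat|].
  by rewrite /eta !ge_min lexx !orbT.
exists eta => //; exists (maxn n1 (maxn n2 n3)) => n.
rewrite !geq_max => /and3P[n1n n2n n3n] X phi psi mX gX gY aXY aYX mu nu pmu pnu.
have metX i : is_metric (mm_d (X i)) by have [] := mX i.
have sepX i : dseparable (mm_d (X i)) by have [] := mX i.
pose xs i := sval (cid (sepX i)).
have hxs i : forall x (r : R), 0 < r -> exists n, mm_d (X i) x (xs i n) < r :=
  svalP (cid (sepX i)).
have /choice[M0 hM0] : forall i, exists M0, forall M phi, (M0 <= M)%N -> gparam (X i) phi ->
    1 - eps <= prI [set t | exists2 j, (j < M)%N & mm_d (X i) (phi t) (xs i j) < del].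
  by move=> i; exact: (net_exhaust (mX i) (hxs i) del0 eps0).
pose M := (\max_i M0 i)%N.
have /choice[c hc] := fun i => cells (metX i) (metY i) (gX i) (gY i) (aXY i) (aYX i) del0 eta0
  (hM0 i M (phi i) (leq_bigmax i) (gX i)) (hK0 i K (psi i) (leq_bigmax i) (gY i))
  (hD0 i Dn (psi i) (leqW (leq_bigmax i)) (gY i)).
pose J : finType := option ('I_M * 'I_K).
have mc i j : measurable ([set t | c i t = j] : set (measurableTypeR R)) by have [] := hc i.
pose w i j := prI [set t | c i t = j].
have w0 i j : 0 <= w i j by exact: prI_ge0.
have w1 i : \sum_j w i j = 1.
  rewrite -[LHS](prI_fin xpredT (mc i)) -(@prI_setT R); congr prI.
  by apply/seteqP; split.
pose C t : {ffun 'I_N -> J} := [ffun i => c i (theta i t)].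
have CE j : [set t | C t = j] = [set t | forall i, [set t | c i t = j i] (theta i t)].
  apply/seteqP; split => t /= => [<- i|h]; first by rewrite ffunE.
  by apply/ffunP => i; rewrite ffunE; exact: h.
have mC j : measurable ([set t | C t = j] : set (measurableTypeR R)).
  by rewrite CE; apply: (measurable_theta_preimage (A := fun i => [set t | c i t = j i])).
have CW j : prI [set t | C t = j] = \prod_i w i (j i).
  by rewrite CE (prI_theta (A := fun i => [set t | c i t = j i])).
pose ok (j : {ffun 'I_N -> J}) := [forall i, isSome (j i)].
pose Phi := @prodmap R N (Fn n) X phi; pose Psi := @prodmap R N F Y psi.
have gPhi : gparam (product_mm (Fn n) X mu) Phi by exact: prodmap_gparam.
have gPsi : gparam (product_mm F Y nu) Psi by exact: prodmap_gparam.
have metPX : is_metric (mm_d (product_mm (Fn n) X mu)) by exact: dF_metric.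
have metPY : is_metric (mm_d (product_mm F Y nu)) by exact: dF_metric.
pose a t t' i := mm_d (Y i) (psi i (theta i t)) (psi i (theta i t')).
pose b t t' i := mm_d (X i) (phi i (theta i t)) (phi i (theta i t')).
have dPhi t t' : dF (Fn n) X (Phi t) (Phi t') = Fn n (b t t').
  by congr (Fn n _); apply/funext => i; rewrite !ffunE.
have dPsi t t' : dF F Y (Psi t) (Psi t') = F (a t t').
  by congr F; apply/funext => i; rewrite !ffunE.
have b0 t t' : nonneg_vec (b t t') by move=> i; have [h _ _ _] := metX i; exact: h.
have oka t i : ok (C t) -> isSome (c i (theta i t)).
  by move=> /forallP/(_ i); rewrite ffunE.
have aD t t' : ok (C t) -> ok (C t') -> box D (a t t').
  move=> okt okt' i; have [d0 _ dC dT] := metY i; rewrite d0 /=.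
  have [_ _ hS _ _] := hc i; have := oka t i okt; have := oka t' i okt'.
  case E' : (c i (theta i t')) => [p'|//] _; case E : (c i (theta i t)) => [p|//] _.
  have [_ _ h] := hS _ _ E; have [_ _ h'] := hS _ _ E'.
  by have := dT (psi i (theta i t)) point (psi i (theta i t')); rewrite (dC point) /D /a; lra.
have ab t t' : ok (C t) -> ok (C t') -> forall i, a t t' i <= b t t' i + (2 * del + 2 * eta).
  by move=> okt okt' i; have [_ _ _ h _] := hc i; apply: h; exact: oka.
have okbad : prI [set t | ~~ ok (C t)] <= e / 4.
  have mN i : measurable ([set t | c i (theta i t) = None] : set (measurableTypeR R)).
    exact: measurable_theta1 (mc i None).
  have [mE hE] := prI_ex_le mN.
  apply: (@le_trans _ _ (prI [set t | exists i, c i (theta i t) = None])).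
    apply: le_prI => //; first exact: (measurable_fin_preimage (fun j => ~~ ok j) mC).
    move=> t [_ /= /forallPn[i]]; rewrite ffunE => h; exists i.
    by move: h; case: (c i _).
  apply: (le_trans hE); apply: le_trans Neps.
  rewrite -[N in N%:R]card_ord mulr_natl -sumr_const; apply: ler_sum => i _.
  rewrite (prI_theta1 i (mc i None)); have [_ h _ _ _] := hc i.
  by apply: (le_trans h); lra.
split; last first.
  (* In this direction the one-sided bound [ab] is enough, since [h3] has condition (3) built in. *)
  move=> gv g gL.
  apply: (@approx_of_good (product_mm F Y nu) (product_mm (Fn n) X mu) Psi Phi g
    [set t | ok (C t)] e metPX gPsi gPhi gL).
  - exact: (measurable_fin_preimage ok mC).
  - have -> : ~` [set t | ok (C t)] = [set t | ~~ ok (C t)].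
      by apply/seteqP; split => t /= /negP.
    by lra.
  - move=> t t' okt okt'.
    apply: (le_trans (le_trans (ler_norm _) (gL _ _))).
    rewrite /= -/Phi -/Psi dPsi dPhi.
    have -> : b t t' = b t' t by apply/funext => i; have [_ _ dC _] := metX i; exact: dC.
    have := h3 gv n n3n _ _ (aD _ _ okt' okt) (b0 t' t).
    have h i : a t' t i <= b t' t i + del3 by have := ab _ _ okt' okt i; lra.
    by move=> /(_ h); lra.
move=> f fL.
pose pi (i : 'I_N) (j : J) : option 'I_K := omap snd j.
pose r i := cell_close (phi i) (psi i) del eta (c i).
have Ei i : expands (w i) (pi i) isSome (r i) k e'.
  have [_ _ _ _ h] := hc i; apply: expandsW (h k eta_k) => //.
have E := HE J (option 'I_K) w pi (fun _ => isSome) r w0 w1 Ei.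
(* A sample point of each cell, so that [f] becomes a function of the cell. The default 0 occurs
   only for empty cells, which have weight 0. *)
pose rep (j : {ffun 'I_N -> J}) : R := xget 0 [set t | C t = j].
pose ft j := f (Phi (rep j)).
have W0 (j : {ffun 'I_N -> J}) : 0 <= \prod_i w i (j i) by exact: prodr_ge0.
have [G [Gok Gw Gk]] := expands_good_set ft W0 (ltW kap0) (ltW kap0) E.
have mG := measurable_fin_preimage (fun j => j \in G) mC.
have repE (j : {ffun 'I_N -> J}) : \prod_i w i (j i) != 0 -> C (rep j) = j.
  rewrite -CW => wj; rewrite /rep; case: xgetP => [t _ //|h].
  have [|t _ /= /h //] := prI_ex (mC j).
  by rewrite lt_neqAle eq_sym wj prI_ge0.
apply: (@approx_of_good (product_mm (Fn n) X mu) (product_mm F Y nu) Phi Psi f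
  [set t | C t \in G] e metPY gPhi gPsi fL).
- exact: mG.
- have -> : ~` [set t | C t \in G] = [set t | C t \notin G].
    by apply/seteqP; split => t /= /negP.
  rewrite (prI_fin (fun j => j \notin G) mC).
  under eq_bigr => j _ do rewrite CW.
  apply: (le_trans Gw); rewrite -/P.
  have : \sum_(j | ~~ ok j) \prod_i w i (j i) <= e / 4.
    under eq_bigr => j _ do rewrite -CW.
    by rewrite -(prI_fin (fun j => ~~ ok j) mC).
  by rewrite /ok; lra.
- move=> t t' Gt Gt'.
  (* The path from [t'] to [t] goes through the sample points [u] of cell [j] and [v] of the cell of
     [t]: [u] is at the right distance from [t'], [f] at [u] is at most [f] at [v], and [v] is close
     to [t]. *)
  have [j [okj pij wj fj rj]] := Gk _ _ Gt' Gt.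
  pose u := rep j; have Cu : C u = j by exact: repE.
  have okt := Gok _ Gt; have okt' := Gok _ Gt'.
  have oku : ok (C u) by rewrite Cu.
  pose v := rep (C t).
  have Cv : C v = C t by rewrite /v /rep; case: xgetP => [x _ //|/(_ t) []].
  have same i : exists m l, [/\ c i (theta i t) = Some (m, l), c i (theta i v) = Some (m, l)
      & exists m', c i (theta i u) = Some (m', l)].
    have := oka t i okt; have := oka u i oku.
    case Eu : (c i (theta i u)) => [[m' l']|//] _; case Et : (c i (theta i t)) => [[m l]|//] _.
    exists m, l; split=> //; last first.
      exists m'; move/ffunP: pij => /(_ i); rewrite -Cu !ffunE Eu Et /= => -[->//].
    by move/ffunP: Cv => /(_ i); rewrite !ffunE Et.
  have s1 : f (Phi t') - f (Phi u) <= Fn n (b t' u).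
    by apply: (le_trans (le_trans (ler_norm _) (fL _ _))); rewrite /= dPhi.
  have s3 : f (Phi v) - f (Phi t) <= Fn n (b v t).
    by apply: (le_trans (le_trans (ler_norm _) (fL _ _))); rewrite /= dPhi.
  have s2 : f (Phi u) <= f (Phi v) by exact: fj.
  have bvt : Fn n (b v t) <= e / 4.
    apply: h2 => // i; have [m [l [Et Ev _]]] := same i.
    have [_ _ hS _ _] := hc i; have [/= ht _ _] := hS _ _ Et; have [/= hv _ _] := hS _ _ Ev.
    have [_ _ dC dT] := metX i.
    have := dT (phi i (theta i v)) (xs i m) (phi i (theta i t)); rewrite (dC (xs i m)) /b; lra.
  have btu : Fn n (b t' u) <= F (a t t') + e / 4.
    apply: h1 => //; first exact: aD.
    move=> i; have [m [l [Et _ [m' Eu]]]] := same i.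
    have [_ _ hS _ _] := hc i; have [/= _ yt _] := hS _ _ Et; have [/= _ yu _] := hS _ _ Eu.
    have [_ _ dC dT] := metY i.
    have := ab t' u okt' oku i.
    have : b t' u i <= a t' u i + (9 * del + 2 * eta).
      move/forallP: rj => /(_ i); rewrite /r /cell_close -Cu !ffunE (oka _ _ okt') /=.
      by move=> /asboolP; exact.
    have := dT (psi i (theta i u)) (ys i l) (psi i (theta i t)).
    have := dT (psi i (theta i t)) (psi i (theta i u)) (psi i (theta i t')).
    have := dT (psi i (theta i u)) (psi i (theta i t)) (psi i (theta i t')).
    rewrite (dC (psi i (theta i t)) (psi i (theta i u))) (dC (ys i l)).
    have -> : a t' u i = a u t' i by exact: dC.
    rewrite -/(a u t' i) -/(a t t' i) ler_norml => ? ? ? ? ?.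
    by apply/andP; split; lra.
  by rewrite /= -/Phi -/Psi dPsi; lra.
Qed.

End ProductCoupling.

(** * Condition (3) implies condition (1) *)

Section Sufficiency.
Context {R : realType} {N : nat}.
Context (Fn : nat -> ('I_N -> R) -> R) (F : ('I_N -> R) -> R).
Hypotheses (FnN : forall n, FN (Fn n)) (FNF : FN F)
  (FnF : forall s, nonneg_vec s -> Fn n s @[n --> \oo] --> F s).

Lemma gap_vanishes_concentrates (X : nat -> 'I_N -> mmspace R) (Y : 'I_N -> mmspace R)
    (mu : forall n, probability (Borel (dF (Fn n) (X n))) R)
    (nu : probability (Borel (dF F Y)) R) :
  gap_vanishes Fn ->
  (forall n i, is_mm (X n i)) -> (forall i, is_mm (Y i)) ->
  (forall i, concentrates (fun n => X n i) (Y i)) ->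
  (forall n, is_product_measure (Fn n) (X n) (mu n)) -> is_product_measure F Y nu ->
  concentrates (fun n => product_mm (Fn n) (X n) (mu n)) (product_mm F Y nu).
Proof.
move=> gv mX mY XY pmu pnu; apply/concentratesP => [n|e e0]; first exact: dF_metric.
have e20 : 0 < e / 2 by lra.
have [eta eta0 [n0 hn0]] := product_coupling FnN FNF FnF mY e20.
have /choice[m hm] : forall i, exists m, forall n, (m <= n)%N ->
    (dconc (X n i) (Y i) < eta%:E)%E.
  move=> i; have [n|h _] := @concentratesP R (fun n => X n i) (Y i); last exact: h.
  by have [] := mX n i.
exists (maxn n0 (\max_i m i)) => n; rewrite geq_max => /andP[n0n mn].
have hi i := dconc_lt (hm i n (leq_trans (leq_bigmax i) mn)).
pose phi i := sval (cid (hi i)); have hphi i := svalP (cid (hi i)).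
pose psi i := sval (cid (hphi i)).
have hpsi i : [/\ gparam (X n i) (phi i), gparam (Y i) (psi i),
    approx (X n i) (Y i) (phi i) (psi i) eta & approx (Y i) (X n i) (psi i) (phi i) eta].
  exact: svalP (cid (hphi i)).
have gX i : gparam (X n i) (phi i) by have [] := hpsi i.
have gY i : gparam (Y i) (psi i) by have [] := hpsi i.
have aXY i : approx (X n i) (Y i) (phi i) (psi i) eta by have [] := hpsi i.
have aYX i : approx (Y i) (X n i) (psi i) (phi i) eta by have [] := hpsi i.
have [h1 h2] := hn0 n n0n (X n) phi psi (mX n) gX gY aXY aYX (mu n) nu (pmu n) pnu.
apply: (@le_lt_trans _ _ (e / 2)%:E); last by rewrite lte_fin; lra.
apply: (dconc_le (ltW e20) _ _ h1 (h2 gv)); exact: prodmap_gparam.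
Qed.

End Sufficiency.

(** * Concentration on the discrete cube *)

Section Cube.
Context {R : realType}.

Definition mean (k : nat) (f : {ffun 'I_k -> bool} -> R) : R :=
  2^-1 ^+ k * \sum_a f a.

Definition variance_cube (k : nat) (f : {ffun 'I_k -> bool} -> R) : R :=
  mean (fun a => (f a - mean f) ^+ 2).

Definition hamming (k : nat) (a b : {ffun 'I_k -> bool}) : R :=
  \sum_i (a i != b i)%:R.

Lemma half_pow_gt0 k : 0 < 2^-1 ^+ k :> R.
Proof. by rewrite exprn_gt0 // invr_gt0. Qed.

Lemma mean_le k (f g : {ffun 'I_k -> bool} -> R) : (forall a, f a <= g a) -> mean f <= mean g.
Proof. by move=> fg; rewrite ler_pM2l ?half_pow_gt0 //; apply: ler_sum => a _. Qed.

Lemma meanD k (f g : {ffun 'I_k -> bool} -> R) : mean (fun a => f a + g a) = mean f + mean g.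
Proof. by rewrite /mean big_split mulrDr. Qed.

Lemma meanZ k (f : {ffun 'I_k -> bool} -> R) c : mean (fun a => c * f a) = c * mean f.
Proof. by rewrite /mean -mulr_sumr mulrCA. Qed.

Lemma mean_cst k c : mean (fun _ : {ffun 'I_k -> bool} => c) = c.
Proof.
rewrite /mean sumr_const card_ffun card_ord card_bool -[c *+ _]mulr_natr natrX exprVn.
by rewrite mulrCA mulVf ?mulr1 // expf_neq0.
Qed.

Lemma mean_cons k (f : {ffun 'I_k.+1 -> bool} -> R) :
  mean f = (mean (fun a => f (ffun_cons (false, a))) + mean (fun a => f (ffun_cons (true, a)))) / 2.
Proof.
rewrite /mean exprS -mulrDr.
have -> : \sum_a f a = \sum_(b : bool) \sum_a f (ffun_cons (b, a)).
  rewrite (reindex (@ffun_cons k bool)) /=.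
    by rewrite pair_bigA; apply: eq_bigr => -[].
  exact: onW_bij (Bijective (@ffun_consK k bool) (@ffun_splitK k bool)).
by rewrite big_bool /= [X in _ * X]addrC; ring.
Qed.

Lemma mean_sq k (f : {ffun 'I_k -> bool} -> R) x :
  mean (fun a => (f a - x) ^+ 2) = variance_cube f + (mean f - x) ^+ 2.
Proof.
have E y : mean (fun a => (f a - y) ^+ 2) = mean (fun a => f a ^+ 2) - 2 * y * mean f + y ^+ 2.
  transitivity (mean (fun a => f a ^+ 2 + ((- (2 * y)) * f a + y ^+ 2))).
    by congr (_ * _); apply: eq_bigr => a _; ring.
  by rewrite !meanD meanZ mean_cst; ring.
by rewrite /variance_cube !E; ring.
Qed.

Lemma hamming_cons k b (a a' : {ffun 'I_k -> bool}) :
  hamming (ffun_cons (b, a)) (ffun_cons (b, a')) = hamming a a'.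
Proof.
rewrite /hamming big_ord_recl !ffunE unlift_none eqxx /= add0r.
by apply: eq_bigr => i _; rewrite !ffunE liftK.
Qed.

Lemma hamming_cons_flip k (a : {ffun 'I_k -> bool}) :
  hamming (ffun_cons (false, a)) (ffun_cons (true, a)) = 1.
Proof.
rewrite /hamming big_ord_recl !ffunE unlift_none /= big1 ?addr0 // => i _.
by rewrite !ffunE liftK eqxx.
Qed.

(* The Efron-Stein inequality, by splitting off one coordinate at a time. *)
Lemma variance_cube_le k (f : {ffun 'I_k -> bool} -> R) (c : R) : 0 <= c ->
  (forall a b, `|f a - f b| <= c * hamming a b) -> variance_cube f <= k%:R * c ^+ 2 / 4.
Proof.
move=> c0; elim: k f => [|k IH] f fc.
  rewrite !mul0r /variance_cube (_ : (fun a => _) = fun=> 0) ?mean_cst //.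
  apply/funext => a; have -> : f = fun=> f a.
    by apply/funext => b; congr f; apply/ffunP => -[].
  by rewrite mean_cst subrr expr0n.
pose f0 a := f (ffun_cons (false, a)); pose f1 a := f (ffun_cons (true, a)).
have V0 : variance_cube f0 <= k%:R * c ^+ 2 / 4.
  by apply: IH => a b; apply: (le_trans (fc _ _)); rewrite hamming_cons.
have V1 : variance_cube f1 <= k%:R * c ^+ 2 / 4.
  by apply: IH => a b; apply: (le_trans (fc _ _)); rewrite hamming_cons.
have m01 : `|mean f0 - mean f1| <= c.
  have h a : `|f0 a - f1 a| <= c.
    by apply: (le_trans (fc _ _)); rewrite hamming_cons_flip mulr1.
  rewrite ler_norml lerBrDr lerBlDr; apply/andP; split.
    rewrite -[X in X + _](@mean_cst k) -meanD; apply: mean_le => a.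
    by have := h a; rewrite ler_norml => /andP[]; lra.
  rewrite -[X in X + _](@mean_cst k) -meanD; apply: mean_le => a.
  by have := h a; rewrite ler_norml => /andP[]; lra.
have m01sq : (mean f0 - mean f1) ^+ 2 <= c ^+ 2.
  by rewrite -real_normK ?num_real // ler_sqr ?nnegrE.
rewrite /variance_cube mean_cons -/f0 -/f1 !mean_sq (mean_cons f) -/f0 -/f1 -[k.+1%:R]natr1.
move: m01sq V0 V1; move: (variance_cube f0) (variance_cube f1) (mean f0) (mean f1) => v0 v1 m0 m1.
move: (k%:R) (c ^+ 2) => kk cc ? ? ?.
(* Law of total variance for the first coordinate. *)
have -> : (v0 + (m0 - (m0 + m1) / 2) ^+ 2 + (v1 + (m1 - (m0 + m1) / 2) ^+ 2)) / 2 =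
    (v0 + v1) / 2 + (m0 - m1) ^+ 2 / 4 by field.
by lra.
Qed.

Lemma chebyshev_cube k (f : {ffun 'I_k -> bool} -> R) (r v : R) : 0 < r ->
  variance_cube f <= v ->
  mean (fun a => (r < `|f a - mean f|)%R%:R) <= v / r ^+ 2.
Proof.
move=> r0 Vv; rewrite ler_pdivlMr ?exprn_gt0 // mulrC -meanZ.
apply: le_trans Vv; apply: mean_le => a.
case: ltP => h; rewrite ?mulr0 ?mulr1 ?sqr_ge0 //.
by rewrite -[leRHS]real_normK ?num_real // ler_sqr ?nnegrE // ltW.
Qed.

(** Flipping all bits preserves the mean, and the distances from [a] to [b] and to its flip add up
    to [k]. *)
Lemma hamming_mean k (a : {ffun 'I_k -> bool}) : mean (hamming a) = k%:R / 2.
Proof.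
pose flip (b : {ffun 'I_k -> bool}) : {ffun 'I_k -> bool} := [ffun i => ~~ b i].
have flipK : involutive flip by move=> b; apply/ffunP => i; rewrite !ffunE negbK.
have E : mean (hamming a) = mean (fun b => hamming a (flip b)).
  by congr (_ * _); rewrite (reindex flip) //=; exact: onW_bij (inv_bij flipK).
have S b : hamming a b + hamming a (flip b) = k%:R.
  rewrite /hamming -big_split /= -[k in RHS]card_ord -sumr_const; apply: eq_bigr => i _.
  by rewrite ffunE; case: (a i); case: (b i); rewrite /= ?addr0 ?add0r.
suff : mean (hamming a) + mean (hamming a) = k%:R by lra.
rewrite {2}E -meanD (_ : (fun b => _) = fun=> k%:R) ?mean_cst //.
by apply/funext => b; exact: S.
Qed.

Lemma hamming_ge0 k (a b : {ffun 'I_k -> bool}) : 0 <= hamming a b.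
Proof. by apply: sumr_ge0. Qed.

Lemma hamming_eq0 k (a b : {ffun 'I_k -> bool}) : hamming a b = 0 <-> a = b.
Proof.
split=> [h|->]; last by rewrite /hamming big1 // => i _; rewrite eqxx.
apply/ffunP => i; apply/eqP; move: h; apply: contra_eqT => ab.
by rewrite gt_eqF // /hamming (bigD1 i) //= ab ltr_pwDl // sumr_ge0.
Qed.

Lemma hamming_ge1 k (a b : {ffun 'I_k -> bool}) : a <> b -> 1 <= hamming a b.
Proof.
move=> ab; have [i abi] : exists i, a i != b i.
  apply: contrapT => /forallNP h; apply: ab; apply/ffunP => i.
  by apply/eqP/negPn/negP; exact: h.
by rewrite /hamming (bigD1 i) //= abi lerDl sumr_ge0.
Qed.

Lemma hammingC k (a b : {ffun 'I_k -> bool}) : hamming a b = hamming b a.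
Proof. by apply: eq_bigr => i _; rewrite eq_sym. Qed.

Lemma hamming_tri k (a b c : {ffun 'I_k -> bool}) : hamming a c <= hamming a b + hamming b c.
Proof.
rewrite /hamming -big_split /=; apply: ler_sum => i _.
by case: (a i); case: (b i); case: (c i) => /=; lra.
Qed.

(** Chebyshev: the mean is [k / 2], the variance at most [k / 4], the deviation more than
    [k / 4]. *)
Lemma hamming_concentration k (a : {ffun 'I_k -> bool}) : (0 < k)%N ->
  mean (fun b => (hamming a b < k%:R / 4)%R%:R) <= 4 / k%:R.
Proof.
move=> k0; have k0' : 0 < k%:R :> R by rewrite ltr0n.
have V : variance_cube (hamming a) <= k%:R * 1 ^+ 2 / 4.
  apply: variance_cube_le => // b c; rewrite mul1r ler_norml.
  have := hamming_tri a b c; have := hamming_tri a c b; rewrite (hammingC c b).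
  by move=> ? ?; apply/andP; split; lra.
have k4 : 0 < k%:R / 4 :> R by lra.
have := chebyshev_cube k4 V; rewrite hamming_mean.
have -> : k%:R * 1 ^+ 2 / 4 / (k%:R / 4) ^+ 2 = 4 / k%:R :> R by field; rewrite gt_eqF.
apply: le_trans; apply: mean_le => b; rewrite ler_nat.
case: (ltP (hamming a b)) => // h; rewrite lt0n eqb0 negbK.
by rewrite ltr0_norm; lra.
Qed.

End Cube.

(** * Two-point spaces and clusters of cubes *)

Section SpreadSpaces.
Context {R : realType}.

Definition push_mfun (T : pointedType) (d : T -> T -> R) (phi : R -> Borel d)
    (mphi : measurable_fun setT (phi : measurableTypeR R -> Borel d)) :
    {mfun measurableTypeR R >-> Borel d} :=
  HB.pack_for {mfun measurableTypeR R >-> Borel d} phi 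
    (isMeasurableFun.Build _ _ (measurableTypeR R) (Borel d) phi mphi).

Definition push_prob (T : pointedType) (d : T -> T -> R) (phi : R -> Borel d)
    (mphi : measurable_fun setT (phi : measurableTypeR R -> Borel d)) : probability (Borel d) R :=
  distribution lebI (push_mfun mphi).

Lemma push_gparam (T : pointedType) (d : T -> T -> R) (phi : R -> Borel d)
    (mphi : measurable_fun setT (phi : measurableTypeR R -> Borel d)) :
  gparam (MMSpace d (push_prob mphi)) phi.
Proof. by split. Qed.

(** A cluster and a vertex of the cube inside it. *)
Definition cellT (k : nat) : Type := (bool * {ffun 'I_k -> bool})%type.
HB.instance Definition _ k := Finite.on (cellT k).
HB.instance Definition _ k := isPointed.Build (cellT k) (false, [ffun=> false]).

Lemma finite_is_mm (T : pointedType) (l : seq T) (d : T -> T -> R) P (e0 : R) :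
  (forall x, exists n, nth point l n = x) -> is_metric d -> 0 < e0 ->
  (forall x y, d x y < e0 -> x = y) -> is_mm (@MMSpace R T d P).
Proof.
move=> enumT md e00 disc; have [d0 dE dC dT] := md; split=> //=.
- move=> u cu; have [m hm] := cu e0 e00; exists (u m) => e e_gt0; exists m => n mn.
  by rewrite (disc _ _ (hm n m mn (leqnn m))) (dE _ _).2.
- exists (nth point l) => x e e_gt0; have [n hn] := enumT x; exists n.
  by rewrite hn (dE _ _).2.
Qed.

Definition two_dist (s : R) (u v : bool) : R := s * (u != v)%:R.

Lemma two_dist_metric s : 0 < s -> is_metric (two_dist s).
Proof.
move=> s0; split=> [u v|u v|u v|u v w]; rewrite /two_dist.
- by rewrite mulr_ge0 // ltW.
- split=> [/eqP|->]; last by rewrite eqxx mulr0.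
  by rewrite mulf_eq0 gt_eqF //= pnatr_eq0 eqb0 negbK => /eqP.
- by rewrite eq_sym.
- rewrite -mulrDr ler_pM2l //.
  by case: u; case: v; case: w => /=; lra.
Qed.

Lemma measurable_finT (T : pointedType) (J : finType) (h : R -> J) (g : J -> T)
    (d : T -> T -> R) :
  (forall j, measurable ([set t | h t = j] : set (measurableTypeR R))) ->
  measurable_fun setT (g \o h : measurableTypeR R -> Borel d).
Proof.
by move=> mh _ A _; rewrite setTI; exact: (measurable_fin_preimage (fun j => A (g j)) mh).
Qed.

Lemma measurable_below (p : R) b :
  measurable ([set t | (t < p) = b] : set (measurableTypeR R)).
Proof.
have : measurable_fun setT (fun t : measurableTypeR R => t < p).
  by apply: measurable_fun_ltr => //; exact: measurable_id.
by move=> /(_ measurableT [set b] Logic.I); rewrite setTI.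
Qed.

Lemma measurable_two (s p : R) :
  measurable_fun setT ((fun t => t < p) : measurableTypeR R -> Borel (two_dist s)).
Proof. exact: (@measurable_finT bool bool (fun t => t < p) id (two_dist s) (measurable_below p)). Qed.

Definition two_point (s p : R) : mmspace R :=
  MMSpace (two_dist s) (push_prob (@measurable_two s p)).

Lemma two_point_mm s p : 0 < s -> is_mm (two_point s p).
Proof.
move=> s0; apply: (@finite_is_mm _ [:: false; true] _ _ s) => //.
- by case; [exists 1%N|exists 0%N].
- exact: two_dist_metric.
- move=> u v; rewrite /two_dist; case: eqP => // _; rewrite mulr1 ltxx //.
Qed.

Lemma prI_below (p : R) : 0 <= p <= 1 -> prI [set t | t < p] = p.
Proof.
move=> /andP[p0 p1]; rewrite /prI -lebIE.
have -> : I01 `&` [set t | t < p] = `[0, p[%classic.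
  apply/seteqP; split => t; rewrite /I01 /= !in_itv /=.
    by move=> [/andP[-> _] ->].
  by move=> /andP[-> tp]; split=> //; exact: lt_le_trans tp p1.
rewrite lebesgue_measure_itv /= lte_fin.
case: ltP => [_|]; first by rewrite sube0.
by move=> h; apply/le_anti; rewrite h p0.
Qed.

(** Truncation makes most distances inside a cluster exactly [tau], and the sum makes most distances
    across clusters exactly [s + tau]. *)
Definition spread_dist (s tau c : R) (k : nat) (x y : cellT k) : R :=
  two_dist s x.1 y.1 + Num.min (c * hamming x.2 y.2) tau.

Lemma spread_dist_metric s tau c k : 0 < s -> 0 < tau -> 0 < c ->
  is_metric (@spread_dist s tau c k).
Proof.
move=> s0 tau0 c0; have [d0 dE dC dT] := two_dist_metric s0.
have m0 (a b : {ffun 'I_k -> bool}) : 0 <= Num.min (c * hamming a b) tau.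
  by rewrite le_min (ltW tau0) andbT mulr_ge0 ?hamming_ge0 // ltW.
split=> [x y|x y|x y|x y z]; rewrite /spread_dist.
- by rewrite addr_ge0.
- split=> [/eqP|->].
    rewrite paddr_eq0 // => /andP[/eqP/dE h1 /eqP h2].
    rewrite (surjective_pairing x) (surjective_pairing y) h1; congr pair.
    apply/(hamming_eq0 (R := R)); move: h2; case: leP => [_ /eqP|_ tau00].
      by rewrite mulf_eq0 (gt_eqF c0) => /eqP.
    by rewrite tau00 ltxx in tau0.
  by rewrite (dE _ _).2 // add0r (hamming_eq0 _ _).2 // mulr0; apply/min_idPl; exact: ltW.
- by rewrite dC hammingC.
- rewrite addrACA; apply: lerD => //.
  have := ler_wpM2l (ltW c0) (hamming_tri x.2 y.2 z.2); rewrite mulrDr.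
  have := hamming_ge0 (R := R) x.2 y.2; have := hamming_ge0 (R := R) y.2 z.2.
  have hc := @mulr_ge0 R c _ (ltW c0).
  move=> /hc; set A := c * _ => A0 /hc; set B := c * _ => B0; set C := c * _.
  by case: (leP C tau); case: (leP A tau); case: (leP B tau); lra.
Qed.

Lemma spread_space (s tau p r : R) : 0 < s -> 0 < tau -> 0 < p < 1 -> 0 < r ->
  exists X : mmspace R, exists phi : R -> Borel (mm_d X), exists cl : mm_T X -> bool,
  [/\ is_mm X, gparam X phi, gparam (two_point s p) (cl \o phi),
      approx X (two_point s p) phi (cl \o phi) r /\ approx (two_point s p) X (cl \o phi) phi r &
      forall x, measurable ([set t | mm_d X x (phi t) <> two_dist s (cl x) (cl (phi t)) + tau]
          : set (measurableTypeR R)) /\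
        prI [set t | mm_d X x (phi t) <> two_dist s (cl x) (cl (phi t)) + tau] <= r].
Proof.
move=> s0 tau0 p01 r0.
(* The first term serves Chebyshev's inequality inside a cluster, the second the concentration of
   the Hamming distance; each then fails with probability at most [r]. *)
pose k := (Num.truncn (4 * tau ^+ 2 / r ^+ 3 + 4 / r)).+1.
have B1 : 0 <= 4 * tau ^+ 2 / r ^+ 3 by rewrite divr_ge0 ?mulr_ge0 ?sqr_ge0 ?exprn_ge0 // ltW.
have B2 : 0 <= 4 / r by rewrite divr_ge0 // ltW.
have kB : 4 * tau ^+ 2 / r ^+ 3 + 4 / r < k%:R by exact: truncnS_gt.
have k0 : 0 < k%:R :> R by rewrite ltr0n.
have k1 : 4 * tau ^+ 2 / r ^+ 3 <= k%:R by lra.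
have k2 : 4 / r <= k%:R by lra.
(* With this scale, Hamming distance [k / 4] already reaches [tau], while the variance bound
   [k * c ^ 2 / 4 = 4 * tau ^ 2 / k] decreases with [k]. *)
pose c := 4 * tau / k%:R.
have c0 : 0 < c by rewrite divr_gt0 // mulr_gt0.
pose d := @spread_dist s tau c k.
have md : is_metric d by exact: spread_dist_metric.
have [dd0 dE dC dT] := md.
pose th0 : R -> R := theta (ord0 : 'I_2); pose th1 : R -> R := theta (ord_max : 'I_2).
pose phi t : cellT k := (th0 t < p, pattern k (th1 t)).
have mth0 b : measurable ([set t | (th0 t < p) = b] : set (measurableTypeR R)).
  exact: (measurable_theta1 (ord0 : 'I_2) (measurable_below p b)).
have mth1 a : measurable ([set t | pattern k (th1 t) = a] : set (measurableTypeR R)).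
  exact: (measurable_theta1 (ord_max : 'I_2) (measurable_pattern a)).
have mfib (j : cellT k) : measurable ([set t | phi t = j] : set (measurableTypeR R)).
  exact: (measurable_pair_fiber j mth0 mth1).
have mphi : measurable_fun setT (phi : measurableTypeR R -> Borel d).
  exact: (@measurable_finT (cellT k) (cellT k) phi id d mfib).
pose X := MMSpace d (push_prob mphi).
pose w (u : bool) : R := prI [set t | (t < p) = u].
have w0 u : 0 <= w u by exact: prI_ge0.
have w1 : w false + w true = 1.
  have := prI_fin xpredT (measurable_below p); rewrite big_bool /= addrC => <-.
  by rewrite -(@prI_setT R); congr prI; apply/seteqP; split.
have law u a : prI [set t | phi t = (u, a)] = w u * 2^-1 ^+ k.
  pose A (i : 'I_2) := if i == ord0 then [set t | (t < p) = u] else [set t : R | pattern k t = a].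
  have mA i : measurable (A i : set (measurableTypeR R)).
    by rewrite /A; case: ifP => _; [exact: measurable_below|exact: measurable_pattern].
  have := prI_theta mA; rewrite big_ord_recl big_ord1 {2 3}/A /= prI_pattern -/(w u) => <-.
  congr prI; apply/seteqP; split => t /=.
    by move=> [h1 h2] i; rewrite /A; case: (unliftP ord0 i) => [i' ->|->] //=;
      have -> : lift ord0 i' = ord_max by apply: val_inj; case: i' => -[].
  by move=> h; have := h ord0; have := h ord_max; rewrite /A /= => h1 h2; congr pair.
have prQ (Q : cellT k -> bool) : prI [set t | Q (phi t)] =
    w false * mean (fun a => (Q (false, a))%:R) + w true * mean (fun a => (Q (true, a))%:R).
  rewrite (prI_fin Q mfib) big_mkcond /=.
  have -> : \sum_i (if Q i then prI [set t | phi t = i] else 0) =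
      \sum_(u : bool) \sum_a w u * (2^-1 ^+ k * (Q (u, a))%:R).
    rewrite pair_bigA /=; apply: eq_bigr => -[u a] _ /=.
    by rewrite law; case: (Q _); rewrite ?mulr1 ?mulr0.
  by rewrite big_bool /= -!mulr_sumr addrC.
have prQle (Q : cellT k -> bool) x : (forall u, mean (fun a => (Q (u, a))%:R) <= x) ->
    prI [set t | Q (phi t)] <= x.
  move=> h; rewrite prQ; apply: (@le_trans _ _ (w false * x + w true * x)).
    by apply: lerD; apply: ler_wpM2l.
  by rewrite -mulrDl w1 mul1r.
exists X, phi, fst; split.
- apply: (@finite_is_mm _ (enum {: cellT k}) _ _ (Num.min s (Num.min c tau))) => //.
  + by move=> x; exists (index x (enum {: cellT k})); rewrite nth_index // mem_enum.
  + by rewrite !lt_min s0 c0 tau0.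
  + move=> x y; rewrite !lt_min /d /spread_dist => /and3P[h1 h2 h3].
    have m0 : 0 <= Num.min (c * hamming x.2 y.2) tau.
      by rewrite le_min (ltW tau0) andbT mulr_ge0 ?hamming_ge0 // ltW.
    have [t0 _ _ _] := two_dist_metric s0.
    have e1 : x.1 = y.1.
      apply/eqP/negPn/negP => ne; move: h1; rewrite /two_dist ne mulr1.
      by lra.
    have e2 : x.2 = y.2.
      apply: contrapT => /(hamming_ge1 (R := R)) h.
      have := t0 x.1 y.1; move: h2 h3.
      have : c <= c * hamming x.2 y.2 by rewrite ler_peMr // ltW.
      by case: (leP (c * hamming x.2 y.2) tau); lra.
    by rewrite (surjective_pairing x) (surjective_pairing y) e1 e2.
- exact: push_gparam.
- split=> [|A _].
    exact: (@measurable_finT bool (cellT k) phi fst (two_dist s) mfib).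
  have mB : measurable ([set t | A (t < p)] : set (measurableTypeR R)).
    exact: (measurable_fin_preimage A (measurable_below p)).
  rewrite -[RHS]/(lebI [set t | A (t < p)]) (prIE mB) -(prI_theta1 (ord0 : 'I_2) mB).
  by rewrite -prIE //; exact: (measurable_theta1 (ord0 : 'I_2) mB).
- split=> [f fL|g gL].
    (* Averaging over a cluster stays 1-Lipschitz: equal vertices of the two clusters are exactly
       [s] apart. *)
    pose g u := mean (fun a => f (u, a)).
    have gL : Lip1 (two_point s p) g.
      move=> u v; rewrite -[mm_d _ _ _]/(two_dist s u v) /g ler_norml.
      have h a : `|f (u, a) - f (v, a)| <= two_dist s u v.
        apply: (le_trans (fL _ _)); rewrite /= /d /spread_dist /= (hamming_eq0 _ _).2 // mulr0.
        by rewrite (min_idPl (ltW tau0)) addr0.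
      rewrite lerBrDr lerBlDr; apply/andP; split.
        rewrite -[X in X + _](@mean_cst R k) -meanD; apply: mean_le => a.
        by have := h a; rewrite ler_norml => /andP[]; lra.
      rewrite -[X in X + _](@mean_cst R k) -meanD; apply: mean_le => a.
      by have := h a; rewrite ler_norml => /andP[]; lra.
    exists g => //; apply: (@prQle (fun x => r < `|f x - g x.1|)) => u /=.
    have V : variance_cube (fun a => f (u, a)) <= k%:R * c ^+ 2 / 4.
      apply: variance_cube_le; first exact: ltW.
      move=> a b; apply: (le_trans (fL _ _)); rewrite /= /d /spread_dist /two_dist /= eqxx mulr0 add0r.
      by rewrite ge_min lexx.
    apply: (le_trans (chebyshev_cube r0 V)).
    rewrite ler_pdivrMr ?exprn_gt0 //.
    have -> : k%:R * c ^+ 2 / 4 = 4 * tau ^+ 2 / k%:R by rewrite /c; field; rewrite gt_eqF.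
    rewrite ler_pdivrMr //.
    move: k1; rewrite ler_pdivrMr ?exprn_gt0 // => k1.
    by rewrite (le_trans k1) // -exprS mulrC.
  exists (g \o fst).
    move=> x y; apply: (le_trans (gL _ _)); rewrite /= /d /spread_dist lerDl.
    by rewrite le_min (ltW tau0) andbT mulr_ge0 ?hamming_ge0 // ltW.
  have -> : [set t | r < `|g ((fst \o phi) t) - (g \o fst) (phi t)|] = set0.
    by apply/seteqP; split => t //=; rewrite subrr normr0 ltNge ltW.
  by rewrite /prI measure0 ltW.
- move=> x; pose Q y := `[< d x y <> two_dist s x.1 y.1 + tau >].
  have E : [set t | d x (phi t) <> two_dist s x.1 (phi t).1 + tau] = [set t | Q (phi t)].
    by apply/seteqP; split => t /= /asboolP.
  rewrite /= E; split; first exact: (measurable_fin_preimage Q mfib).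
  apply: prQle => u; apply: (@le_trans _ _ (4 / k%:R)); last first.
    by move: k2; rewrite !ler_pdivrMr // mulrC.
  apply: le_trans (hamming_concentration x.2 (ltn0Sn _)); apply: mean_le => a.
  rewrite ler_nat; case: (boolP (Q _)) => // /asboolP h; rewrite lt0n eqb0 negbK.
  rewrite ltNge; apply/negP => hk; apply: h; rewrite /d /spread_dist /=; congr (_ + _).
  apply/min_idPr; apply: (@le_trans _ _ (c * (k%:R / 4))); last by rewrite ler_pM2l.
  by rewrite le_eqVlt; apply/orP; left; apply/eqP; rewrite /c; field; rewrite gt_eqF.
Qed.

End SpreadSpaces.

(** * Distinct subset sums *)

Section SubsetSums.
Local Open Scope set_scope.
Local Open Scope nat_scope.

Lemma sum_pow2_lt (T : finType) (h : T -> nat) (A : {set T}) (m : nat) :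
  {in A &, injective h} -> (forall x, x \in A -> h x < m) -> \sum_(x in A) 2 ^ h x < 2 ^ m.
Proof.
elim: m A => [|m IH] A hA Am.
  by rewrite big_pred0 // => x; apply/negP => /Am.
pose B := [set x in A | h x != m].
have BA x : x \in B -> x \in A by rewrite inE => /andP[].
have hB : \sum_(x in B) 2 ^ h x < 2 ^ m.
  apply: IH => [x y /BA xA /BA yA|x]; first exact: hA.
  by rewrite inE => /andP[/Am]; rewrite ltnS leq_eqVlt => /orP[/eqP ->|//]; rewrite eqxx.
rewrite (bigID (fun x => h x == m)) /= expnS mul2n -addnn -addnS leq_add //.
  case: (pickP (fun x => (x \in A) && (h x == m))) => [x /andP[xA /eqP xm]|none]; last first.
    by rewrite big_pred0.
  rewrite (big_pred1 x) ?xm // => y; apply/andP/eqP => [[yA /eqP ym]|->]; last by rewrite xA xm eqxx.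
  by apply: hA => //; rewrite xm.
by rewrite (eq_bigl (mem B)) // => x; rewrite !inE.
Qed.

(** At the largest exponent where the sets differ, one side has a power of two that the smaller
    exponents of the other cannot make up for. *)
Lemma sum_pow2_inj (T : finType) (h : T -> nat) (A B : {set T}) : injective h ->
  \sum_(x in A) 2 ^ h x = \sum_(x in B) 2 ^ h x -> A = B.
Proof.
move=> hi E; apply/eqP/negPn/negP => AB.
have [x0 hx0] : exists x, (x \in A) != (x \in B).
  apply/existsP; apply: contraR AB => /existsPn nh; apply/eqP/setP => x.
  by apply/eqP; have := nh x; rewrite negbK.
have [x hx xmax] := @arg_maxnP _ x0 (fun x => (x \in A) != (x \in B)) h hx0.
have split (C : {set T}) : \sum_(y in C) 2 ^ h y =
    (\sum_(y in C | h y < h x) 2 ^ h y) + ((x \in C) * 2 ^ h x + \sum_(y in C | h x < h y) 2 ^ h y).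
  rewrite (bigID (fun y => h y < h x)) /=; congr (_ + _).
  rewrite (bigID (fun y => h y == h x)) /=; congr (_ + _).
    case: (boolP (x \in C)) => xC; last first.
      rewrite big_pred0 ?mul0n // => y; apply/negP => /andP[/andP[yC _] /eqP/hi yx].
      by rewrite yx (negbTE xC) in yC.
    rewrite mul1n (big_pred1 x) // => y; rewrite /= (inj_eq hi).
    by case: eqP => [->|_]; rewrite ?andbF // xC ltnn.
  by apply: eq_bigl => y; rewrite -leqNgt -andbA; congr (_ && _); rewrite andbC ltn_neqAle eq_sym.
have high : \sum_(y in A | h x < h y) 2 ^ h y = \sum_(y in B | h x < h y) 2 ^ h y.
  apply: eq_bigl => y; case: (ltnP (h x) (h y)) => xy; rewrite ?andbF // !andbT.
  by apply/eqP/negPn/negP => /xmax yx; have := leq_ltn_trans yx xy; rewrite ltnn.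
have low (C : {set T}) : \sum_(y in C | h y < h x) 2 ^ h y < 2 ^ h x.
  rewrite (eq_bigl (mem [set y in C | h y < h x])); last by move=> y; rewrite !inE.
  by apply: sum_pow2_lt => [y z _ _|y]; [exact: hi|rewrite inE => /andP[]].
move: E; rewrite !split high !addnA => /addIn.
have := low A; have := low B; move: hx.
case: (x \in A); case: (x \in B) => // _; rewrite ?mul1n ?mul0n ?addn0.
  by move=> lB _ E; move: lB; rewrite -E ltnNge leq_addl.
by move=> _ lA E; move: lA; rewrite E ltnNge leq_addl.
Qed.

Definition bcode (N : nat) (u : {ffun 'I_N -> bool}) : nat := \sum_(i | u i) 2 ^ i.

Lemma bcode_inj N : injective (@bcode N).
Proof.
move=> u v uv; have := @sum_pow2_inj _ val [set i | u i] [set i | v i] val_inj.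
have E (w : {ffun 'I_N -> bool}) : \sum_(x in [set i | w i]) 2 ^ val x = @bcode N w.
  by apply: eq_bigl => i; rewrite inE.
rewrite !E => /(_ uv) /setP h; apply/ffunP => i.
by have := h i; rewrite !inE.
Qed.

End SubsetSums.

Section Masses.
Local Open Scope set_scope.
Local Open Scope ring_scope.
Context {R : realType} {N : nat}.

(** A coin with odds [2 ^ 2 ^ i] to 1. *)
Definition heads (i : nat) : R := (2 ^ 2 ^ i)%:R / (1 + (2 ^ 2 ^ i)%:R).

Lemma heads_itv i : 0 < heads i < 1.
Proof.
have h : 0 < (2 ^ 2 ^ i)%:R :> R by rewrite ltr0n expn_gt0.
by rewrite /heads divr_gt0 ?ltr_pdivrMr; lra.
Qed.

Definition mass (u : {ffun 'I_N -> bool}) : R :=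
  \prod_i (if u i then heads i else 1 - heads i).

Definition mass_norm : R := \prod_(i < N) (1 + (2 ^ 2 ^ i)%:R).

Lemma mass_norm_gt0 : 0 < mass_norm.
Proof. by apply: prodr_gt0 => i _; rewrite ltr_pwDl. Qed.

(* This choice of the success probabilities makes the masses proportional to
   distinct powers of two, so that their subset sums are all distinct. *)
Lemma massE u : mass u = (2 ^ bcode u)%:R / mass_norm.
Proof.
have -> : mass u = \prod_i ((if u i then (2 ^ 2 ^ i)%:R else 1) / (1 + (2 ^ 2 ^ i)%:R)).
  apply: eq_bigr => i _; case: (u i) => //; rewrite /heads.
  have h : 0 < (2 ^ 2 ^ i)%:R :> R by rewrite ltr0n expn_gt0.
  by field; lra.
rewrite prodf_div; congr (_ / _).
by rewrite /bcode expn_sum natr_prod -big_mkcond.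
Qed.

(** Weights are integers divided by [mass_norm], so at this distance the integers coincide. *)
Lemma mass_sum_gap (A B : {set {ffun 'I_N -> bool}}) :
  `|weight mass A - weight mass B| < mass_norm^-1 -> A = B.
Proof.
have E (C : {set {ffun 'I_N -> bool}}) :
    weight mass C = (\sum_(u in C) 2 ^ bcode u)%N%:R / mass_norm.
  by rewrite /weight natr_sum mulr_suml; apply: eq_bigr => u _; exact: massE.
rewrite !E -mulrBl normrM (ger0_norm (ltW _ : 0 <= mass_norm^-1)) ?invr_gt0 ?mass_norm_gt0 //.
rewrite -[ltRHS]mul1r ltr_pM2r ?invr_gt0 ?mass_norm_gt0 // => h.
apply: (@sum_pow2_inj _ (@bcode N)); first exact: bcode_inj.
apply/eqP; rewrite eqn_leq; move: h; rewrite ltr_norml => /andP[h1 h2].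
by apply/andP; split; rewrite -ltnS -(ltr_nat R) -natr1; lra.
Qed.

Lemma mass_ge u : mass_norm^-1 <= mass u.
Proof. by rewrite massE ler_peMl ?invr_ge0 ?(ltW mass_norm_gt0) // ler1n expn_gt0. Qed.

End Masses.

Section FiniteGap.
Context {R : realType}.

Lemma fin_gap (U : finType) (g : U -> R) : exists2 del : R, 0 < del &
  forall u v, g u != g v -> del <= `|g u - g v|.
Proof.
pose P (p : U * U) := g p.1 != g p.2.
case: (pickP P) => [p0 Pp0|none]; last first.
  by exists 1 => // u v uv; have := none (u, v); rewrite /P uv.
have [p Pp pmin] := arg_minP (fun p : U * U => `|g p.1 - g p.2|) Pp0.
exists `|g p.1 - g p.2|; first by rewrite normr_gt0 subr_eq0.
by move=> u v uv; exact: (pmin (u, v)).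
Qed.

End FiniteGap.

(** * Recovering a function from its law *)

Section LawDeterminesFunction.
Context {R : realType}.

Lemma approxW (X Y : mmspace R) phi psi (r e : R) : gparam X phi -> gparam Y psi -> r <= e ->
  approx X Y phi psi r -> approx X Y phi psi e.
Proof.
move=> gX gY re h f fL; have [g gL hg] := h f fL; exists g => //.
apply: le_trans (le_trans hg re); apply: le_prI; try exact: measurable_far.
by move=> t [_] /=; exact: le_lt_trans.
Qed.

Lemma Lip1_law (X : mmspace R) phi phi' f (v r : R) : is_metric (mm_d X) ->
  gparam X phi -> gparam X phi' -> Lip1 X f ->
  prI [set t | `|f (phi t) - v| <= r] = prI [set t | `|f (phi' t) - v| <= r].
Proof.
move=> mX [_ h] [_ h'] fL.
have mA : measurable ([set x | `|f x - v| <= r] : set (Borel (mm_d X))).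
  have -> : [set x | `|f x - v| <= r] = ~` [set x | r < `|f x - v|].
    by apply/seteqP; split => x /=; rewrite leNgt => /negP.
  apply: measurableC; apply: measurable_dopen => x /= rx.
  exists (`|f x - v| - r); first by rewrite subr_gt0.
  move=> y /= xy; have := ler_distD (f y) (f x) v; have := fL x y; lra.
by rewrite /prI (h _ mA) -(h' _ mA).
Qed.

Lemma measurable_close (X : mmspace R) phi f (v r : R) : gparam X phi -> Lip1 X f ->
  measurable ([set t | `|f (phi t) - v| <= r] : set (measurableTypeR R)).
Proof.
move=> gX fL.
have -> : [set t | `|f (phi t) - v| <= r] = ~` [set t | r < `|f (phi t) - cst v t|].
  by apply/seteqP; split => x /=; rewrite leNgt => /negP.
apply: measurableC; apply: measurable_far_set; last exact: measurable_cst.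
exact: (measurable_Lip1 gX fL).
Qed.

(** The two couplings share only the law of [f]. Through it, the level set [A] of [g'] and the set
    [B] where [g] is within [2 * e] of that level have masses within [2 * e], less than [gap], so
    they coincide. Two transfers turn [2 * e] into [3 * e] and then [4 * e], below the separation of
    the values of [g']. *)
Lemma law_determines (X Y : mmspace R) phi phi' psi psi' f g g' (e gap : R)
    (U : finType) (emb : mm_T Y -> U) (une : U -> mm_T Y) (m : U -> R) :
  is_metric (mm_d X) -> cancel emb une -> 0 < e ->
  gparam X phi -> gparam X phi' -> gparam Y psi -> gparam Y psi' ->
  Lip1 X f -> Lip1 Y g -> Lip1 Y g' ->
  (forall u, measurable ([set t | emb (psi t) = u] : set (measurableTypeR R))) ->
  (forall u, measurable ([set t | emb (psi' t) = u] : set (measurableTypeR R))) ->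
  (forall u, prI [set t | emb (psi t) = u] = m u) ->
  (forall u, prI [set t | emb (psi' t) = u] = m u) ->
  (forall A B : {set U}, `|weight m A - weight m B| < gap -> A = B) -> 2 * e < gap ->
  (forall u v, g' (une u) != g' (une v) -> 4 * e < `|g' (une u) - g' (une v)|) ->
  prI [set t | e < `|f (phi t) - g (psi t)|] <= e ->
  prI [set t | e < `|f (phi' t) - g' (psi' t)|] <= e ->
  forall u, `|g (une u) - g' (une u)| <= 2 * e.
Proof.
move=> metX embK e0 gX gX' gY gY' fL gL gL' mpsi mpsi' hm hm' mgap egap g'gap hg hg' u0.
pose v := g' (une u0).
pose A : {set U} := [set u | g' (une u) == v]%SET.
pose B : {set U} := [set u | `|g (une u) - v| <= 2 * e]%SET.
have wA : weight m A = prI [set t | g' (psi' t) == v].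
  rewrite /weight; under eq_bigr => u _ do rewrite -hm'.
  rewrite -(prI_fin (fun u => u \in A) mpsi'); congr prI.
  by apply/seteqP; split => t /=; rewrite inE embK.
have wB : weight m B = prI [set t | `|g (psi t) - v| <= 2 * e].
  rewrite /weight; under eq_bigr => u _ do rewrite -hm.
  rewrite -(prI_fin (fun u => u \in B) mpsi); congr prI.
  by apply/seteqP; split => t /=; rewrite inE embK.
have mA : measurable ([set t | g' (psi' t) == v] : set (measurableTypeR R)).
  have := measurable_fin_preimage (fun u => u \in A) mpsi'.
  by congr measurable; apply/seteqP; split => t /=; rewrite inE embK.
have mfar := measurable_far e gX gY fL gL.
have mfar' := measurable_far e gX' gY' fL gL'.
have h1 : weight m A <= weight m B + 2 * e.
  rewrite wA wB.
  have s1 : prI [set t | g' (psi' t) == v] <= prI [set t | `|f (phi' t) - v| <= e] + e.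
    apply: le_trans (lerD (lexx _) hg'); apply: le_trans (prIU_le _ _) => //; last exact: measurable_close.
    apply: le_prI => //; first by apply: measurableU => //; exact: measurable_close.
    move=> t [_ /= /eqP tv]; case: (leP `|f (phi' t) - v| e); [by left|right].
    by rewrite /= tv.
  have s2 : prI [set t | `|f (phi t) - v| <= e] <= prI [set t | `|g (psi t) - v| <= 2 * e] + e.
    apply: le_trans (lerD (lexx _) hg); apply: le_trans (prIU_le _ _) => //; last exact: measurable_close.
    apply: le_prI; [exact: measurable_close|by apply: measurableU => //; exact: measurable_close|].
    move=> t [_ /= tv]; case: (leP `|f (phi t) - g (psi t)| e) => h; [left|by right].
    by move: tv h => /=; rewrite !ler_norml => /andP[? ?] /andP[? ?]; apply/andP; split; lra.
  by rewrite (Lip1_law v e metX gX' gX fL) in s1; lra.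
have h2 : weight m B <= weight m A + 2 * e.
  rewrite wA wB.
  have s1 : prI [set t | `|g (psi t) - v| <= 2 * e] <= prI [set t | `|f (phi t) - v| <= 3 * e] + e.
    apply: le_trans (lerD (lexx _) hg); apply: le_trans (prIU_le _ _) => //; last exact: measurable_close.
    apply: le_prI; [exact: measurable_close|by apply: measurableU => //; exact: measurable_close|].
    move=> t [_ /= tv]; case: (leP `|f (phi t) - g (psi t)| e) => h; [left|by right].
    by move: tv h => /=; rewrite !ler_norml => /andP[? ?] /andP[? ?]; apply/andP; split; lra.
  have s2 : prI [set t | `|f (phi' t) - v| <= 3 * e] <= prI [set t | g' (psi' t) == v] + e.
    apply: le_trans (lerD (lexx _) hg'); apply: le_trans (prIU_le _ _) => //.
    apply: le_prI; [exact: measurable_close|exact: measurableU|].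
    move=> t [_ /= tv]; case: (leP `|f (phi' t) - g' (psi' t)| e) => h; [left|by right].
    apply/negPn/negP => ne; have := g'gap (emb (psi' t)) u0; rewrite embK => /(_ ne).
    rewrite -/v ltNge; apply/negP/negPn.
    by move: tv h => /=; rewrite !ler_norml => /andP[? ?] /andP[? ?]; apply/andP; split; lra.
  by rewrite (Lip1_law v (3 * e) metX gX gX' fL) in s1; lra.
have AB : A = B.
  apply: mgap; apply: le_lt_trans egap; rewrite ler_norml; apply/andP; split; lra.
have : u0 \in B by rewrite -AB inE.
by rewrite inE.
Qed.

End LawDeterminesFunction.

(** * Condition (1) implies condition (2) *)

Section Necessity.
Context {R : realType} {N : nat}.
Context (Fn : nat -> ('I_N -> R) -> R) (F : ('I_N -> R) -> R).
Hypotheses (FnN : forall n, FN (Fn n)) (FNF : FN F)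
  (FnF : forall s, nonneg_vec s -> Fn n s @[n --> \oo] --> F s).

Definition product_stable : Prop :=
  forall (X : nat -> 'I_N -> mmspace R) (Y : 'I_N -> mmspace R),
    (forall n i, is_mm (X n i)) -> (forall i, is_mm (Y i)) ->
    (forall i, concentrates (fun n => X n i) (Y i)) ->
    forall (mu : forall n, probability (Borel (dF (Fn n) (X n))) R)
           (nu : probability (Borel (dF F Y)) R),
    (forall n, is_product_measure (Fn n) (X n) (mu n)) -> is_product_measure F Y nu ->
    concentrates (fun n => product_mm (Fn n) (X n) (mu n)) (product_mm F Y nu).

(** The spaces to be built need positive [s' i] and [tau n i]. Moving [s] by [del / 2] and the
    near-minimiser [b] by [del] makes both positive, at the cost of [e / 8] each. *)
Lemma nonvanishing_gap (s : 'I_N -> R) (e : R) : nonneg_vec s -> 0 < e ->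
  (forall n0, exists2 n, (n0 <= n)%N & e < Fn n s - Finf (Fn n) s) ->
  exists s' : 'I_N -> R, (forall i, 0 < s' i) /\
  exists2 e' : R, 0 < e' & exists tau : nat -> 'I_N -> R, (forall n i, 0 < tau n i) /\
    forall n0, exists2 n, (n0 <= n)%N & Fn n (fun i => s' i + tau n i) < Fn n s' - e'.
Proof.
move=> s0 e0 hs.
have [del del0 [n1 h1]] := FN_evt_small_near0 FnN FNF FnF (e := e / 8) ltac:(lra).
pose s' i := s i + del / 2.
have s'0 i : 0 < s' i by rewrite /s'; have := s0 i; lra.
exists s'; split=> //; exists (e / 2); first by lra.
pose P n (t : 'I_N -> R) := (forall i, 0 < t i) /\ Fn n (fun i => s' i + t i) < Fn n s' - e / 2.
(* For indices without a gap, any positive vector will do, as the family of spaces must be defined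
   for every [n]. *)
have /choice[tau htau] : forall n, exists t : 'I_N -> R, (forall i, 0 < t i) /\
    ((exists t, P n t) -> P n t).
  move=> n; have [[t [t0 ht]]|nP] := pselect (exists t, P n t).
    by exists t; split.
  by exists (fun=> 1); split.
exists tau; split=> [n i|n0]; first exact: (htau n).1.
have [n] := hs (maxn n0 n1); rewrite geq_max => /andP[n0n n1n] gap.
exists n => //; apply: ((htau n).2 _).2.
have [b sb Fb] : exists2 b, (forall i, s i <= b i) & Fn n b < Fn n s - e.
  have /inf_lt[] : Finf (Fn n) s < Fn n s - e by lra.
    by exists (Fn n s), s.
  by move=> _ [b sb <-] hb; exists b.
have Fmp := (FnN n).1.
have b0 : nonneg_vec b by move=> i; exact: le_trans (s0 i) (sb i).
exists (fun i => b i + del - s' i); split.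
  by move=> i; rewrite /s'; have := sb i; lra.
have -> : (fun i => s' i + (b i + del - s' i)) = (fun i => b i + del).
  by apply/funext => i; lra.
have bd0 : nonneg_vec (fun i => b i + del) by move=> i; have := b0 i; lra.
have := metric_preserving_dist Fmp bd0 b0.
have -> : (fun i => `|b i + del - b i|) = (fun=> del).
  by apply/funext => i; rewrite addrAC subrr add0r gtr0_norm.
have := h1 n n1n (fun=> del) (fun=> ltW del0) (fun=> lexx _).
have := metric_preserving_dist Fmp s0 (fun i => ltW (s'0 i)).
have -> : (fun i => `|s i - s' i|) = (fun=> del / 2).
  by apply/funext => i; rewrite /s' opprD addrA subrr add0r normrN gtr0_norm //; lra.
have d2 : 0 <= del / 2 by lra.
have d2' : del / 2 <= del by lra.
have := h1 n n1n (fun=> del / 2) (fun=> d2) (fun=> d2').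
by lra.
Qed.

Lemma dopen_two_dist (s : R) (A : set bool) : 0 < s -> dopen (two_dist s) A.
Proof.
move=> s0 u Au; exists s => // v /=; rewrite /two_dist; case: eqP => [<- //|_].
by rewrite mulr1 ltxx.
Qed.

Lemma two_point_mass (s p : R) (u : bool) : 0 < p < 1 ->
  fine (mm_P (two_point s p) [set u]) = if u then p else 1 - p.
Proof.
move=> /andP[p0 p1]; rewrite -[LHS]/(prI [set t | (t < p) = u]).
have p01 : 0 <= p <= 1 by rewrite !ltW.
case: u; first by rewrite -[RHS]prI_below.
rewrite -[p in RHS]prI_below // -prIC; last exact: (measurable_below p true).
by congr prI; apply/seteqP; split => t /=; case: (t < p) => //= /(_ isT).
Qed.

Lemma spread_family (s : 'I_N -> R) (tau : nat -> 'I_N -> R) (r : nat -> R) :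
  (forall i, 0 < s i) -> (forall n i, 0 < tau n i) -> (forall n, 0 < r n) ->
  exists (X : nat -> 'I_N -> mmspace R) (phi : forall n i, R -> Borel (mm_d (X n i)))
    (cl : forall n i, mm_T (X n i) -> bool), forall n i,
  [/\ is_mm (X n i), gparam (X n i) (phi n i),
    gparam (two_point (s i) (heads i)) (cl n i \o phi n i),
    approx (X n i) (two_point (s i) (heads i)) (phi n i) (cl n i \o phi n i) (r n) /\
    approx (two_point (s i) (heads i)) (X n i) (cl n i \o phi n i) (phi n i) (r n) &
    forall x, measurable ([set t | mm_d (X n i) x (phi n i t) <>
          two_dist (s i) (cl n i x) (cl n i (phi n i t)) + tau n i] : set (measurableTypeR R)) /\
        prI [set t | mm_d (X n i) x (phi n i t) <>
          two_dist (s i) (cl n i x) (cl n i (phi n i t)) + tau n i] <= r n].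
Proof.
move=> s0 tau0 r0.
have H n i := spread_space (s0 i) (tau0 n i) (heads_itv i) (r0 n).
have HX n i := svalP (cid (H n i)); have Hphi n i := svalP (cid (HX n i)).
exists (fun n i => sval (cid (H n i))), (fun n i => sval (cid (HX n i))),
  (fun n i => sval (cid (Hphi n i))) => n i.
exact: (svalP (cid (Hphi n i))).
Qed.

(** The image of the uniform law under [prodmap] is the product measure. *)
Lemma product_measure_exists (G : nat -> ('I_N -> R) -> R) (X : nat -> 'I_N -> mmspace R)
    (phi : forall n i, R -> Borel (mm_d (X n i))) :
  (forall n, FN (G n)) -> (forall n i, is_mm (X n i)) ->
  (forall n i, gparam (X n i) (phi n i)) ->
  exists mu : forall n, probability (Borel (dF (G n) (X n))) R,
    forall n, is_product_measure (G n) (X n) (mu n).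
Proof.
move=> GN mX gphi.
exists (fun n => push_prob (measurable_prodmap (GN n) (mX n) (gphi n))) => n A mA.
exact: (lebI_prodmap_rect (G n) (gphi n) mA).
Qed.

Section Counterexample.
Variables (s : 'I_N -> R) (eps : R) (tau : nat -> 'I_N -> R).
Hypotheses (s0 : forall i, 0 < s i) (eps0 : 0 < eps) (tau0 : forall n i, 0 < tau n i).
Hypothesis gap : forall n0, exists2 n, (n0 <= n)%N &
  Fn n (fun i => s i + tau n i) < Fn n s - eps.

Let Y (i : 'I_N) : mmspace R := two_point (s i) (heads i).

Let mY i : is_mm (Y i). Proof. exact: two_point_mm. Qed.

Variable nu : probability (Borel (dF F Y)) R.
Hypothesis pnu : is_product_measure F Y nu.

Definition cluster (x : prodT (fun i => mm_T (Y i))) : {ffun 'I_N -> bool} :=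
  [ffun i => (x i : bool)].

Definition cluster_pt (u : {ffun 'I_N -> bool}) : prodT (fun i => mm_T (Y i)) :=
  [ffun i => (u i : mm_T (Y i))].

Let clusterK : cancel cluster cluster_pt.
Proof. by move=> x; apply/ffunP => i; rewrite !ffunE. Qed.

Let cluster_law psi u : gparam (product_mm F Y nu) psi ->
  measurable ([set t | cluster (psi t) = u] : set (measurableTypeR R)) /\
  prI [set t | cluster (psi t) = u] = mass u.
Proof.
move=> [mpsi hpsi].
pose A i : set (Borel (mm_d (Y i))) := [set (u i : mm_T (Y i))].
have mA i : measurable (A i).
  by apply: sub_sigma_algebra; apply: dopen_two_dist.
pose B : set (Borel (dF F Y)) := [set x : prodT (fun i => mm_T (Y i)) | forall i, A i (x i)].
have mB : measurable B by apply: measurable_rects => //; exists A.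
have E : [set t | cluster (psi t) = u] = psi @^-1` B.
  apply/seteqP; split => t /= => [ut i|h]; first by rewrite /A /= -ut ffunE.
  by apply/ffunP => i; rewrite ffunE; exact: h.
rewrite E; split; first by have := mpsi measurableT B mB; rewrite setTI.
transitivity (fine (nu B)); first by rewrite /prI (hpsi B mB).
have -> : nu B = _ := pnu mA.
rewrite /= /mass.
by apply: eq_bigr => i _; exact: (two_point_mass (s i) (u i) (heads_itv i)).
Qed.

Lemma counterexample : ~ product_stable.
Proof.
move=> H1.
have e_gt0 := eps0.
pose r n : R := n.+1%:R^-1.
have r0 n : 0 < r n by rewrite invr_gt0.
have [X [phi [cl Hcl]]] := spread_family s0 tau0 r0.
have mX n i : is_mm (X n i) by have [] := Hcl n i.
have gphi n i : gparam (X n i) (phi n i) by have [] := Hcl n i.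
have gpsi n i : gparam (Y i) (cl n i \o phi n i) by have [] := Hcl n i.
have r_small (e : R) : 0 < e -> exists n0, forall n, (n0 <= n)%N -> r n <= e.
  move=> e0; exists (Num.truncn e^-1) => n hn.
  rewrite /r invf_ple ?posrE //; apply: ltW; apply: (lt_le_trans (truncnS_gt _)).
  by rewrite ler_nat.
have XY i : concentrates (fun n => X n i) (Y i).
  apply/concentratesP => [n|e e0]; first by have [] := mX n i.
  have [n0 hn0] := r_small (e / 2) ltac:(lra).
  exists n0 => n /hn0 rn; have [_ _ _ [a1 a2] _] := Hcl n i.
  apply: le_lt_trans (dconc_le (ltW (r0 n)) (gphi n i) (gpsi n i) a1 a2) _.
  by rewrite lte_fin; lra.
have [mu pmu] := product_measure_exists FnN mX gphi.
have /concentratesP conc := H1 X Y mX mY XY mu nu pmu pnu.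
have {}conc e : 0 < e -> exists n0, forall n, (n0 <= n)%N ->
    (dconc (product_mm (Fn n) (X n) (mu n)) (product_mm F Y nu) < e%:E)%E.
  by apply: conc => n; exact: (dF_metric (FnN n) (mX n)).
pose u0 : {ffun 'I_N -> bool} := [ffun=> false]; pose u1 : {ffun 'I_N -> bool} := [ffun=> true].
(* The function that cannot be imitated: it separates the extreme clusters by the full [F s]. *)
pose g0 (x : prodT (fun i => mm_T (Y i))) := dF F Y x (cluster_pt u0).
have metPY : is_metric (mm_d (product_mm F Y nu)) by exact: (dF_metric FNF mY).
have g0L : Lip1 (product_mm F Y nu) g0 by exact: (dist_Lip1 (Z := product_mm F Y nu)).
have g00 : g0 (cluster_pt u0) = 0 by have [_ dE _ _] := metPY; exact: (dE _ _).2.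
have g01 : g0 (cluster_pt u1) = F s.
  rewrite /g0 /dF; congr F; apply/funext => i; rewrite !ffunE.
  by rewrite -[LHS]/(two_dist (s i) true false) /two_dist mulr1.
have [del del0 hdel] := fin_gap (fun u => g0 (cluster_pt u)).
have Z0 := mass_norm_gt0 (R := R) (N := N).
pose z : R := (mass_norm (N := N))^-1; have z0 : 0 < z by rewrite invr_gt0.
(* The three bounds serve the final contradiction, the comparison of masses, and the separation of
   the values of [g0]. *)
pose e := Num.min (eps / 8) (Num.min (z / 8) (del / 8)).
have e0 : 0 < e by rewrite !lt_min; apply/and3P; split; lra.
have e_eps : e <= eps / 8 by rewrite ge_min lexx.
have e_z : e <= z / 8 by rewrite !ge_min lexx orbT.
have e_del : e <= del / 8 by rewrite !ge_min lexx !orbT.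
have [eta eta0 [n1 hn1]] := product_coupling FnN FNF FnF mY e0.
have [n2 hn2] := r_small eta eta0.
have [n3 hn3] := conc e e0.
have [n4 hn4] := r_small (z / (8 * N.+1%:R)) ltac:(by rewrite divr_gt0 // mulr_gt0 // ltr0n).
have /cvgrPdist_le/(_ e e0)[n5 _ hn5] := FnF (fun i => ltW (s0 i)).
have [n] := gap (maxn n1 (maxn n2 (maxn n3 (maxn n4 n5)))).
rewrite !geq_max => /and5P[n1n n2n n3n n4n n5n] gapn.
have aXY i : approx (X n i) (Y i) (phi n i) (cl n i \o phi n i) eta.
  by have [_ _ _ [a1 _] _] := Hcl n i; exact: approxW (gphi n i) (gpsi n i) (hn2 n n2n) a1.
have aYX i : approx (Y i) (X n i) (cl n i \o phi n i) (phi n i) eta.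
  by have [_ _ _ [_ a2] _] := Hcl n i; exact: approxW (gpsi n i) (gphi n i) (hn2 n n2n) a2.
have [ap _] := hn1 n n1n (X n) (phi n) (fun i => cl n i \o phi n i) (mX n) (gphi n) (gpsi n)
  aXY aYX (mu n) nu (pmu n) pnu.
pose Phi := @prodmap R N (Fn n) (X n) (phi n).
pose Psi := @prodmap R N F Y (fun i => cl n i \o phi n i).
have gPhi : gparam (product_mm (Fn n) (X n) (mu n)) Phi by exact: prodmap_gparam.
have gPsi : gparam (product_mm F Y nu) Psi by exact: prodmap_gparam.
have metPX : is_metric (mm_d (product_mm (Fn n) (X n) (mu n))) by exact: (dF_metric (FnN n) (mX n)).
(* These parameters come from the assumed concentration and are unrelated to [Phi] and [Psi]; [f]
   imitates [g0] through them, and [g] imitates [f] through the explicit coupling. *)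
have [Phi' [Psi' [gPhi' gPsi' _ ap']]] := dconc_lt (hn3 n n3n).
have [f fL hf'] := ap' g0 g0L.
have [g gL hg] := ap f fL.
have {}hf' : prI [set t | e < `|f (Phi' t) - g0 (Psi' t)|] <= e.
  rewrite (_ : [set t | _] = [set t | e < `|g0 (Psi' t) - f (Phi' t)|]) //.
  by apply/seteqP; split => t /=; rewrite distrC.
have gg0 : forall u, `|g (cluster_pt u) - g0 (cluster_pt u)| <= 2 * e.
  apply: (@law_determines R (product_mm (Fn n) (X n) (mu n)) (product_mm F Y nu) Phi Phi' Psi Psi'
    f g g0 e z _ cluster cluster_pt mass) => //.
  - by move=> u; exact: (cluster_law u gPsi).1.
  - by move=> u; exact: (cluster_law u gPsi').1.
  - by move=> u; exact: (cluster_law u gPsi).2.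
  - by move=> u; exact: (cluster_law u gPsi').2.
  - by move=> A B; exact: mass_sum_gap.
  - by lra.
  - by move=> u v /hdel; lra.
pose far := [set t | e < `|f (Phi t) - g (Psi t)|].
have mfar : measurable (far : set (measurableTypeR R)) by exact: (measurable_far e gPhi gPsi fL gL).
have hfar : prI far <= e by exact: hg.
have [m0 p0] := cluster_law u0 gPsi; have [m1 p1] := cluster_law u1 gPsi.
have zle (u : {ffun 'I_N -> bool}) : z <= mass u by exact: mass_ge.
have [t0 [ct0 nft0]] : exists t0, cluster (Psi t0) = u0 /\ ~ far t0.
  apply: contrapT => /forallNP h.
  have : prI [set t | cluster (Psi t) = u0] <= prI far.
    by apply: le_prI => // t [_ /= ct]; apply: contrapT => nf; apply: (h t).
  by rewrite p0; have := zle u0; lra.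
(* The points at an untypical distance from the chosen [t0]. The cluster [u1] has mass at least [z],
   more than [far] and these sets together, so it contains a suitable [t1]. *)
pose W i := [set t | mm_d (X n i) (phi n i (theta i t0)) (phi n i t) <>
  two_dist (s i) (cl n i (phi n i (theta i t0))) (cl n i (phi n i t)) + tau n i].
have mW i : measurable (W i : set (measurableTypeR R)).
  by have [_ _ _ _ h] := Hcl n i; exact: (h _).1.
have hW i : prI (W i) <= r n by have [_ _ _ _ h] := Hcl n i; exact: (h _).2.
have [mE hE] := prI_ex_le (fun i => measurable_theta1 i (mW i)).
have hEz : prI [set t | exists i, W i (theta i t)] <= z / 8.
  apply: (le_trans hE); apply: (@le_trans _ _ (N%:R * r n)).
    rewrite -[N in N%:R]card_ord mulr_natl -sumr_const; apply: ler_sum => i _.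
    by rewrite (prI_theta1 i (mW i)).
  apply: (@le_trans _ _ (N.+1%:R * (z / (8 * N.+1%:R)))).
    by apply: ler_pM => //; [exact: ltW|rewrite ler_nat|exact: hn4].
  have zx (x : R) : 0 < x -> x * (z / (8 * x)) = z / 8 by move=> x0; field; rewrite gt_eqF.
  by rewrite zx // ltr0n.
have [t1 [ct1 nft1 nW]] : exists t1, [/\ cluster (Psi t1) = u1, ~ far t1 &
    forall i, ~ W i (theta i t1)].
  apply: contrapT => /forallNP h.
  have : prI [set t | cluster (Psi t) = u1] <= prI (far `|` [set t | exists i, W i (theta i t)]).
    apply: le_prI => //; first exact: measurableU.
    move=> t [_ /= ct]; apply: contrapT => /not_orP[nf nE].
    by apply: (h t); split=> // i Wi; apply: nE; exists i.
  have := prIU_le mfar mE.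
  by rewrite p1; have := zle u1; lra.
have dist i : mm_d (X n i) (phi n i (theta i t0)) (phi n i (theta i t1)) = s i + tau n i.
  have := contrapT (nW i) => ->; congr (_ + _).
  have c0 : cl n i (phi n i (theta i t0)) = false.
    by have /ffunP/(_ i) := ct0; rewrite !ffunE.
  have c1 : cl n i (phi n i (theta i t1)) = true.
    by have /ffunP/(_ i) := ct1; rewrite !ffunE.
  by rewrite c0 c1 /two_dist mulr1.
have := fL (Phi t1) (Phi t0); have [_ _ dC _] := metPX; rewrite dC.
have -> : mm_d (product_mm (Fn n) (X n) (mu n)) (Phi t0) (Phi t1) =
    Fn n (fun i => s i + tau n i).
  by rewrite /= /dF; congr (Fn n _); apply/funext => i; rewrite !ffunE dist.
have E0 : Psi t0 = cluster_pt u0 by rewrite -ct0 clusterK.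
have E1 : Psi t1 = cluster_pt u1 by rewrite -ct1 clusterK.
(* [f] increases by at least [F s - 6 * e] from [t0] to [t1], but by at most
   [Fn n (s + tau) < Fn n s - eps]. As [Fn n s] is within [e] of [F s], this would force
   [eps < 7 * e]. *)
move: nft0 nft1 (gg0 u0) (gg0 u1); rewrite /far /= E0 E1 g00 g01.
move=> /negP; rewrite -leNgt => a0 /negP; rewrite -leNgt => a1 a2 a3 a4.
have := hn5 n n5n; rewrite /= => a5.
move: a0 a1 a2 a3 a4 a5; rewrite !ler_norml.
by move=> /andP[? ?] /andP[? ?] /andP[? ?] /andP[? ?] /andP[? ?] /andP[? ?]; lra.
Qed.

End Counterexample.

Lemma product_stable_gap : product_stable ->
  forall s, nonneg_vec s -> Fn n s - Finf (Fn n) s @[n --> \oo] --> 0.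
Proof.
move=> H1 s s0; apply/cvgrPdist_le => e e0; apply: contrapT => hne.
have [|s' [s'0 [e' e'0 [tau [tau0 htau]]]]] := nonvanishing_gap s0 e0; last first.
  have [nu pnu] := product_measure_exists (G := fun=> F) (X := fun _ i => two_point (s' i) (heads i))
    (phi := fun _ i t => t < heads i) (fun=> FNF) (fun _ i => two_point_mm _ (s'0 i))
    (fun _ i => push_gparam _).
  exact: (counterexample s'0 e'0 tau0 htau (pnu 0%N) H1).
move=> n0; apply: contrapT => h; apply: hne; exists n0 => // n n0n /=.
rewrite sub0r normrN ger0_norm; last exact: Finf_gap_ge0.
by rewrite leNgt; apply/negP => lt; apply: h; exists n.
Qed.

End Necessity.

Theorem mainTheorem4 (R : realType) (N : nat)
  (Fn : nat -> ('I_N -> R) -> R) (F : ('I_N -> R) -> R) :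
  (forall n, FN (Fn n)) -> FN F ->
  (forall s, nonneg_vec s -> Fn n s @[n --> \oo] --> F s) ->
  [<->
   (* (1) *)
   (forall (X : nat -> 'I_N -> mmspace R) (Y : 'I_N -> mmspace R),
      (forall n i, is_mm (X n i)) -> (forall i, is_mm (Y i)) ->
      (forall i, concentrates (fun n => X n i) (Y i)) ->
      forall (mu : forall n, probability (Borel (dF (Fn n) (X n))) R)
             (nu : probability (Borel (dF F Y)) R),
      (forall n, is_product_measure (Fn n) (X n) (mu n)) -> is_product_measure F Y nu ->
      concentrates (fun n => product_mm (Fn n) (X n) (mu n)) (product_mm F Y nu));
   (* (2) *)
   (forall s, nonneg_vec s -> Fn n s - Finf (Fn n) s @[n --> \oo] --> 0);
   (* (3) *)
   (forall D : R, 0 < D ->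
      sup [set Fn n s - Finf (Fn n) s | s in [set s | forall i, 0 <= s i <= D]]
        @[n --> \oo] --> 0)].
Proof.
move=> FnN FNF FnF; split; first exact: (product_stable_gap FnN FNF FnF).
split; first exact: (gap_pointwise_sup FnN FNF FnF).
move=> gv X Y mX mY XY mu nu pmu pnu.
exact: (gap_vanishes_concentrates FnN FNF FnF gv mX mY XY pmu pnu).
Qed.
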